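(* Let $K$ be a field, let $\tau$ be an orientation such that the commutative ladder $\mathrm{CL}_n(\tau)$ is of finite type, and let $M$ be a persistence module on $\mathrm{CL}_n(\tau)$. Assume that the procedure MATRIX_REDUCTION (described in the context) is called with the block matrix problem of $M$ as input. Then MATRIX_REDUCTION terminates, and the input block matrix is transformed to an isomorphic block matrix (isomorphic as an object of the arrow category $\operatorname{arr}(\operatorname{rep}\mathbb{A}_n(\tau))$) which consists only of identity, zero, and strongly zero blocks, and whose indecomposable decomposition in $\operatorname{arr}(\operatorname{rep}\mathbb{A}_n(\tau))$ corresponds, under the isomorphism of categories $F:\operatorname{rep}\mathrm{CL}_n(\tau)\to\operatorname{arr}(\operatorname{rep}\mathbb{A}_n(\tau))$, to an indecomposable decomposition of $M$.
   Context: **Ladders and arrows.** $K$ is a fixed field. An orientation is a sequence $\tau=(\tau_1,\dots,\tau_{n-1})$ with $\tau_i\in\{f,b\}$, $n\ge 1$. $\mathbb{A}_n(\tau)$ is the quiver with vertices $1,\dots,n$ and, for each $i$, one arrow $i\to i+1$ if $\tau_i=f$ and $i\leftarrow i+1$ if $\tau_i=b$. The ladder quiver $L_n(\tau)$ consists of two copies of $\mathbb{A}_n(\tau)$ (bottom row with vertices $1,\dots,n$, top row with vertices $1',\dots,n'$) together with arrows $i\to i'$ for all $i$. The commutative ladder $\mathrm{CL}_n(\tau)$ is $L_n(\tau)$ bound by all commutativity relations ($p-p'$ for any two different paths $p,p'$ with the same source and the same target). A persistence module on $\mathrm{CL}_n(\tau)$ is a finite-dimensional $K$-representation of this bound quiver.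 ''Finite type'' means that there are only finitely many isomorphism classes of indecomposable representations; $\mathrm{CL}_n(\tau)$ is of finite type if and only if $n\le 4$. The arrow category $\operatorname{arr}(\operatorname{rep}\mathbb{A}_n(\tau))$ has as objects the morphisms $\phi:V\to W$ of $\operatorname{rep}\mathbb{A}_n(\tau)$; a morphism from $\phi_1:V_1\to W_1$ to $\phi_2:V_2\to W_2$ is a pair $(F_V:V_1\to V_2,\ F_W:W_1\to W_2)$ of morphisms of $\operatorname{rep}\mathbb{A}_n(\tau)$ with $F_W\phi_1=\phi_2F_V$; composition is componentwise. The isomorphism of categories $F:\operatorname{rep}\mathrm{CL}_n(\tau)\to\operatorname{arr}(\operatorname{rep}\mathbb{A}_n(\tau))$ sends $M$ to the morphism from its bottom row to its top row given by the vertical maps of $M$. **Intervals.** For $1\le b\le d\le n$, $\mathbb{I}[b,d]\in\operatorname{rep}\mathbb{A}_n(\tau)$ has $K$ at the vertices $b,\dots,d$ and $0$ elsewhere, with identity maps between the copies of $K$ and zero maps otherwise. These are, up to isomorphism, all the indecomposables of $\operatorname{rep}\mathbb{A}_n(\tau)$. Write $\mathbb{I}[a,b]\trianglerighteq\mathbb{I}[c,d]$ if $\operatorname{Hom}(\mathbb{I}[a,b],\mathbb{I}[c,d])\ne 0$. In that case this space is one-dimensional with basis $f_{a:b}^{c:d}$, where $(f_{a:b}^{c:d})_i=\mathrm{id}_K$ if $i\in[a,b]\cap[c,d]$ and $0$ otherwise. **Block matrix of $M$.** Write $F(M):V\to W$ and choose isomorphisms $\eta_V:V\cong\bigoplus\mathbb{I}[a,b]^{m_{a,b}}$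 and $\eta_W:W\cong\bigoplus\mathbb{I}[c,d]^{m'_{c,d}}$ (sums over $1\le a\le b\le n$ and $1\le c\le d\le n$). The morphism $\Phi(M)=\eta_WF(M)\eta_V^{-1}$ has components $\Phi_{a:b}^{c:d}:\mathbb{I}[a,b]^{m_{a,b}}\to\mathbb{I}[c,d]^{m'_{c,d}}$ with $\Phi_{a:b}^{c:d}=M_{a:b}^{c:d}f_{a:b}^{c:d}$, where $M_{a:b}^{c:d}$ is an $m'_{c,d}\times m_{a,b}$ matrix over $K$, if $\mathbb{I}[a,b]\trianglerighteq\mathbb{I}[c,d]$, and $\Phi_{a:b}^{c:d}=0$ otherwise. The block $\Phi_{a:b}^{c:d}$ is in row $c{:}d$ and column $a{:}b$. **Ordering.** Let $\Gamma$ be the Auslander–Reiten quiver of $\mathbb{A}_n(\tau)$, with vertices identified with the intervals $a{:}b$. Let $\ell$ be a function from the vertices of $\Gamma$ to $\mathbb{Z}$ with $\ell(y)=\ell(x)+1$ for every arrow $x\to y$ of $\Gamma$ (it exists and is unique up to an additive constant). The total order $\prec$ on intervals is: $x\prec y$ if $\ell(x)<\ell(y)$, and ties are resolved by reverse lexicographic order on pairs $(b,d)$ (the lexicographically larger pair comes first). For example, for $\tau=fb$: $2{:}2\prec 2{:}3\prec 1{:}2\prec 1{:}3\prec 3{:}3\prec 1{:}1$; for $\tau=fff$: $4{:}4\prec3{:}4\prec3{:}3\prec2{:}4\prec2{:}3\prec1{:}4\prec2{:}2\prec1{:}3\prec1{:}2\prec1{:}1$. **Block matrix problem of $M$.** This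 is $\Phi(M)$ with columns ordered from left to right in increasing $\prec$ and rows ordered from top to bottom in decreasing $\prec$, together with the following permissible operations: if $\mathbb{I}[a,b]\trianglerighteq\mathbb{I}[c,d]$, then operations from row $a{:}b$ to row $c{:}d$ (adding multiples of rows of $a{:}b$ to rows of $c{:}d$) are permissible, and operations to column $a{:}b$ from column $c{:}d$ (adding multiples of columns of $c{:}d$ to columns of $a{:}b$) are permissible. Other such operations are impermissible. Operations are carried out on the coefficient matrices over $K$; blocks with $\mathbb{I}[a,b]\not\trianglerighteq\mathbb{I}[c,d]$ always remain zero. An inner row (column) operation is an invertible row (column) operation affecting only the $K$-vector rows (columns) within one fixed row (column) block. Row and column blocks may be subdivided during the procedure; the parts keep the interval label, are placed consecutively, and inherit the permissibility rules (so operations between parts with the same interval are permissible in both directions), and ''inner'' then refers to a single part. **Statuses.** Each block has a status: $\emptyset$ (strongly zero: a block in row $c{:}d$ and column $a{:}b$ with $\mathbb{I}[a,b]\not\trianglerighteq\mathbb{I}[c,d]$), $*$ (unprocessed), $E$ (identity block), or $0$ (zero block). Blocks of status $\emptyset,E,0$ are processed. Initially all blocks that are not strongly zero have status $*$ (even if numerically zero or identity). Tests such as ''identity'', ''zero'', ''nonzero'' in the procedure refer to statuses; nonzero means neither $0$ nor $\emptyset$. Two distinct blocks are row (column) neighbors if they are in the same row (column). **MATRIX_REDUCTION.** While there are unprocessed blocks, do: 1. Let $v_*$ be the bottommost $*$ block of the rightmost column containing $*$ blocks. 2. Let $F_R=$ ROW_SIDE_EFFECT$(v_* )$ and $F_C=$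 COL_SIDE_EFFECT$(v_* )$, where ROW_SIDE_EFFECT$(v)$ (resp. COL_SIDE_EFFECT$(v)$) is the set of identity row (resp. column) neighbors of $v$. 3. Transform $v_*$ to the form $\begin{bmatrix}E&0\\0&0\end{bmatrix}$ ($E$ an identity matrix, possibly empty) by inner row and column operations on the whole block matrix. 4. For all $v'\in F_R$ do COL_FIX$(v')$; for all $v'\in F_C$ do ROW_FIX$(v')$. 5. Update the partitioning: split the row and column of $v_*$ in two, according to $\begin{bmatrix}E&0\\0&0\end{bmatrix}$, and split further rows and columns as needed so that each identity matrix is its own block; the diagonal pieces of a split identity block get status $E$ and the off-diagonal pieces status $0$; the pieces of $v_*$ get statuses $E$ and $0$; all other pieces inherit their status. 6. While there exists a nonzero block $v_t$ such that $p=$ ERASABLE$(v_t)$ is not null: zero out $v_t$ by traversing the process tree $p$ and performing the operations it indicates; $v_t$ then has status $0$. COL_FIX$(v)$: set $V'=$ COL_SIDE_EFFECT$(v)$; transform $v$ to an identity by inner column operations; for all $v'\in V'$ do ROW_FIX$(v')$. ROW_FIX$(v)$: set $V'=$ ROW_SIDE_EFFECT$(v)$; transform $v$ to an identity by inner row operations; for all $v'\in V'$ do COL_FIX$(v')$. ERASABLE$(v_t,v_f=\text{null},\textit{visited}=\{\})$: return the result of ROW_ERASABLE$(v_t,v_f,\textit{visited})$ if it is not null; else the result of COL_ERASABLE$(v_t,v_f,\textit{visited})$ if it is not null; else null. The set *visited* keeps track of the targets visited during one top-level call of ERASABLE, so that each block is visited as a target at most once per top-level call. ROW_ERASABLE$(v_t,v_f,\textit{visited})$: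 set $V'=$ COL_SIDE_EFFECT$(v_t)$ and add $v_t$ to *visited*. For each $v_E\in V'$ which is not in *visited*, with $v_E\ne v_f$, and such that row operations from the row of $v_E$ to the row of $v_t$ are permissible: set *usable* = true and *subtrees* = $\{\}$; for each nonzero row neighbor $u$ of $v_E$, let $v_t'$ be the block in the same row as $v_t$ and the same column as $u$; if $v_t'$ is in *visited* or $v_t'$ has status $E$, set *usable* = false and stop examining this $v_E$; if $v_t'$ has status $0$, let $p=$ ERASABLE$(v_t',u,\textit{visited})$, and if $p$ is null set *usable* = false and stop examining this $v_E$, otherwise add $p$ to *subtrees*. If *usable* is still true, return the process tree with root $(v_t,v_E)$ and arrows to the roots of *subtrees*. If no $v_E$ leads to a return, return null. COL_ERASABLE is the same with rows and columns interchanged: $V'=$ ROW_SIDE_EFFECT$(v_t)$; column operations from the column of $v_E$ to the column of $v_t$ must be permissible; $u$ ranges over the nonzero column neighbors of $v_E$; and $v_t'$ is the block in the same column as $v_t$ and the same row as $u$. A vertex $(v_t,v_E)$ of a process tree stands for the operation making $v_t$ zero by adding the appropriate multiple of the row (for ROW_ERASABLE) or column (for COL_ERASABLE) of the identity block $v_E$ to the row or column of $v_t$; its successors are the zero blocks that may have become nonzero as side effects, and which are zeroed out again. *)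

(* Defs.v *)
From HB Require Import structures.
From Stdlib Require Import Relation_Operators.
From mathcomp Require Import all_boot all_order all_algebra.
From mathcomp Require Import boolp.

Set Implicit Arguments.
Unset Strict Implicit.
Unset Printing Implicit Defensive.

Import Order.TTheory GRing.Theory Num.Theory.
Local Open Scope ring_scope.

Record precat := Precat {
  ob :> Type;
  mor : ob -> ob -> zmodType;
  idmor : forall X, mor X X;
  ccomp : forall X Y Z, mor Y Z -> mor X Y -> mor X Z;
  ccompA : forall W X Y Z (h : mor Y Z) (g : mor X Y) (f : mor W X),
    ccomp h (ccomp g f) = ccomp (ccomp h g) f;
  ccomp1m : forall X Y (f : mor X Y), ccomp (idmor Y) f = f;
  ccompm1 : forall X Y (f : mor X Y), ccomp f (idmor X) = f;
  ccompDl : forall X Y Z (g h : mor Y Z) (f : mor X Y),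
    ccomp (g + h) f = ccomp g f + ccomp h f;
  ccompDr : forall X Y Z (h : mor Y Z) (f g : mor X Y),
    ccomp h (f + g) = ccomp h f + ccomp h g }.

Arguments mor {p} X Y.
Arguments idmor {p} X.
Arguments ccomp {p X Y Z} g f.

Definition inverse (C : precat) (X Y : C) (f : mor X Y) (g : mor Y X) : Prop :=
  ccomp g f = idmor X /\ ccomp f g = idmor Y.

Definition isomorphic (C : precat) (X Y : C) : Prop :=
  exists (f : mor X Y) (g : mor Y X), inverse f g.

Definition zero_object (C : precat) (X : C) : Prop := idmor X = 0.

Definition direct_sum (C : precat) (J : finType) (X_ : J -> C) (X : C) : Prop :=
  exists (i_ : forall j, mor (X_ j) X) (p_ : forall j, mor X (X_ j)),
    [/\ forall j, ccomp (p_ j) (i_ j) = idmor (X_ j),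
        forall j k, j != k -> ccomp (p_ j) (i_ k) = 0
      & \sum_j ccomp (i_ j) (p_ j) = idmor X].

Definition indecomposable (C : precat) (X : C) : Prop :=
  ~ zero_object X /\
  forall Y Z : C, direct_sum (fun b : bool => if b then Y else Z) X ->
    zero_object Y \/ zero_object Z.

Definition indecomposable_decomposition (C : precat) (J : finType) (X_ : J -> C)
    (X : C) : Prop :=
  (forall j, indecomposable (X_ j)) /\ direct_sum X_ X.

Definition finite_type (C : precat) : Prop :=
  exists (k : nat) (L : 'I_k -> C),
    forall X : C, indecomposable X -> exists i, isomorphic (L i) X.

Definition split_mono (C : precat) (X Y : C) (f : mor X Y) : Prop :=
  exists g, ccomp g f = idmor X.

Definition split_epi (C : precat) (X Y : C) (f : mor X Y) : Prop :=
  exists g, ccomp f g = idmor Y.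

Definition irreducible_mor (C : precat) (X Y : C) (f : mor X Y) : Prop :=
  [/\ ~ split_mono f, ~ split_epi f
    & forall (Z : C) (h : mor Z Y) (g : mor X Z), f = ccomp h g ->
        split_mono g \/ split_epi h].

Section FullSubcategory.
Variables (C : precat) (P : C -> Prop).

Definition full_sub : precat :=
  @Precat {X : C | P X} (fun X Y => mor (sval X) (sval Y)) (fun X => idmor (sval X))
    (fun X Y Z => @ccomp C (sval X) (sval Y) (sval Z))
    (fun W X Y Z => @ccompA C (sval W) (sval X) (sval Y) (sval Z))
    (fun X Y => @ccomp1m C (sval X) (sval Y))
    (fun X Y => @ccompm1 C (sval X) (sval Y))
    (fun X Y Z => @ccompDl C (sval X) (sval Y) (sval Z))
    (fun X Y Z => @ccompDr C (sval X) (sval Y) (sval Z)).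

End FullSubcategory.

Record arrow (C : precat) := Arrow {
  arr_dom : C; arr_cod : C; arr_map : mor arr_dom arr_cod }.

Section ArrowCategory.
Variable C : precat.
Implicit Types X Y Z : arrow C.

Definition arr_square X Y : {pred mor (arr_dom X) (arr_dom Y) * mor (arr_cod X) (arr_cod Y)} :=
  fun F => ccomp F.2 (arr_map X) == ccomp (arr_map Y) F.1.

Fact ccomp0m (U V W : C) (f : mor U V) : ccomp (0 : mor V W) f = 0.
Proof. by apply: (@addrI _ (ccomp 0 f)); rewrite -ccompDl !addr0. Qed.

Fact ccompm0 (U V W : C) (f : mor V W) : ccomp f (0 : mor U V) = 0.
Proof. by apply: (@addrI _ (ccomp f 0)); rewrite -ccompDr !addr0. Qed.

Fact ccompNm (U V W : C) (g : mor V W) (f : mor U V) : ccomp (- g) f = - ccomp g f.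
Proof. by apply: (@addrI _ (ccomp g f)); rewrite -ccompDl !subrr ccomp0m. Qed.

Fact ccompmN (U V W : C) (g : mor V W) (f : mor U V) : ccomp g (- f) = - ccomp g f.
Proof. by apply: (@addrI _ (ccomp g f)); rewrite -ccompDr !subrr ccompm0. Qed.

Fact arr_square_closed X Y : zmod_closed (@arr_square X Y).
Proof.
split=> [|F G]; first by rewrite unfold_in /arr_square /= ccomp0m ccompm0.
rewrite !unfold_in /arr_square /= => /eqP hF /eqP hG.
by rewrite ccompDl ccompDr ccompNm ccompmN hF hG.
Qed.

HB.instance Definition _ X Y :=
  GRing.isZmodClosed.Build _ (@arr_square X Y) (@arr_square_closed X Y).

Record arr_hom X Y := ArrHom {
  arr_pair :> (mor (arr_dom X) (arr_dom Y) * mor (arr_cod X) (arr_cod Y))%type;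
  arr_homP : arr_pair \in @arr_square X Y }.

HB.instance Definition _ X Y := [isSub for @arr_pair X Y].
HB.instance Definition _ X Y := [Choice of arr_hom X Y by <:].
HB.instance Definition _ X Y := [SubChoice_isSubZmodule of arr_hom X Y by <:].

Fact arr_id_subproof X : (idmor (arr_dom X), idmor (arr_cod X)) \in @arr_square X X.
Proof. by rewrite unfold_in /arr_square /= ccomp1m ccompm1. Qed.

Definition arr_id X : arr_hom X X := ArrHom (arr_id_subproof X).

Fact arr_comp_subproof X Y Z (G : arr_hom Y Z) (F : arr_hom X Y) :
  (ccomp (arr_pair G).1 (arr_pair F).1, ccomp (arr_pair G).2 (arr_pair F).2)
    \in @arr_square X Z.
Proof.
rewrite unfold_in /arr_square /=.
have /eqP hF := arr_homP F; have /eqP hG := arr_homP G.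
by rewrite -ccompA hF ccompA hG -ccompA.
Qed.

Definition arr_comp X Y Z (G : arr_hom Y Z) (F : arr_hom X Y) : arr_hom X Z :=
  ArrHom (arr_comp_subproof G F).

Fact arr_compA W X Y Z (H : arr_hom Y Z) (G : arr_hom X Y) (F : arr_hom W X) :
  arr_comp H (arr_comp G F) = arr_comp (arr_comp H G) F.
Proof. by apply: val_inj; rewrite /= !ccompA. Qed.

Fact arr_comp1m X Y (F : arr_hom X Y) : arr_comp (arr_id Y) F = F.
Proof. by apply: val_inj; rewrite /= !ccomp1m; case: (arr_pair F). Qed.

Fact arr_compm1 X Y (F : arr_hom X Y) : arr_comp F (arr_id X) = F.
Proof. by apply: val_inj; rewrite /= !ccompm1; case: (arr_pair F). Qed.

Fact arr_compDl X Y Z (G H : arr_hom Y Z) (F : arr_hom X Y) :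
  arr_comp (G + H) F = arr_comp G F + arr_comp H F.
Proof. by apply: val_inj; rewrite /= !ccompDl. Qed.

Fact arr_compDr X Y Z (H : arr_hom Y Z) (F G : arr_hom X Y) :
  arr_comp H (F + G) = arr_comp H F + arr_comp H G.
Proof. by apply: val_inj; rewrite /= !ccompDr. Qed.

Definition arr : precat := @Precat (arrow C) (fun X Y => arr_hom X Y : zmodType)
  arr_id arr_comp arr_compA arr_comp1m arr_compm1 arr_compDl arr_compDr.

End ArrowCategory.

Section Family.
Variables (I : finType) (T : I -> zmodType).

Definition family_of := {dffun forall v : I, T v}.
HB.instance Definition _ := Choice.on family_of.

Definition fam0 : family_of := [ffun v => (0 : T v)].
Definition famN (f : family_of) : family_of := [ffun v => - f v].
Definition famD (f g : family_of) : family_of := [ffun v => f v + g v].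

Fact famDA : associative famD.
Proof. by move=> f g h; apply/ffunP=> v; rewrite !ffunE addrA. Qed.
Fact famDC : commutative famD.
Proof. by move=> f g; apply/ffunP=> v; rewrite !ffunE addrC. Qed.
Fact fam0D : left_id fam0 famD.
Proof. by move=> f; apply/ffunP=> v; rewrite !ffunE add0r. Qed.
Fact famND : left_inverse fam0 famN famD.
Proof. by move=> f; apply/ffunP=> v; rewrite !ffunE addNr. Qed.

HB.instance Definition _ := GRing.isZmodule.Build family_of famDA famDC fam0D famND.

End Family.

Record quiver := Quiver {
  vertex : finType; edge : finType; src : edge -> vertex; tgt : edge -> vertex }.

Inductive qpath (Q : quiver) : vertex Q -> vertex Q -> Type :=
| qpath_nil v : qpath v v
| qpath_cons (a : edge Q) w (p : qpath (tgt a) w) : qpath (src a) w.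

Section Representations.
Variables (K : fieldType) (Q : quiver).

Record rep := Rep {
  rep_space : vertex Q -> vectType K;
  rep_act : forall a : edge Q, 'Hom(rep_space (src a), rep_space (tgt a)) }.

Implicit Types X Y Z : rep.

Fixpoint act_path X s t (p : qpath s t) : 'Hom(rep_space X s, rep_space X t) :=
  match p with
  | qpath_nil v => \1%VF
  | qpath_cons a w q => (act_path X q \o rep_act X a)%VF
  end.

Definition commutative_rep X : Prop :=
  forall s t (p q : qpath s t), act_path X p = act_path X q.

Definition rep_family X Y := family_of (fun v => 'Hom(rep_space X v, rep_space Y v) : zmodType).

Definition intertwines X Y : {pred rep_family X Y} :=
  fun f => [forall a, (f (tgt a) \o rep_act X a == rep_act Y a \o f (src a))%VF].

Fact intertwines_closed X Y : zmod_closed (@intertwines X Y).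
Proof.
split=> [|f g].
  by apply/forallP=> a; rewrite !ffunE comp_lfun0l comp_lfun0r.
move=> /forallP hf /forallP hg; apply/forallP=> a; rewrite !ffunE.
by rewrite comp_lfunDl comp_lfunDr comp_lfunNl comp_lfunNr (eqP (hf a)) (eqP (hg a)).
Qed.

HB.instance Definition _ X Y :=
  GRing.isZmodClosed.Build _ (@intertwines X Y) (@intertwines_closed X Y).

Record rep_hom X Y := RepHom {
  rep_fun :> rep_family X Y; rep_homP : rep_fun \in @intertwines X Y }.

HB.instance Definition _ X Y := [isSub for @rep_fun X Y].
HB.instance Definition _ X Y := [Choice of rep_hom X Y by <:].
HB.instance Definition _ X Y := [SubChoice_isSubZmodule of rep_hom X Y by <:].

Definition rep_id_fam X : rep_family X X := [ffun v => \1%VF].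

Fact rep_id_subproof X : rep_id_fam X \in @intertwines X X.
Proof. by apply/forallP=> a; rewrite !ffunE comp_lfun1l comp_lfun1r. Qed.

Definition rep_id X : rep_hom X X := RepHom (rep_id_subproof X).

Definition rep_comp_fam X Y Z (g : rep_hom Y Z) (f : rep_hom X Y) : rep_family X Z :=
  [ffun v => (rep_fun g v \o rep_fun f v)%VF].

Fact rep_comp_subproof X Y Z (g : rep_hom Y Z) (f : rep_hom X Y) :
  rep_comp_fam g f \in @intertwines X Z.
Proof.
apply/forallP=> a; rewrite !ffunE.
have /forallP/(_ a)/eqP hf := rep_homP f; have /forallP/(_ a)/eqP hg := rep_homP g.
by rewrite -comp_lfunA hf comp_lfunA hg comp_lfunA.
Qed.

Definition rep_comp X Y Z (g : rep_hom Y Z) (f : rep_hom X Y) : rep_hom X Z :=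
  RepHom (rep_comp_subproof g f).

Fact rep_compA W X Y Z (h : rep_hom Y Z) (g : rep_hom X Y) (f : rep_hom W X) :
  rep_comp h (rep_comp g f) = rep_comp (rep_comp h g) f.
Proof. by apply: val_inj; apply/ffunP=> v; rewrite !ffunE comp_lfunA. Qed.

Fact rep_comp1m X Y (f : rep_hom X Y) : rep_comp (rep_id Y) f = f.
Proof. by apply: val_inj; apply/ffunP=> v; rewrite !ffunE comp_lfun1l. Qed.

Fact rep_compm1 X Y (f : rep_hom X Y) : rep_comp f (rep_id X) = f.
Proof. by apply: val_inj; apply/ffunP=> v; rewrite !ffunE comp_lfun1r. Qed.

Fact rep_compDl X Y Z (g h : rep_hom Y Z) (f : rep_hom X Y) :
  rep_comp (g + h) f = rep_comp g f + rep_comp h f.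
Proof. by apply: val_inj; apply/ffunP=> v; rewrite !ffunE comp_lfunDl. Qed.

Fact rep_compDr X Y Z (h : rep_hom Y Z) (f g : rep_hom X Y) :
  rep_comp h (f + g) = rep_comp h f + rep_comp h g.
Proof. by apply: val_inj; apply/ffunP=> v; rewrite !ffunE comp_lfunDr. Qed.

Definition rep_cat : precat := @Precat rep (fun X Y => rep_hom X Y : zmodType)
  rep_id rep_comp rep_compA rep_comp1m rep_compm1 rep_compDl rep_compDr.

End Representations.

Inductive direction := fwd | bwd.

(* The quiver has n = m.+1 vertices, numbered from 0; edge i joins i and i + 1. *)
Definition An (m : nat) (tau : 'I_m -> direction) : quiver :=
  let left_end (i : 'I_m) : 'I_m.+1 := widen_ord (leqnSn m) i in
  let right_end (i : 'I_m) : 'I_m.+1 := lift ord0 i in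
  @Quiver 'I_m.+1 'I_m
    (fun i => if tau i is fwd then left_end i else right_end i)
    (fun i => if tau i is fwd then right_end i else left_end i).

(* A vertex (v, false) lies in the bottom row and (v, true) in the top row;
   [inl (a, b)] is the copy of a in row b, and [inr v] is the edge v -> v'. *)
Definition ladder (m : nat) (tau : 'I_m -> direction) : quiver :=
  @Quiver (vertex (An tau) * bool)%type (edge (An tau) * bool + vertex (An tau))%type
    (fun e => match e with inl (a, b) => (src a, b) | inr v => (v, false) end)
    (fun e => match e with inl (a, b) => (tgt a, b) | inr v => (v, true) end).

Section Ladder.
Variables (K : fieldType) (m : nat) (tau : 'I_m -> direction).

Definition repA : precat := rep_cat K (An tau).

Definition repCL : precat := @full_sub (rep_cat K (ladder tau))
  (@commutative_rep K (ladder tau)).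

Definition ladder_row (M : rep K (ladder tau)) (b : bool) : rep K (An tau) :=
  @Rep K (An tau) (fun v => rep_space M (v, b)) (fun a => rep_act M (inl (a, b))).

Definition ladder_vertical_fam (M : rep K (ladder tau)) :
    rep_family (ladder_row M false) (ladder_row M true) :=
  [ffun v => rep_act M (inr v)].

Fact ladder_vertical_subproof (M : repCL) :
  ladder_vertical_fam (sval M) \in @intertwines K (An tau) _ _.
Proof.
apply/forallP=> a; rewrite !ffunE; apply/eqP.
have := svalP M (src a, false) (tgt a, true)
  (@qpath_cons (ladder tau) (inl (a, false)) _
    (@qpath_cons (ladder tau) (inr (tgt a)) _ (qpath_nil _)))
  (@qpath_cons (ladder tau) (inr (src a)) _
    (@qpath_cons (ladder tau) (inl (a, true)) _ (qpath_nil _))).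
by rewrite /= !comp_lfun1l.
Qed.

Definition ladder_vertical (M : repCL) :
    mor (ladder_row (sval M) false : repA) (ladder_row (sval M) true) :=
  RepHom (ladder_vertical_subproof M).

(* The isomorphism of categories rep CL -> arr (rep A), on objects. *)
Definition ladder_arrow (M : repCL) : arr repA := Arrow (ladder_vertical M).

Definition ivl := {x : 'I_m.+1 * 'I_m.+1 | (x.1 <= x.2)%N}.

Definition in_ivl (x : ivl) (v : 'I_m.+1) : bool :=
  ((val x).1 <= v <= (val x).2)%N.

Definition ivl_rep (x : ivl) : repA :=
  @Rep K (An tau) (fun v => 'rV[K]_(in_ivl x v))
    (fun a => linfun (mulmxr (pid_mx 1))).

Definition ivl_ge (x y : ivl) : bool :=
  `[< exists f : mor (ivl_rep x) (ivl_rep y), f <> 0 >].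

Definition AR_arrow (x y : ivl) : Prop :=
  exists f : mor (ivl_rep x) (ivl_rep y), irreducible_mor f.

Definition AR_grading (ell : ivl -> int) : Prop :=
  forall x y, AR_arrow x y -> ell y = ell x + 1.

(* The reflexive closure of the order on intervals: by level, and inside a level
   the lexicographically larger pair of end points comes first. *)
Definition ivl_le (ell : ivl -> int) (x y : ivl) : bool :=
  (ell x < ell y) || (ell x == ell y) &&
  (((val y).1 < (val x).1)%N || ((val y).1 == (val x).1) && ((val y).2 <= (val x).2)%N).

Section Sum.
Variables (p : nat) (lab : 'I_p -> ivl).

Definition alive (v : 'I_m.+1) : pred 'I_p := fun j => in_ivl (lab j) v.

(* The direct sum of the intervals lab j: at v, row vectors indexed by the
   j such that lab j contains v. *)
Definition ivl_sum : repA :=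
  @Rep K (An tau) (fun v => 'rV[K]_#|alive v|)
    (fun a => linfun (mulmxr (\matrix_(i, j) (enum_val i == enum_val j)%:R))).

End Sum.

Section BlockMorphism.
Variables (R C : nat) (rlab : 'I_R -> ivl) (clab : 'I_C -> ivl).

Definition strongly_zero_mask (A : 'M[K]_(R, C)) : 'M[K]_(R, C) :=
  \matrix_(r, c) (if ivl_ge (clab c) (rlab r) then A r c else 0).

(* The morphism whose component from the summand c to the summand r is A r c times
   the basis of Hom(I(clab c), I(rlab r)), or 0 if this space is 0. Linear maps act
   on row vectors on the right, hence the transposition. *)
Definition block_family (A : 'M[K]_(R, C)) :
    rep_family (ivl_sum clab : rep K (An tau)) (ivl_sum rlab) :=
  [ffun v => linfun (mulmxr (\matrix_(i, j)
    strongly_zero_mask A (enum_val j) (enum_val i)))].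

End BlockMorphism.

Fact pid_mx1_inj (b c : bool) (u : 'rV[K]_b) : c -> u *m (pid_mx 1 : 'M_(b, c)) = 0 -> u = 0.
Proof.
by case: b c u => [] [] // u _; rewrite ?[u]thinmx0 // pid_mx_1 mulmx1.
Qed.

Fact pid_mx1_surj (b c : bool) (w : 'rV[K]_c) : b -> exists u, w = u *m (pid_mx 1 : 'M_(b, c)).
Proof.
by case: b c w => [] [] // w _; [exists w; rewrite pid_mx_1 mulmx1 | exists 0; rewrite [LHS]thinmx0 [RHS]thinmx0].
Qed.

Fact ivl_ge_edge (x y : ivl) (a : edge (An tau)) :
  ivl_ge x y -> in_ivl x (src a) -> in_ivl y (tgt a) ->
  in_ivl y (src a) = in_ivl x (tgt a).
Proof.
move=> /asboolP[f f_neq0].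
have fE (e : edge (An tau)) (u : 'rV[K]_(in_ivl x (src e))) :
    rep_fun f (tgt e) (u *m pid_mx 1) = rep_fun f (src e) u *m pid_mx 1.
  have /forallP/(_ e)/eqP/lfunP/(_ u) := rep_homP f.
  by rewrite !comp_lfunE /= !lfunE.
pose nz v := rep_fun f v != 0.
have nz_in v : nz v -> in_ivl x v && in_ivl y v.
  rewrite /nz; move: (rep_fun f v) => /=.
  case: (in_ivl x v) => [|g /eqP[]] /=; last first.
    by apply/lfunP=> u; rewrite [u]thinmx0 !linear0.
  case: (in_ivl y v) => [|g /eqP[]] //=.
  by apply/lfunP=> u; rewrite [LHS]thinmx0 [RHS]thinmx0.
have [v0 nz_v0] : exists v, nz v.
  apply/existsP; apply: contra_notT f_neq0 => /existsPn nz0.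
  apply: val_inj; apply/ffunP=> v; rewrite ffunE.
  by apply/eqP; have := nz0 v; rewrite negbK.
have fwdP e : nz (src e) -> in_ivl y (tgt e) -> nz (tgt e).
  move=> nz_s y_t; apply: contraNneq nz_s => f_t; apply/eqP/lfunP=> u.
  by rewrite lfunE; apply: (pid_mx1_inj y_t); rewrite -fE f_t lfunE.
have bwdP e : nz (tgt e) -> in_ivl x (src e) -> nz (src e).
  move=> nz_t x_s; apply: contraNneq nz_t => f_s; apply/eqP/lfunP=> w.
  have [u ->] := pid_mx1_surj w x_s.
  by rewrite fE f_s !lfunE /= mul0mx.
have adj (i : 'I_m) (l := widen_ord (leqnSn m) i) (r := lift ord0 i : 'I_m.+1) :
    in_ivl x l -> in_ivl x r -> in_ivl y l -> in_ivl y r ->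
    nz l = nz r.
  move=> xl xr yl yr; have := fwdP i; have := bwdP i; rewrite /=.
  by case: (tau i) => h1 h2; apply/idP/idP=> h; [apply: h2|apply: h1|apply: h1|apply: h2].
have between (z : ivl) (u v w : 'I_m.+1) : (u <= v <= w)%N ->
    in_ivl z u -> in_ivl z w -> in_ivl z v.
  rewrite /in_ivl => /andP[uv vw] /andP[zu _] /andP[_ wz].
  by rewrite (leq_trans zu uv) (leq_trans vw wz).
have far k : forall u v : 'I_m.+1, (v = u + k :> nat)%N ->
    in_ivl x u -> in_ivl x v -> in_ivl y u -> in_ivl y v ->
    nz u = nz v.
  elim: k => [|k IHk] u v vE xu xv yu yv.
    by congr nz; apply: val_inj; rewrite /= vE addn0.
  have lt_um : (u + k < m)%N by rewrite -ltnS -addnS -vE.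
  pose i := Ordinal lt_um; pose l := widen_ord (leqnSn m) i.
  have vr : v = lift ord0 i by apply: val_inj; rewrite /= /bump /= vE addnS.
  have lP : (u <= l <= v)%N by rewrite /= leq_addr vE leq_add2l leqnSn.
  have xl := between x _ _ _ lP xu xv; have yl := between y _ _ _ lP yu yv.
  by rewrite (IHk u l) // vr; apply: adj; rewrite -?vr.
have nzE u : in_ivl x u -> in_ivl y u -> nz u.
  move=> xu yu; have /andP[x0 y0] := nz_in _ nz_v0.
  have [le_u|/ltnW le_u] := leqP v0 u.
    by rewrite -(far (u - v0)%N v0 u) // subnKC.
  by rewrite (far (v0 - u)%N u v0) // subnKC.
move=> x_s y_t; apply/idP/idP => [y_s|x_t].
  by have /andP[] := nz_in _ (fwdP a (nzE _ x_s y_s) y_t).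
by have /andP[] := nz_in _ (bwdP a (nzE _ x_t y_t) x_s).
Qed.

Fact sum_enum_val p (P : pred 'I_p) (F : 'I_p -> K) (c : 'I_p) :
  \sum_(j < #|P|) (c == enum_val j)%:R * F (enum_val j) = (P c)%:R * F c.
Proof.
rewrite -(big_enum_val (fun j => (c == j)%:R * F j)) /=.
case Pc: (P c).
  rewrite (bigD1 c) //= eqxx big1 ?addr0 // => j /andP[_ /negPf].
  by rewrite eq_sym => ->; rewrite mul0r.
rewrite mul0r big1 // => j Pj; case: eqP => [cj|_]; last by rewrite mul0r.
by move: Pj; rewrite unfold_in -cj Pc.
Qed.

Section SumIsDirect.
Variables (p : nat) (lab : 'I_p -> ivl).

Definition ivl_in_fam j : rep_family (ivl_rep (lab j) : rep K (An tau)) (ivl_sum lab) :=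
  [ffun v => linfun (mulmxr (\matrix_(i, k) (enum_val k == j)%:R))].

Definition ivl_pr_fam j : rep_family (ivl_sum lab : rep K (An tau)) (ivl_rep (lab j)) :=
  [ffun v => linfun (mulmxr (\matrix_(k, i) (enum_val k == j)%:R))].

Fact sum_const_bool (b : bool) (F : 'I_b -> K) x : (forall i, F i = x) -> \sum_(i < b) F i = b%:R * x.
Proof. by move=> FE; rewrite (eq_bigr (fun=> x)) // sumr_const card_ord mulr_natl. Qed.

Fact ivl_in_subproof j : ivl_in_fam j \in @intertwines K (An tau) _ _.
Proof.
apply/forallP=> a; rewrite !ffunE; apply/eqP/lfunP=> u.
rewrite !comp_lfunE !lfunE /= -!mulmxA; congr (_ *m _).
apply/matrixP=> i k; rewrite !mxE.
rewrite (sum_const_bool (x := (enum_val k == j)%:R)); last first.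
  move=> l; rewrite !mxE; case: (in_ivl _ _) (in_ivl _ _) i l => [] [] [[|//] ?] [[|//] ?] //=; by rewrite mul1r.
transitivity (\sum_(l < #|alive lab (src a)|) (j == enum_val l)%:R * (enum_val l == enum_val k)%:R : K); last first.
  by apply: eq_bigr => l _; rewrite !mxE (eq_sym j).
rewrite (sum_enum_val (alive lab (src a)) (fun l => (l == enum_val k)%:R)).
have k_t := enum_valP k; rewrite unfold_in /alive in k_t.
have := leq_ltn_trans (leq0n i) (ltn_ord i); rewrite /alive (eq_sym j).
have [<-|_] := eqVneq (enum_val k) j; last by rewrite !mulr0.
by rewrite k_t; case: (in_ivl _ (src a)).
Qed.

Fact ivl_pr_subproof j : ivl_pr_fam j \in @intertwines K (An tau) _ _.
Proof.
apply/forallP=> a; rewrite !ffunE; apply/eqP/lfunP=> u.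
rewrite !comp_lfunE !lfunE /= -!mulmxA; congr (_ *m _).
apply/matrixP=> i k; rewrite !mxE.
transitivity (\sum_(l < #|alive lab (tgt a)|) (enum_val i == enum_val l)%:R * (enum_val l == j)%:R : K).
  by apply: eq_bigr => l _; rewrite !mxE.
rewrite (sum_enum_val (alive lab (tgt a)) (fun l => (l == j)%:R)).
rewrite (sum_const_bool (x := (enum_val i == j)%:R)); last first.
  by move=> l; rewrite !mxE; case: (in_ivl _ _) (in_ivl _ _) l k => [] [] [[|//] ?] [[|//] ?] //=; rewrite mulr1.
have i_s := enum_valP i; rewrite unfold_in /alive in i_s.
have := leq_ltn_trans (leq0n k) (ltn_ord k); rewrite /alive.
have [<-|_] := eqVneq (enum_val i) j; last by rewrite !mulr0.
by rewrite i_s; case: (in_ivl _ (tgt a)).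
Qed.

Fact rep_sumE (J : finType) (X Y : rep K (An tau)) (F : J -> rep_hom X Y) v :
  rep_fun (\sum_j F j) v = \sum_j rep_fun (F j) v.
Proof.
elim/big_rec2: _ => [|j f g _ <-]; first by rewrite ffunE.
by rewrite ffunE.
Qed.

Fact ivl_sumP : direct_sum (fun j => ivl_rep (lab j)) (ivl_sum lab).
Proof.
exists (fun j => RepHom (ivl_in_subproof j)), (fun j => RepHom (ivl_pr_subproof j)).
have in_pr j k v (u : 'rV[K]_(in_ivl (lab k) v)) :
    rep_fun (rep_comp (RepHom (ivl_pr_subproof j)) (RepHom (ivl_in_subproof k))) v u
    = u *m const_mx (j == k)%:R.
  rewrite !ffunE comp_lfunE !lfunE /= -mulmxA; congr (_ *m _); apply/matrixP=> a b; rewrite !mxE.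
  transitivity (\sum_(l < #|alive lab v|) (k == enum_val l)%:R * (enum_val l == j)%:R : K).
    by apply: eq_bigr => l _; rewrite !mxE (eq_sym k).
  rewrite (sum_enum_val (alive lab v) (fun l => (l == j)%:R)) (eq_sym j) /alive.
  by have := leq_ltn_trans (leq0n a) (ltn_ord a); case: in_ivl => //; rewrite mul1r.
split=> [j|j k j_k|].
- apply: val_inj; apply/ffunP=> v; apply/lfunP=> u.
  rewrite [LHS]in_pr eqxx ffunE id_lfunE.
  move: u => /=; case: in_ivl => u; last by rewrite [LHS]thinmx0 [RHS]thinmx0.
  by rewrite (_ : const_mx _ = 1%:M) ?mulmx1 //; apply/matrixP=> a b; rewrite !mxE !ord1 eqxx.
- apply: val_inj; apply/ffunP=> v; apply/lfunP=> u.
  by rewrite [LHS]in_pr (negPf j_k) !ffunE lfunE -[const_mx _]/(0 : 'M_(_, _)) mulmx0.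
- apply: val_inj; apply/ffunP=> v; apply/lfunP=> u.
  rewrite rep_sumE sum_lfunE /= !ffunE id_lfunE.
  under eq_bigr => j _ do rewrite !ffunE comp_lfunE !lfunE /= -mulmxA.
  rewrite -mulmx_sumr -[RHS]mulmx1; congr (_ *m _).
  apply/matrixP=> a b; rewrite summxE !mxE.
  under eq_bigr => j _.
    rewrite mxE; under eq_bigr => i _ do rewrite !mxE.
    rewrite (sum_const_bool (x := (enum_val a == j)%:R * (enum_val b == j)%:R)) //; over.
  rewrite (bigD1 (enum_val a)) //= big1 => [|j /negPf ne]; last first.
    by rewrite eq_sym ne mul0r mulr0.
  have a_v := enum_valP a; rewrite unfold_in /alive in a_v.
  by rewrite a_v eqxx !mul1r addr0 (inj_eq enum_val_inj) eq_sym.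
Qed.
End SumIsDirect.

Fact block_morphism_subproof R C (rlab : 'I_R -> ivl) (clab : 'I_C -> ivl)
    (A : 'M[K]_(R, C)) :
  block_family rlab clab A \in @intertwines K (An tau) _ _.
Proof.
apply/forallP=> a; rewrite !ffunE; apply/eqP/lfunP=> u.
rewrite !comp_lfunE !lfunE /= -!mulmxA; congr (_ *m _).
apply/matrixP=> i k; rewrite !mxE.
pose B c r := strongly_zero_mask rlab clab A r c.
transitivity ((alive clab (tgt a) (enum_val i))%:R * B (enum_val i) (enum_val k)).
  rewrite -(sum_enum_val (alive clab (tgt a)) (fun j => B j (enum_val k))).
  by apply: eq_bigr => j _; rewrite !mxE /B !mxE.
transitivity ((alive rlab (src a) (enum_val k))%:R * B (enum_val i) (enum_val k)); last first.
  rewrite -(sum_enum_val (alive rlab (src a)) (fun j => B (enum_val i) j)).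
  by apply: eq_bigr => j _; rewrite !mxE /B !mxE mulrC eq_sym.
rewrite /B !mxE; case: ifP => [ge_ik|]; last by rewrite !mulr0.
congr ((nat_of_bool _)%:R * _); rewrite /alive; symmetry; apply: ivl_ge_edge ge_ik _ _.
  exact: (enum_valP i).
exact: (enum_valP k).
Qed.

Definition block_morphism R C (rlab : 'I_R -> ivl) (clab : 'I_C -> ivl)
    (A : 'M[K]_(R, C)) : mor (ivl_sum clab) (ivl_sum rlab) :=
  RepHom (block_morphism_subproof rlab clab A).

Inductive status := Strongly_zero | Unprocessed | Identity | Zero.

Definition is_identity (x : status) : bool := if x is Identity then true else false.

Definition is_nonzero (x : status) : bool :=
  match x with Unprocessed | Identity => true | _ => false end.

(* A part of a row or column partition: its interval and its number of K-rows. *)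
Definition part := (ivl * nat)%type.

Definition part0 : part := (Sub (ord0, ord0) (leqnn 0), 0%N).

Definition part_label (s : seq part) (i : nat) : ivl := (nth part0 s i).1.
Definition part_size (s : seq part) (i : nat) : nat := (nth part0 s i).2.
Definition part_start (s : seq part) (i : nat) : nat := sumn [seq x.2 | x <- take i s].
Definition total_size (s : seq part) : nat := sumn [seq x.2 | x <- s].

Definition in_part (s : seq part) (i r : nat) : bool :=
  (part_start s i <= r < part_start s i + part_size s i)%N.

Definition line_label (s : seq part) (r : nat) : ivl :=
  nth part0.1 (flatten [seq nseq x.2 x.1 | x <- s]) r.

(* The row and the column index of a block, counted from the top and from the left. *)
Definition position := (nat * nat)%type.

(* The total numbers R and C of K-rows and K-columns never change; parts are consecutive
   and may be empty. *)
Record block_matrix (R C : nat) := BlockMatrix {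
  rows : seq part;
  cols : seq part;
  mat : 'M[K]_(R, C);
  stat : position -> status }.

Section BlockMatrix.
Variables R C : nat.
Implicit Types (s : block_matrix R C) (v u : position).

Definition row_line s (r : 'I_R) : ivl := line_label (rows s) r.
Definition col_line s (c : 'I_C) : ivl := line_label (cols s) c.

Definition block_arrow s : arr repA :=
  Arrow (block_morphism (row_line s) (col_line s) (mat s)).

Definition in_range s v : bool := (v.1 < size (rows s))%N && (v.2 < size (cols s))%N.

Definition strongly_zero s v : bool :=
  ~~ ivl_ge (part_label (cols s) v.2) (part_label (rows s) v.1).

(* Block v of A is [E 0; 0 0] with E the r x r identity. *)
Definition echelon_block s (A : 'M[K]_(R, C)) v (r : nat) : Prop :=
  (r <= minn (part_size (rows s) v.1) (part_size (cols s) v.2))%N /\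
  forall (a : 'I_R) (b : 'I_C), in_part (rows s) v.1 a -> in_part (cols s) v.2 b ->
    let i := (a - part_start (rows s) v.1)%N in
    let j := (b - part_start (cols s) v.2)%N in
    A a b = ((i == j) && (i < r)%N)%:R.

Definition identity_block s (A : 'M[K]_(R, C)) v : Prop :=
  part_size (rows s) v.1 = part_size (cols s) v.2 /\
  echelon_block s A v (part_size (rows s) v.1).

Definition zero_block s (A : 'M[K]_(R, C)) v : Prop :=
  forall (a : 'I_R) (b : 'I_C), in_part (rows s) v.1 a -> in_part (cols s) v.2 b -> A a b = 0.

Definition block_matrix_problem (ell : ivl -> int) (M : repCL) s : Prop :=
  let F := ladder_arrow M in
  let order := sort (ivl_le ell) (enum {: ivl}) in
  [/\ exists mV mW : ivl -> nat,
        cols s = [seq (x, mV x) | x <- order] /\ rows s = [seq (x, mW x) | x <- rev order],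
      total_size (rows s) = R /\ total_size (cols s) = C,
      exists (etaV : mor (arr_dom F) (ivl_sum (col_line s))) etaV'
             (etaW : mor (arr_cod F) (ivl_sum (row_line s))) etaW',
        [/\ inverse etaV etaV', inverse etaW etaW'
          & arr_map (block_arrow s) = ccomp etaW (ccomp (arr_map F) etaV')],
      mat s = strongly_zero_mask (row_line s) (col_line s) (mat s)
    & forall v, in_range s v ->
        stat s v = if strongly_zero s v then Strongly_zero else Unprocessed].

Definition row_side_effect s v : seq position :=
  [seq u <- [seq (v.1, j) | j <- iota 0 (size (cols s))] | (u != v) && is_identity (stat s u)].

Definition col_side_effect s v : seq position :=
  [seq u <- [seq (i, v.2) | i <- iota 0 (size (rows s))] | (u != v) && is_identity (stat s u)].

Inductive mode := Row_mode | Col_mode.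

Definition candidates s (d : mode) v : seq position :=
  if d is Row_mode then col_side_effect s v else row_side_effect s v.

Definition permissible s (d : mode) (vE vt : position) : bool :=
  if d is Row_mode then ivl_ge (part_label (rows s) vE.1) (part_label (rows s) vt.1)
  else ivl_ge (part_label (cols s) vt.2) (part_label (cols s) vE.2).

Definition affecting s (d : mode) (vE : position) : seq position :=
  [seq u <- if d is Row_mode then [seq (vE.1, j) | j <- iota 0 (size (cols s))]
            else [seq (i, vE.2) | i <- iota 0 (size (rows s))]
  | (u != vE) && is_nonzero (stat s u)].

Definition affected (d : mode) (vt u : position) : position :=
  if d is Row_mode then (vt.1, u.2) else (u.1, vt.2).

Inductive process_tree :=
  Process (d : mode) (vt vE : position) (subtrees : seq process_tree).

(* [erasable s vt vf visited res visited']: a call of ERASABLE may return res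
   (None is null) and leave visited' as the set of visited targets. Sets without
   a prescribed order of enumeration may be enumerated in any order. *)
Inductive erasable s : position -> option position -> seq position ->
    option process_tree -> seq position -> Prop :=
| Erasable_row vt vf vis p vis' :
    erasable_by s Row_mode vt vf vis (Some p) vis' ->
    erasable s vt vf vis (Some p) vis'
| Erasable_col vt vf vis vis' res vis'' :
    erasable_by s Row_mode vt vf vis None vis' ->
    erasable_by s Col_mode vt vf vis' res vis'' ->
    erasable s vt vf vis res vis''
with erasable_by s : mode -> position -> option position -> seq position ->
    option process_tree -> seq position -> Prop :=
| Erasable_by d vt vf vis es res vis' :
    perm_eq es (candidates s d vt) ->
    try_candidates s d vt vf es (vt :: vis) res vis' ->
    erasable_by s d vt vf vis res vis'
(* The loop over the candidates vE. *)
with try_candidates s : mode -> position -> option position -> seq position ->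
    seq position -> option process_tree -> seq position -> Prop :=
| Try_none d vt vf vis : try_candidates s d vt vf [::] vis None vis
| Try_skip d vt vf vE es vis res vis' :
    [|| vE \in vis, Some vE == vf | ~~ permissible s d vE vt] ->
    try_candidates s d vt vf es vis res vis' ->
    try_candidates s d vt vf (vE :: es) vis res vis'
| Try_usable d vt vf vE es vis us ps vis' :
    [&& vE \notin vis, Some vE != vf & permissible s d vE vt] ->
    perm_eq us (affecting s d vE) ->
    clear_effects s d vt us vis (Some ps) vis' ->
    try_candidates s d vt vf (vE :: es) vis (Some (Process d vt vE ps)) vis'
| Try_unusable d vt vf vE es vis us vis' res vis'' :
    [&& vE \notin vis, Some vE != vf & permissible s d vE vt] ->
    perm_eq us (affecting s d vE) ->
    clear_effects s d vt us vis None vis' ->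
    try_candidates s d vt vf es vis' res vis'' ->
    try_candidates s d vt vf (vE :: es) vis res vis''
(* The loop over the neighbors u of vE; the result is None if vE is found not usable,
   and the list of subtrees otherwise. *)
with clear_effects s : mode -> position -> seq position -> seq position ->
    option (seq process_tree) -> seq position -> Prop :=
| Clear_nil d vt vis : clear_effects s d vt [::] vis (Some [::]) vis
| Clear_blocked d vt u us vis :
    (affected d vt u \in vis) || is_identity (stat s (affected d vt u)) ->
    clear_effects s d vt (u :: us) vis None vis
| Clear_harmless d vt u us vis res vis' :
    affected d vt u \notin vis ->
    stat s (affected d vt u) = Unprocessed \/ stat s (affected d vt u) = Strongly_zero ->
    clear_effects s d vt us vis res vis' ->
    clear_effects s d vt (u :: us) vis res vis'
| Clear_null d vt u us vis vis' :
    affected d vt u \notin vis -> stat s (affected d vt u) = Zero ->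
    erasable s (affected d vt u) (Some u) vis None vis' ->
    clear_effects s d vt (u :: us) vis None vis'
| Clear_subtree d vt u us vis p vis' res vis'' :
    affected d vt u \notin vis -> stat s (affected d vt u) = Zero ->
    erasable s (affected d vt u) (Some u) vis (Some p) vis' ->
    clear_effects s d vt us vis' res vis'' ->
    clear_effects s d vt (u :: us) vis (omap (cons p) res) vis''.

(* An invertible matrix acting only inside part i. *)
Definition inner n (t : seq part) (i : nat) (P : 'M[K]_n) : Prop :=
  P \in unitmx /\
  forall a b : 'I_n, ~~ (in_part t i a && in_part t i b) -> P a b = (a == b)%:R.

(* Adding multiples of the K-rows (K-columns) of the part of vE to those of the part
   of vt; strongly zero blocks remain zero. *)
Definition add_multiples s (d : mode) (vE vt : position) (A A' : 'M[K]_(R, C)) : Prop :=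
  let mask := strongly_zero_mask (row_line s) (col_line s) in
  match d with
  | Row_mode => exists X : 'M[K]_R,
      (forall a b, X a b != 0 -> in_part (rows s) vt.1 a && in_part (rows s) vE.1 b) /\
      A' = mask (A + X *m A)
  | Col_mode => exists X : 'M[K]_C,
      (forall a b, X a b != 0 -> in_part (cols s) vE.2 a && in_part (cols s) vt.2 b) /\
      A' = mask (A + A *m X)
  end.

(* Traversal of a process tree from its root. *)
Inductive process s : process_tree -> 'M[K]_(R, C) -> 'M[K]_(R, C) -> Prop :=
| Process_root d vt vE ps A A' A'' :
    add_multiples s d vE vt A A' -> zero_block s A' vt -> process_all s ps A' A'' ->
    process s (Process d vt vE ps) A A''
with process_all s : seq process_tree -> 'M[K]_(R, C) -> 'M[K]_(R, C) -> Prop :=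
| Process_nil A : process_all s [::] A A
| Process_cons p ps A A' A'' :
    process s p A A' -> process_all s ps A' A'' -> process_all s (p :: ps) A A''.

(* The rows and columns to be split when v is: those of v, and along with a row (column)
   every column (row) that shares an identity block with it. *)
Inductive split_row s v : nat -> Prop :=
| Split_row_pivot : split_row s v v.1
| Split_row_identity i j : in_range s (i, j) -> is_identity (stat s (i, j)) ->
    split_col s v j -> split_row s v i
with split_col s v : nat -> Prop :=
| Split_col_pivot : split_col s v v.2
| Split_col_identity i j : in_range s (i, j) -> is_identity (stat s (i, j)) ->
    split_row s v i -> split_col s v j.

(* The new parts in order: (i, b) is piece b of the former part i, where [false] is the
   first piece and the only one if i is not in S. *)
Definition pieces (S : pred nat) (k : nat) : seq (nat * bool) :=
  flatten [seq if S i then [:: (i, false); (i, true)] else [:: (i, false)] | i <- iota 0 k].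

Definition split_parts (S : pred nat) (r : nat) (t : seq part) : seq part :=
  [seq (part_label t x.1,
        if S x.1 then (if x.2 then part_size t x.1 - r else r)%N else part_size t x.1)
  | x <- pieces S (size t)].

Definition split_at s v (r : nat) : block_matrix R C :=
  let SR i := `[< split_row s v i >] in
  let SC j := `[< split_col s v j >] in
  @BlockMatrix R C (split_parts SR r (rows s)) (split_parts SC r (cols s)) (mat s)
    (fun w =>
       let x := nth (0%N, false) (pieces SR (size (rows s))) w.1 in
       let y := nth (0%N, false) (pieces SC (size (cols s))) w.2 in
       let u := (x.1, y.1) in
       if u == v then (if x.2 || y.2 then Zero else Identity)
       else if is_identity (stat s u) then (if x.2 == y.2 then Identity else Zero)
       else stat s u).

Definition set_mat s (A : 'M[K]_(R, C)) : block_matrix R C :=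
  BlockMatrix (rows s) (cols s) A (stat s).

Definition set_zero s v : block_matrix R C :=
  BlockMatrix (rows s) (cols s) (mat s) (fun u => if u == v then Zero else stat s u).

Inductive fix_call := Col_fix of position | Row_fix of position.

(* [Fixing calls v r]: the block v has been brought to the form [E 0; 0 0] with E of
   size r, and the given stack of calls remains to be executed. *)
Inductive control :=
| Main_loop
| Fixing (calls : seq fix_call) (v : position) (r : nat)
| Erasing.

Definition config := (control * block_matrix R C)%type.

Definition unprocessed s v : Prop := in_range s v /\ stat s v = Unprocessed.

Definition pivot s v : Prop :=
  unprocessed s v /\
  forall u, unprocessed s u -> (u.2 < v.2)%N || (u.2 == v.2) && (u.1 <= v.1)%N.

Inductive step : config -> config -> Prop :=
| Step_pivot s v P Q r fr fc :
    pivot s v ->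
    inner (rows s) v.1 P -> inner (cols s) v.2 Q -> echelon_block s (P *m mat s *m Q) v r ->
    perm_eq fr (row_side_effect s v) -> perm_eq fc (col_side_effect s v) ->
    step (Main_loop, s)
      (Fixing ([seq Col_fix u | u <- fr] ++ [seq Row_fix u | u <- fc]) v r,
       set_mat s (P *m mat s *m Q))
| Step_col_fix s u calls v r Q us :
    inner (cols s) u.2 Q -> identity_block s (mat s *m Q) u ->
    perm_eq us (col_side_effect s u) ->
    step (Fixing (Col_fix u :: calls) v r, s)
      (Fixing ([seq Row_fix w | w <- us] ++ calls) v r, set_mat s (mat s *m Q))
| Step_row_fix s u calls v r P us :
    inner (rows s) u.1 P -> identity_block s (P *m mat s) u ->
    perm_eq us (row_side_effect s u) ->
    step (Fixing (Row_fix u :: calls) v r, s)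
      (Fixing ([seq Col_fix w | w <- us] ++ calls) v r, set_mat s (P *m mat s))
| Step_split s v r :
    step (Fixing [::] v r, s) (Erasing, split_at s v r)
| Step_erase s vt p vis A :
    in_range s vt -> is_nonzero (stat s vt) ->
    erasable s vt None [::] (Some p) vis -> process s p (mat s) A ->
    step (Erasing, s) (Erasing, set_zero (set_mat s A) vt)
| Step_leave s :
    (forall vt, in_range s vt -> is_nonzero (stat s vt) ->
       exists vis, erasable s vt None [::] None vis) ->
    step (Erasing, s) (Main_loop, s).

Definition finished (c : config) : Prop :=
  c.1 = Main_loop /\ forall v, ~ unprocessed c.2 v.

Definition reachable (c c' : config) : Prop := clos_refl_trans config step c c'.

Definition terminates (c : config) : Prop :=
  Acc (fun c2 c1 => step c1 c2) c /\
  forall c', reachable c c' -> finished c' \/ exists c'', step c' c''.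

(* The status of every block is final and agrees with its entries. *)
Definition reduced s : Prop :=
  forall v, in_range s v ->
    match stat s v with
    | Identity => identity_block s (mat s) v
    | Zero => zero_block s (mat s) v
    | Strongly_zero => strongly_zero s v /\ zero_block s (mat s) v
    | Unprocessed => False
    end.

End BlockMatrix.

End Ladder.

(* Main.v *)
(* Ladders with four or more edges in a row are not of finite type: for each orientation of
   four edges there are two pairs of intervals, orthogonal inside a pair and with nonzero
   morphisms from the first pair to the second, and the Jordan blocks placed between the pairs
   are indecomposables of unbounded dimension. So only fifteen orientations remain. For them
   the grading of the Auslander-Reiten quiver is forced, because it has an arrow x -> y as soon
   as Hom(x, y) is nonzero and no third interval z has nonzero Hom(x, z) and Hom(z, y).

   A permissible operation is an automorphism of a sum of intervals, so each step is an
   isomorphism of arrows, and it remains to follow the statuses. These do not depend on the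
   entries of the matrix but, a priori, on the choices left open by the procedure. In a round
   of the main loop the identity blocks reachable from the pivot form a tree; the fixing calls
   descend this tree and never disturb the pivot or a block that has already been fixed. In the
   erasing loop, an upper bound for the blocks that some run of ERASABLE can erase, and a lower
   bound for those that every run erases, show that the set of blocks erased in the end does
   not depend on the choices. Along a process tree no pending target lies in the line of an
   identity block in use, so the traversal zeroes out exactly its targets. The statuses after
   each round are thus determined by the orientation, and a computation over the fifteen
   orientations shows that no unprocessed block is left in the end. *)

Require Import Defs.
From HB Require Import structures.
From mathcomp Require Import all_boot all_order all_algebra.
From mathcomp Require Import boolp.
From mathcomp Require Import zify.

Set Implicit Arguments.
Unset Strict Implicit.
Unset Printing Implicit Defensive.

Import Order.TTheory GRing.Theory Num.Theory.

Local Open Scope ring_scope.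

(** * Direct sums *)

(** A finite computation suffices because statuses forget everything unbounded. Whether Hom between
    two intervals vanishes depends on their end points alone, over every field, and empty parts are
    kept, so the rank of a pivot changes sizes but never the pattern of blocks. The main obstacle is
    the set of visited targets in ERASABLE. It is shared by all branches of a call, including those
    that fail, so the order of enumeration may decide whether a block is found erasable. This is why
    there are two one-sided bounds, one ignoring the visited set and one allowing for the largest
    set that can arise, instead of one simulated search. A second obstacle is that statuses are
    temporarily false during a traversal: side effects are nonzero blocks of status 0, and an
    operation taken from a line that contains one would spread it further. The results of iterations
    (levels of intervals, depths of lines, sets of targets) serve as certificates: the properties
    used are checked on the final value. *)

Section Precategories.
Variable C : precat.
Implicit Types X Y Z : C.

Lemma ccomp_suml (J : finType) X Y Z (h : mor Y Z) (f : J -> mor X Y) :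
  ccomp h (\sum_j f j) = \sum_j ccomp h (f j).
Proof. by apply: (big_morph (ccomp h)) => [? ?|]; rewrite ?ccompDr ?ccompm0. Qed.

Lemma ccomp_sumr (J : finType) X Y Z (h : J -> mor Y Z) (f : mor X Y) :
  ccomp (\sum_j h j) f = \sum_j ccomp (h j) f.
Proof. by apply: (big_morph (fun g => ccomp g f)) => [? ?|]; rewrite ?ccompDl ?ccomp0m. Qed.

Lemma isomorphic_refl X : isomorphic X X.
Proof. by exists (idmor X), (idmor X); split; rewrite ccomp1m. Qed.

Lemma isomorphic_sym X Y : isomorphic X Y -> isomorphic Y X.
Proof. by move=> [f [g [gf fg]]]; exists g, f. Qed.

Lemma isomorphic_trans X Y Z : isomorphic X Y -> isomorphic Y Z -> isomorphic X Z.
Proof.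
move=> [f [g [gf fg]]] [f' [g' [gf' fg']]].
exists (ccomp f' f), (ccomp g g'); split.
  by rewrite -ccompA (ccompA g') gf' ccomp1m gf.
by rewrite -ccompA (ccompA f) fg ccomp1m fg'.
Qed.

Lemma direct_sum_iso (J : finType) (X_ : J -> C) X Y :
  isomorphic X Y -> direct_sum X_ X -> direct_sum X_ Y.
Proof.
move=> [f [g [gf fg]]] [i_ [p_ [pi pi0 ip]]].
exists (fun j => ccomp f (i_ j)), (fun j => ccomp (p_ j) g); split=> [j|j k jk|].
- by rewrite -ccompA (ccompA g) gf ccomp1m.
- by rewrite -ccompA (ccompA g) gf ccomp1m pi0.
- under eq_bigr => j _ do rewrite -ccompA (ccompA (i_ j)).
  by rewrite -ccomp_suml -ccomp_sumr ip ccomp1m fg.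
Qed.

Lemma zero_object_sum X : zero_object X -> direct_sum (of_void C) X.
Proof.
by move=> X0; exists (fun=> 0), (fun=> 0); split=> [[]|[]|]; rewrite big1 // => [[]].
Qed.

Lemma direct_sum_cat (I J : finType) (X_ : I -> C) (Y_ : J -> C) X Y Z :
  direct_sum (fun b : bool => if b then X else Y) Z ->
  direct_sum X_ X -> direct_sum Y_ Y ->
  direct_sum (fun s : I + J => match s with inl i => X_ i | inr j => Y_ j end) Z.
Proof.
move=> [i_ [p_ [pi pi0 ip]]] [iX [pX [piX piX0 ipX]]] [iY [pY [piY piY0 ipY]]].
pose W (s : I + J) := match s with inl i => X_ i | inr j => Y_ j end.
exists (fun s : I + J => match s as t return mor (W t) Z with
          inl i => ccomp (i_ true) (iX i) | inr j => ccomp (i_ false) (iY j) end).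
exists (fun s : I + J => match s as t return mor Z (W t) with
          inl i => ccomp (pX i) (p_ true) | inr j => ccomp (pY j) (p_ false) end).
have piT := pi true; have piF := pi false.
have TF := pi0 true false isT; have FT := pi0 false true isT.
move: ip; rewrite big_bool => ip.
move: (i_ true) (i_ false) (p_ true) (p_ false) piT piF TF FT ip.
move=> /= iT iF pT pF piT piF TF FT ip.
split=> [[i|j]|[i|j] [k|k] jk|].
- by rewrite /= -ccompA (ccompA pT) piT ccomp1m.
- by rewrite /= -ccompA (ccompA pF) piF ccomp1m.
- by rewrite /= -ccompA (ccompA pT) piT ccomp1m piX0.
- by rewrite /= -ccompA (ccompA pT) TF ccomp0m ccompm0.
- by rewrite /= -ccompA (ccompA pF) FT ccomp0m ccompm0.
- by rewrite /= -ccompA (ccompA pF) piF ccomp1m piY0.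
rewrite big_sumType /=.
under eq_bigr => j _ do rewrite -ccompA (ccompA (iX j)).
under [X in _ + X]eq_bigr => j _ do rewrite -ccompA (ccompA (iY j)).
by rewrite -!ccomp_suml -!ccomp_sumr ipX ipY !ccomp1m.
Qed.

Lemma direct_sum_pair X Y Z : direct_sum (fun b : bool => if b then Y else Z) X ->
  exists (iY : mor Y X) (iZ : mor Z X) (pY : mor X Y) (pZ : mor X Z),
    [/\ ccomp pY iY = idmor Y, ccomp pZ iZ = idmor Z, ccomp pY iZ = 0, ccomp pZ iY = 0
      & ccomp iY pY + ccomp iZ pZ = idmor X].
Proof.
move=> [i_ [p_ [pi pi0 ip]]]; exists (i_ true), (i_ false), (p_ true), (p_ false).
split; [exact: (pi true)|exact: (pi false)|exact: (pi0 true false)|exact: (pi0 false true)|].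
by rewrite -ip big_bool.
Qed.

(** Nonzero summands of a proper splitting have smaller [d], so splitting stops; a zero object is
    the sum of the empty family. *)
Lemma decomposition_exists (d : C -> nat) :
  (forall X Y Z, direct_sum (fun b : bool => if b then Y else Z) X ->
    ~ zero_object Y -> ~ zero_object Z -> (d Y < d X)%N /\ (d Z < d X)%N) ->
  forall X, exists (J : finType) (X_ : J -> C), indecomposable_decomposition X_ X.
Proof.
move=> d_lt X; have [k] := ubnP (d X); elim: k X => // k IHk X; rewrite ltnS => le_k.
have [X0|Xn0] := EM (zero_object X).
  by exists void, (of_void C); split=> [[]|]; apply: zero_object_sum X0.
have [Xi|] := EM (indecomposable X).
  exists unit, (fun=> X); split=> //; exists (fun=> idmor X), (fun=> idmor X).
  split=> [j|[] []|] //; first by rewrite ccomp1m.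
  by rewrite (big_pred1 tt) ?ccomp1m // => -[].
move=> /not_andP[//|] /existsNP[Y] /existsNP[Z] /not_implyP[sX] /not_orP[Y0 Z0].
have [lY lZ] := d_lt _ _ _ sX Y0 Z0.
have [I [X_ [iX dX]]] := IHk Y (leq_trans lY le_k).
have [J [Y_ [iY dY]]] := IHk Z (leq_trans lZ le_k).
exists (I + J)%type, (fun s : I + J => match s with inl i => X_ i | inr j => Y_ j end).
by split; [case|apply: direct_sum_cat sX dX dY].
Qed.

End Precategories.

(** * Fully faithful additive functors *)

Section FullyFaithful.
Variables (C D : precat) (F : C -> D) (Fm : forall X Y : C, mor X Y -> mor (F X) (F Y)).
Variable Gm : forall X Y : C, mor (F X) (F Y) -> mor X Y.
Hypothesis FmK : forall X Y, cancel (@Fm X Y) (@Gm X Y).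
Hypothesis GmK : forall X Y, cancel (@Gm X Y) (@Fm X Y).
Hypothesis Fm1 : forall X, Fm (idmor X) = idmor (F X).
Hypothesis FmM : forall X Y Z (g : mor Y Z) (f : mor X Y), Fm (ccomp g f) = ccomp (Fm g) (Fm f).
Hypothesis FmD : forall X Y (f g : mor X Y), Fm (f + g) = Fm f + Fm g.

Let Fm0 X Y : Fm (0 : mor X Y) = 0.
Proof. by apply: (@addrI _ (Fm 0)); rewrite -FmD !addr0. Qed.

Let Fm_sum (J : finType) X Y (f : J -> mor X Y) : Fm (\sum_j f j) = \sum_j Fm (f j).
Proof. exact: (big_morph _ (@FmD X Y) (@Fm0 X Y)). Qed.

Lemma zero_object_functor X : zero_object (F X) <-> zero_object X.
Proof.
rewrite /zero_object; split=> X0; last by rewrite -Fm1 X0 Fm0.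
by apply: (can_inj (@FmK X X)); rewrite Fm1 Fm0.
Qed.

Lemma direct_sum_functor (J : finType) (X_ : J -> C) X :
  direct_sum (fun j => F (X_ j)) (F X) <-> direct_sum X_ X.
Proof.
split=> [] [i_ [p_ [pi pi0 ip]]].
  exists (fun j => Gm (i_ j)), (fun j => Gm (p_ j)); split=> [j|j k jk|];
    apply: (can_inj (@FmK _ _)).
  - by rewrite FmM !GmK Fm1.
  - by rewrite FmM !GmK Fm0 pi0.
  - by rewrite Fm_sum Fm1 -ip; apply: eq_bigr => j _; rewrite FmM !GmK.
exists (fun j => Fm (i_ j)), (fun j => Fm (p_ j)); split=> [j|j k jk|].
- by rewrite -FmM pi Fm1.
- by rewrite -FmM pi0 // Fm0.
- by rewrite -Fm1 -ip Fm_sum; apply: eq_bigr => j _; rewrite FmM.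
Qed.

(** Summands of [F X] are arbitrary objects of [D]; surjectivity on objects allows them to be pulled
    back to [C]. *)
Lemma indecomposable_functor X :
  (forall Y : D, exists X, F X = Y) -> indecomposable (F X) <-> indecomposable X.
Proof.
move=> F_surj.
have FE Y Z : (fun b : bool => F (if b then Y else Z)) = (fun b => if b then F Y else F Z).
  by apply: funext => -[].
split=> [] [n0 ind]; split=> [/zero_object_functor //|Y Z].
  move=> /direct_sum_functor; rewrite FE.
  by move=> /ind[] /zero_object_functor; [left|right].
have [Y' <-] := F_surj Y; have [Z' <-] := F_surj Z; rewrite -FE.
by move=> /direct_sum_functor/ind[] /zero_object_functor; [left|right].
Qed.

End FullyFaithful.

(** * Morphisms between intervals *)

Section IntervalHoms.
Variables (K : fieldType) (m : nat) (tau : 'I_m -> direction).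
Implicit Types (x y z : ivl m) (v : 'I_m.+1).

(** A convex set of vertices is a segment, so whatever agrees across each edge inside it is
    constant. It is applied to the scalars of a morphism on the intersection of two intervals. *)
Lemma between_const T (F : 'I_m.+1 -> T) (P : pred 'I_m.+1) :
  (forall u v w : 'I_m.+1, (u <= v <= w)%N -> P u -> P w -> P v) ->
  (forall i : 'I_m, P (widen_ord (leqnSn m) i) -> P (lift ord0 i) ->
     F (widen_ord (leqnSn m) i) = F (lift ord0 i)) ->
  forall u v, P u -> P v -> F u = F v.
Proof.
move=> P_conv F_adj.
have far k : forall u v : 'I_m.+1, (v = u + k :> nat)%N -> P u -> P v -> F u = F v.
  elim: k => [|k IHk] u v vE Pu Pv; first by congr F; apply: val_inj; rewrite /= vE addn0.
  have lt_um : (u + k < m)%N by rewrite -ltnS -addnS -vE.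
  pose i := Ordinal lt_um.
  have vr : v = lift ord0 i by apply: val_inj; rewrite /= /bump /= vE addnS.
  have Pl : P (widen_ord (leqnSn m) i).
    by apply: (P_conv u _ v) => //=; rewrite leq_addr vE leq_add2l leqnSn.
  by rewrite (IHk u (widen_ord (leqnSn m) i)) // vr; apply: F_adj; rewrite -?vr.
move=> u v Pu Pv; have [le_u|/ltnW le_u] := leqP u v.
  by apply: (far (v - u)%N) => //; rewrite subnKC.
by apply/esym/(far (u - v)%N) => //; rewrite subnKC.
Qed.

Lemma in_ivl_conv x (u v w : 'I_m.+1) :
  (u <= v <= w)%N -> in_ivl x u -> in_ivl x w -> in_ivl x v.
Proof.
rewrite /in_ivl => /andP[uv vw] /andP[xu _] /andP[_ wx].
by rewrite (leq_trans xu uv) (leq_trans vw wx).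
Qed.

(** The spaces of an interval have dimension 0 or 1 and [pid_mx 1] is the canonical map between two
    of them; the scalar records whether the space in the middle is nonzero. *)
Lemma pid_mx1M (b c d : bool) :
  (pid_mx 1 : 'M[K]_(b, c)) *m (pid_mx 1 : 'M_(c, d)) = c%:R *: pid_mx 1.
Proof.
by case: b c d => [] [] []; apply/matrixP=> -[[|?] ?] -[[|?] ?] //; rewrite !mxE
  ?big_ord0 ?big_ord1 ?mxE /= ?mul1r ?mul0r.
Qed.

Lemma rV_bool_eq (b : bool) : ~~ b -> forall u v : 'rV[K]_b, u = v.
Proof. by case: b => // _ u v; rewrite [u]thinmx0 [v]thinmx0. Qed.

Lemma scale_pid_mx1_inj (b d : bool) (c c' : K) : b -> d ->
  c *: (pid_mx 1 : 'M_(b, d)) = c' *: pid_mx 1 -> c = c'.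
Proof.
case: b d => [] [] // _ _ /matrixP/(_ ord0 ord0); by rewrite !mxE /= !mulr1.
Qed.

(* The scalar of a morphism of intervals at a vertex, which is 0 outside of the
   intersection. *)
Definition hom_coef x y (f : rep_hom (ivl_rep K tau x) (ivl_rep K tau y)) v : K :=
  \sum_j (rep_fun f v (const_mx 1) : 'rV_(in_ivl y v)) 0 j.

Lemma hom_coefE x y (f : rep_hom (ivl_rep K tau x) (ivl_rep K tau y)) v
    (u : 'rV_(in_ivl x v)) : rep_fun f v u = hom_coef f v *: (u *m pid_mx 1).
Proof.
rewrite /hom_coef; move: (rep_fun f v) u => /=.
case: (in_ivl x v) => [] /= g u; last by rewrite [u]thinmx0 mul0mx scaler0 linear0.
case: (in_ivl y v) g => [] /= g; last by rewrite [LHS]thinmx0 [RHS]thinmx0.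
rewrite big_ord1 pid_mx_1 mulmx1.
have -> : u = u 0 0 *: const_mx 1 by apply/rowP=> i; rewrite !mxE ord1 mulr1.
rewrite linearZ /=; apply/rowP=> i; rewrite !mxE ord1; rewrite mulr1 mulrC; congr (_ * _).
Qed.

Lemma hom_coef0 x y (f : rep_hom (ivl_rep K tau x) (ivl_rep K tau y)) v :
  ~~ (in_ivl x v && in_ivl y v) -> hom_coef f v = 0.
Proof.
rewrite /hom_coef; move: (rep_fun f v) => /=.
case: (in_ivl x v) => [] /= g; last first.
  by rewrite [const_mx _]thinmx0 linear0 big1 // => i _; rewrite mxE.
by case: (in_ivl y v) g => [] /= g // _; rewrite big_ord0.
Qed.

Lemma ivl_actE x (a : edge (An tau)) (u : 'rV_(in_ivl x (src a))) :
  rep_act (ivl_rep K tau x) a u = u *m pid_mx 1.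
Proof. by rewrite lfunE. Qed.

(** The two ways round the square of an edge pass through [x] at its target and through [y] at its
    source; the booleans say whether these corners are nonzero. *)
Lemma hom_coef_edge x y (f : rep_hom (ivl_rep K tau x) (ivl_rep K tau y)) (a : edge (An tau)) :
  in_ivl x (src a) -> in_ivl y (tgt a) ->
  (in_ivl x (tgt a))%:R * hom_coef f (tgt a) = (in_ivl y (src a))%:R * hom_coef f (src a).
Proof.
move=> xs yt; have /forallP/(_ a)/eqP/lfunP E := rep_homP f.
apply: (scale_pid_mx1_inj xs yt); rewrite !(mulrC (nat_of_bool _)%:R) -!scalerA -!pid_mx1M.
have {}E u := E u; apply/row_matrixP=> i.
have := E (row i 1%:M); rewrite !comp_lfunE !ivl_actE !hom_coefE.
rewrite -!scalemxAl -!mulmxA => E'.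
by rewrite !linearZ /= -[pid_mx 1 *m pid_mx 1]mul1mx -[X in _ = _ *: row i X]mul1mx !row_mul.
Qed.

Lemma hom_coef_const x y (f : rep_hom (ivl_rep K tau x) (ivl_rep K tau y)) u v :
  in_ivl x u && in_ivl y u -> in_ivl x v && in_ivl y v -> hom_coef f u = hom_coef f v.
Proof.
move: u v; apply: between_const => [u v w uvw /andP[xu yu] /andP[xw yw]|i].
  by rewrite (in_ivl_conv uvw xu xw) (in_ivl_conv uvw yu yw).
move=> /andP[xl yl] /andP[xr yr]; have := @hom_coef_edge x y f i; rewrite /=.
by case: (tau i) => /(_ _ _)/=; rewrite ?xl ?xr ?yl ?yr !mul1r => /(_ isT isT).
Qed.

Lemma hom_eq0 x y (f : rep_hom (ivl_rep K tau x) (ivl_rep K tau y)) v :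
  in_ivl x v -> in_ivl y v -> hom_coef f v = 0 -> f = 0.
Proof.
move=> xv yv f0; apply: val_inj; apply/ffunP=> w; rewrite ffunE.
apply/lfunP=> u; rewrite hom_coefE lfunE.
have [xyw|/hom_coef0 ->] := boolP (in_ivl x w && in_ivl y w); last by rewrite scale0r.
by rewrite (hom_coef_const f xyw (v := v)) ?xv ?yv // f0 scale0r.
Qed.

Definition edges_ge x y : bool :=
  [forall a : edge (An tau), in_ivl x (src a) && in_ivl y (tgt a) ==>
     (in_ivl y (src a) == in_ivl x (tgt a))].

Definition ivl_basis_fam x y : rep_family (ivl_rep K tau x : rep K (An tau)) (ivl_rep K tau y) :=
  [ffun v => linfun (mulmxr (pid_mx 1))].

Lemma ivl_basis_subproof x y : edges_ge x y -> ivl_basis_fam x y \in @intertwines K (An tau) _ _.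
Proof.
move=> /forallP xy; apply/forallP=> a; apply/eqP/lfunP=> u; rewrite !ffunE !comp_lfunE !lfunE /=.
rewrite -!mulmxA !pid_mx1M.
have /orP[xs|/rV_bool_eq xs] := orbN (in_ivl x (src a)); last by rewrite (xs u 0) !mul0mx.
have /orP[yt|/rV_bool_eq yt] := orbN (in_ivl y (tgt a)); last exact: yt.
by have /eqP -> := implyP (xy a) (introT andP (conj xs yt)).
Qed.

Lemma hom_coef_basis x y (xy : edges_ge x y) v : in_ivl x v -> in_ivl y v ->
  hom_coef (RepHom (ivl_basis_subproof xy)) v = 1.
Proof.
move=> xv yv; apply: (scale_pid_mx1_inj xv yv); apply/row_matrixP=> i.
have := hom_coefE (RepHom (ivl_basis_subproof xy)) (row i 1%:M).
rewrite /= ffunE lfunE /= -!row_mul !mul1mx => E.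
by rewrite linearZ /= -E scale1r.
Qed.

(** A morphism has the same scalar along the whole intersection, so Hom is nonzero exactly if the
    identities on the intersection form a morphism. The right side no longer depends on [K]. *)
Lemma ivl_geE x y :
  ivl_ge K tau x y = [exists v, in_ivl x v && in_ivl y v] && edges_ge x y.
Proof.
apply/idP/idP => [xy|/andP[/existsP[v /andP[xv yv]] xy]].
  apply/andP; split; last first.
    by apply/forallP=> a; apply/implyP=> /andP[xs yt]; rewrite (ivl_ge_edge xy xs yt).
  move: xy => /asboolP[f f0]; apply: contra_notT f0 => /existsPn xy0.
  apply: val_inj; apply/ffunP=> v; rewrite ffunE; apply/lfunP=> u.
  by rewrite hom_coefE lfunE hom_coef0 ?scale0r.
apply/asboolP; exists (RepHom (ivl_basis_subproof xy)) => E.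
have := hom_coef_basis xy xv yv; rewrite E /hom_coef big1 => [/eqP|j _].
  by rewrite eq_sym oner_eq0.
by rewrite ffunE lfunE mxE.
Qed.

Lemma hom_not_ge x y (f : rep_hom (ivl_rep K tau x) (ivl_rep K tau y)) : ~~ ivl_ge K tau x y -> f = 0.
Proof. by apply: contraNP => f0; apply/asboolP; exists f. Qed.

Lemma hom_coef_neq0 x y (f : rep_hom (ivl_rep K tau x) (ivl_rep K tau y)) v :
  in_ivl x v -> in_ivl y v -> f <> 0 -> hom_coef f v != 0.
Proof. by move=> xv yv f0; apply/eqP=> /(hom_eq0 xv yv). Qed.

Lemma hom_neq0_ex x y (f : rep_hom (ivl_rep K tau x) (ivl_rep K tau y)) :
  f <> 0 -> exists v, [/\ in_ivl x v, in_ivl y v & hom_coef f v != 0].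
Proof.
move=> f0; have : ivl_ge K tau x y by apply/asboolP; exists f.
rewrite ivl_geE => /andP[/existsP[v /andP[xv yv]] _]; exists v; split=> //.
exact: hom_coef_neq0.
Qed.

Lemma hom_coef_comp x y z (g : rep_hom (ivl_rep K tau y) (ivl_rep K tau z))
    (f : rep_hom (ivl_rep K tau x) (ivl_rep K tau y)) v :
  in_ivl x v -> in_ivl z v ->
  hom_coef (rep_comp g f) v = (in_ivl y v)%:R * hom_coef g v * hom_coef f v.
Proof.
move=> xv zv; apply: (scale_pid_mx1_inj xv zv); apply/row_matrixP=> i.
have := hom_coefE (rep_comp g f) (row i 1%:M).
rewrite ffunE comp_lfunE !hom_coefE /= -!scalemxAl -!mulmxA pid_mx1M -!scalemxAr scalerA => E.
by rewrite !linearZ /= -[pid_mx 1]mul1mx row_mul -E scalerA mulrC mulrA.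
Qed.

Lemma ivl_ge_refl x : ivl_ge K tau x x.
Proof.
rewrite ivl_geE; apply/andP; split.
  apply/existsP; exists (val x).1; rewrite /in_ivl leqnn.
  by have /= -> := valP x.
by apply/forallP=> a; apply/implyP=> /andP[-> ->].
Qed.

(** Helly's theorem on a line: among the three pairwise common points, the one between the other two
    lies in all three intervals. *)
Lemma ivl_helly x y z (v1 v2 v3 : 'I_m.+1) :
  in_ivl x v1 -> in_ivl y v1 -> in_ivl y v2 -> in_ivl z v2 -> in_ivl x v3 -> in_ivl z v3 ->
  exists v, [/\ in_ivl x v, in_ivl y v & in_ivl z v].
Proof.
wlog l12 : x z v1 v2 v3 / (v1 <= v2)%N.
  move=> H x1 y1 y2 z2 x3 z3; have [l|/ltnW l] := leqP v1 v2; first exact: H l x1 y1 y2 z2 x3 z3.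
  by have [v [? ? ?]] := H z x v2 v1 v3 l z2 y2 y1 x1 z3 x3; exists v.
move=> x1 y1 y2 z2 x3 z3; have [l|/ltnW l3] := leqP v2 v3.
  by exists v2; split=> //; apply: (@in_ivl_conv x v1 v2 v3) => //; rewrite l12.
have [l|/ltnW l] := leqP v3 v1.
  by exists v1; split=> //; apply: (@in_ivl_conv z v3 v1 v2) => //; rewrite l.
exists v3; split=> //; apply: (@in_ivl_conv y v1 v3 v2) => //; by rewrite l.
Qed.

(** If [x] has a nonzero morphism to [z], then Helly gives a vertex common to all three intervals,
    where the composite is nonzero; its scalar is constant on the intersection of [x] and [z], which
    forces [v] into [y]. Thus basis morphisms compose to a basis morphism or to 0, uniformly in the
    vertex. *)
Lemma ivl_ge_comp x y z v : ivl_ge K tau x y -> ivl_ge K tau y z ->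
  in_ivl x v -> in_ivl z v -> in_ivl y v = ivl_ge K tau x z.
Proof.
move=> xy yz xv zv; have /asboolP[f f0] := xy; have /asboolP[g g0] := yz.
apply/idP/idP=> [yv|xz].
  apply/asboolP; exists (rep_comp g f) => gf0.
  have : hom_coef (rep_comp g f) v != 0.
    by rewrite hom_coef_comp // yv mul1r mulf_neq0 // hom_coef_neq0.
  rewrite gf0 /hom_coef big1 ?eqxx // => j _; by rewrite ffunE lfunE mxE.
have [v1 [x1 y1 _]] := hom_neq0_ex f0; have [v2 [y2 z2 _]] := hom_neq0_ex g0.
have [w [xw yw zw]] := ivl_helly x1 y1 y2 z2 xv zv.
have: hom_coef (rep_comp g f) w != 0.
  by rewrite hom_coef_comp // yw mul1r mulf_neq0 // hom_coef_neq0.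
rewrite (hom_coef_const _ (v := v)) ?xw ?zw ?xv ?zv // hom_coef_comp //.
by case: (in_ivl y v) => //; rewrite !mul0r eqxx.
Qed.

End IntervalHoms.

(** * Morphisms between sums of intervals *)

Section BlockMorphisms.
Variables (K : fieldType) (m : nat) (tau : 'I_m -> direction).

Local Notation ge := (ivl_ge K tau).
Local Notation mask := (strongly_zero_mask tau).
Local Notation bm := (block_morphism tau).

Lemma maskE p q (rlab : 'I_q -> ivl m) (clab : 'I_p -> ivl m) (A : 'M[K]_(q, p)) r c :
  mask rlab clab A r c = (ge (clab c) (rlab r))%:R * A r c.
Proof. by rewrite mxE; case: ifP; rewrite ?mul1r ?mul0r. Qed.

Lemma mask_id p q (rlab : 'I_q -> ivl m) (clab : 'I_p -> ivl m) (A : 'M[K]_(q, p)) :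
  mask rlab clab (mask rlab clab A) = mask rlab clab A.
Proof. by apply/matrixP=> r c; rewrite !maskE; case: (ge _ _); rewrite ?mul1r ?mul0r. Qed.

Lemma block_morphismE p q (rlab : 'I_q -> ivl m) (clab : 'I_p -> ivl m) (A : 'M[K]_(q, p)) v
    (u : 'rV_#|alive clab v|) :
  rep_fun (bm rlab clab A) v u =
  u *m \matrix_(i, j) mask rlab clab A (enum_val j) (enum_val i).
Proof. by rewrite /= ffunE lfunE. Qed.

Lemma block_morphism_eq p q (rlab : 'I_q -> ivl m) (clab : 'I_p -> ivl m) (A B : 'M[K]_(q, p)) :
  mask rlab clab A = mask rlab clab B -> bm rlab clab A = bm rlab clab B.
Proof.
move=> AB; apply: val_inj; apply/ffunP=> v; apply/lfunP=> u.
by rewrite !block_morphismE AB.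
Qed.

Lemma block_morphism_inj p q (rlab : 'I_q -> ivl m) (clab : 'I_p -> ivl m) (A B : 'M[K]_(q, p)) :
  bm rlab clab A = bm rlab clab B -> mask rlab clab A = mask rlab clab B.
Proof.
move=> AB; apply/matrixP=> r c; rewrite !maskE.
have [g|] := boolP (ge (clab c) (rlab r)); last by rewrite !mul0r.
have := g; rewrite ivl_geE => /andP[/existsP[v /andP[cv rv]] _].
pose i := enum_rank_in (cv : c \in alive clab v) c.
pose j := enum_rank_in (rv : r \in alive rlab v) r.
have : rep_fun (bm rlab clab A) v (delta_mx 0 i) = rep_fun (bm rlab clab B) v (delta_mx 0 i).
  by rewrite AB.
rewrite !block_morphismE -!rowE => /rowP/(_ j).
by rewrite !mxE !enum_rankK_in // g !mul1r.
Qed.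

(** At a vertex only the middle summands alive there contribute. By [ivl_ge_comp] these are the ones
    whose basis morphisms have a nonzero composite, so the vertex drops out. *)
Lemma block_morphism_comp p q r (l1 : 'I_p -> ivl m) (l2 : 'I_q -> ivl m) (l3 : 'I_r -> ivl m)
    (B : 'M[K]_(r, q)) (A : 'M[K]_(q, p)) :
  rep_comp (bm l3 l2 B) (bm l2 l1 A) = bm l3 l1 (mask l3 l2 B *m mask l2 l1 A).
Proof.
apply: val_inj; apply/ffunP=> v; apply/lfunP=> u.
rewrite block_morphismE ffunE comp_lfunE !block_morphismE -mulmxA; congr (_ *m _).
apply/matrixP=> i j; rewrite [LHS]mxE [RHS]mxE.
under eq_bigr => k _ do rewrite mxE [X in _ * X]mxE mulrC.
rewrite -(big_enum_val (fun k => mask l3 l2 B (enum_val j) k * mask l2 l1 A k (enum_val i))) /=.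
rewrite maskE mxE mulr_sumr big_mkcond /=; apply: eq_bigr => k _.
rewrite -[k \in _]/(in_ivl (l2 k) v) !maskE.
have := enum_valP i; have := enum_valP j; rewrite !unfold_in /alive.
move: (enum_val i) (enum_val j) => {}i {}j jv iv.
have [g1|] := boolP (ge (l1 i) (l2 k)); last by rewrite !mul0r !mulr0 if_same.
have [g2|] := boolP (ge (l2 k) (l3 j)); last by rewrite !mul0r !mulr0 if_same.
by rewrite (ivl_ge_comp g1 g2 iv jv); case: (ge _ _); rewrite ?mul1r ?mul0r.
Qed.

Lemma block_morphism1 p (lab : 'I_p -> ivl m) : bm lab lab (1%:M : 'M[K]_p) = idmor (ivl_sum K tau lab).
Proof.
apply: val_inj; apply/ffunP=> v; apply/lfunP=> u.
rewrite block_morphismE /= ffunE id_lfunE -[RHS]mulmx1; congr (_ *m _).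
apply/matrixP=> i j; rewrite !mxE (inj_eq enum_val_inj) (eq_sym j).
by case: (eqVneq i j) => [->|]; rewrite ?ivl_ge_refl ?if_same.
Qed.

Lemma block_morphism0 p q (rlab : 'I_q -> ivl m) (clab : 'I_p -> ivl m) :
  bm rlab clab (0 : 'M[K]_(q, p)) = 0.
Proof.
apply: val_inj; apply/ffunP=> v; apply/lfunP=> u; rewrite block_morphismE ffunE lfunE.
rewrite (_ : \matrix_(i, j) _ = 0) ?mulmx0 //.
by apply/matrixP=> i j; rewrite !mxE if_same.
Qed.

Lemma ord_bool_nat0 (b : bool) (i : 'I_b) : i = 0%N :> nat.
Proof. by case: b i => -[[|i]]. Qed.

Lemma ord_bool_eq (b : bool) (i j : 'I_b) : i = j.
Proof. by apply: val_inj; rewrite /= !ord_bool_nat0. Qed.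

Lemma ivl_inE p (lab : 'I_p -> ivl m) j v (u : 'rV_(in_ivl (lab j) v)) :
  rep_fun (RepHom (ivl_in_subproof K tau lab j)) v u = u *m \matrix_(i, k) (enum_val k == j)%:R.
Proof. by rewrite /= ffunE lfunE. Qed.

Lemma ivl_prE p (lab : 'I_p -> ivl m) j v (u : 'rV_#|alive lab v|) :
  rep_fun (RepHom (ivl_pr_subproof K tau lab j)) v u = u *m \matrix_(k, i) (enum_val k == j)%:R.
Proof. by rewrite /= ffunE lfunE. Qed.

Lemma block_morphism_full p q (rlab : 'I_q -> ivl m) (clab : 'I_p -> ivl m)
    (f : mor (ivl_sum K tau clab) (ivl_sum K tau rlab)) :
  exists A, f = bm rlab clab A.
Proof.
pose in_ c : mor (ivl_rep K tau (clab c)) (ivl_sum K tau clab) := RepHom (ivl_in_subproof K tau clab c).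
pose pr_ r : mor (ivl_sum K tau rlab) (ivl_rep K tau (rlab r)) := RepHom (ivl_pr_subproof K tau rlab r).
pose g r c := rep_comp (rep_comp (pr_ r) f) (in_ c).
(* The scalar of each component is read off at any common vertex; [hom_coef_const] makes the choice
   irrelevant. *)
pose A := \matrix_(r, c) if [pick v | in_ivl (clab c) v && in_ivl (rlab r) v] is Some v
                         then hom_coef (g r c) v else 0.
exists A; apply: val_inj; apply/ffunP=> v; apply/lfunP=> u.
rewrite block_morphismE -[LHS]mul_rV_lin1; congr (_ *m _).
apply/matrixP=> i j; rewrite [RHS]mxE maskE [A _ _]mxE.
have iv := enum_valP i; have jv := enum_valP j; rewrite !unfold_in /alive in iv jv.
have E : lin1_mx (rep_fun f v) i j = hom_coef (g (enum_val j) (enum_val i)) v.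
  apply: (@scale_pid_mx1_inj K _ _ _ _ iv jv); apply/row_matrixP=> k.
  have := hom_coefE (g (enum_val j) (enum_val i)) (row k 1%:M).
  rewrite /g ffunE comp_lfunE ffunE comp_lfunE ivl_inE ivl_prE => E.
  rewrite !linearZ /= -{2}[pid_mx 1]mul1mx row_mul -{}E.
  rewrite (_ : row k 1%:M *m _ = delta_mx 0 i); last first.
    apply/rowP=> l; rewrite !mxE (sum_const_bool (x := (l == i)%:R)) => [|k'].
      by rewrite iv mul1r.
    by rewrite !mxE (inj_eq enum_val_inj) (ord_bool_eq k k') eqxx mul1r.
  rewrite [lin1_mx _ _ _]mxE; apply/rowP=> l; rewrite !mxE (bigD1 j) //= big1 => [|k' ne].
    by rewrite !mxE eqxx mulr1 addr0 ord_bool_nat0 ord_bool_nat0 mulr1.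
  by rewrite !mxE (inj_eq enum_val_inj) (negPf ne) mulr0.
have [g0|g0] := boolP (ge (clab (enum_val i)) (rlab (enum_val j))); last first.
  by rewrite mul0r E [g _ _](hom_not_ge _ g0) /hom_coef big1 // => l _; rewrite ffunE lfunE mxE.
rewrite mul1r E; case: pickP => [w /andP[cw rw]|/(_ v)]; last by rewrite iv jv.
by apply: hom_coef_const; rewrite ?iv ?cw.
Qed.

(** The entry at [(a, b)] adds row [b] to row [a] from the left and column [a] to column [b] from
    the right; the condition is permissibility in both readings. *)
Definition admissible p (lab : 'I_p -> ivl m) (P : 'M[K]_p) : Prop :=
  forall a b, P a b != 0 -> ge (lab b) (lab a).

Lemma admissible_mask p (lab : 'I_p -> ivl m) (P : 'M[K]_p) : admissible lab P -> mask lab lab P = P.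
Proof.
move=> P_adm; apply/matrixP=> a b; rewrite maskE.
have [->|/P_adm ->] := eqVneq (P a b) 0; by rewrite ?mulr0 ?mul1r.
Qed.

Lemma block_morphism_inverse p (lab : 'I_p -> ivl m) (P P' : 'M[K]_p) :
  admissible lab P -> admissible lab P' -> P *m P' = 1%:M -> 
  inverse (bm lab lab P : mor (ivl_sum K tau lab) (ivl_sum K tau lab)) (bm lab lab P').
Proof.
move=> hP hP' PP'; split; rewrite -block_morphism1 [LHS]block_morphism_comp !admissible_mask //.
  by rewrite (mulmx1C PP').
by rewrite PP'.
Qed.

(** The product may acquire entries in strongly zero blocks; they stand for zero morphisms, so
    masking them does not change the arrow. *)
Lemma block_row_iso p q (rlab : 'I_q -> ivl m) (clab : 'I_p -> ivl m) (A : 'M[K]_(q, p)) P P' :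
  mask rlab clab A = A -> admissible rlab P -> admissible rlab P' -> P *m P' = 1%:M ->
  isomorphic (Arrow (bm rlab clab A) : arr (repA K tau))
             (Arrow (bm rlab clab (mask rlab clab (P *m A)))).
Proof.
move=> mA hP hP' PP'; have [PP1 PP2] := block_morphism_inverse hP hP' PP'.
have E : ccomp (bm rlab rlab P : mor (ivl_sum K tau rlab) (ivl_sum K tau rlab)) (bm rlab clab A)
      = bm rlab clab (mask rlab clab (P *m A)).
  rewrite [LHS]block_morphism_comp mA admissible_mask //.
  by apply: block_morphism_eq; rewrite mask_id.
have F1 : (idmor (ivl_sum K tau clab), bm rlab rlab P : mor (ivl_sum K tau rlab) (ivl_sum K tau rlab)) \in
   @arr_square (repA K tau) (Arrow (bm rlab clab A)) (Arrow (bm rlab clab (mask rlab clab (P *m A)))).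
  by rewrite unfold_in; apply/eqP/(etrans E)/esym/ccompm1.
have F2 : (idmor (ivl_sum K tau clab), bm rlab rlab P' : mor (ivl_sum K tau rlab) (ivl_sum K tau rlab)) \in
   @arr_square (repA K tau) (Arrow (bm rlab clab (mask rlab clab (P *m A)))) (Arrow (bm rlab clab A)).
  rewrite unfold_in; apply/eqP; rewrite [RHS]ccompm1 /= -E.
  apply: etrans (@ccompA (repA K tau) _ _ _ _ _ _ _) _.
  rewrite [X in ccomp X _]PP1; exact: (@ccomp1m (repA K tau)).
exists (ArrHom F1), (ArrHom F2); split; apply: val_inj; congr pair;
  first [exact: PP1 | exact: PP2 | exact: (@ccomp1m (repA K tau))].
Qed.

Lemma block_col_iso p q (rlab : 'I_q -> ivl m) (clab : 'I_p -> ivl m) (A : 'M[K]_(q, p)) Q Q' :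
  mask rlab clab A = A -> admissible clab Q -> admissible clab Q' -> Q *m Q' = 1%:M ->
  isomorphic (Arrow (bm rlab clab A) : arr (repA K tau))
             (Arrow (bm rlab clab (mask rlab clab (A *m Q)))).
Proof.
move=> mA hP hP' PP'; have [PP1 PP2] := block_morphism_inverse hP hP' PP'.
have E : ccomp (bm rlab clab A : mor (ivl_sum K tau clab) (ivl_sum K tau rlab))
               (bm clab clab Q : mor (ivl_sum K tau clab) (ivl_sum K tau clab))
      = bm rlab clab (mask rlab clab (A *m Q)).
  rewrite [LHS]block_morphism_comp mA admissible_mask //.
  by apply: block_morphism_eq; rewrite mask_id.
have F1 : (bm clab clab Q' : mor (ivl_sum K tau clab) (ivl_sum K tau clab), idmor (ivl_sum K tau rlab)) \in
   @arr_square (repA K tau) (Arrow (bm rlab clab A)) (Arrow (bm rlab clab (mask rlab clab (A *m Q)))).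
  rewrite unfold_in; apply/eqP; rewrite [LHS]ccomp1m /= -E.
  apply/esym; apply: etrans (esym (@ccompA (repA K tau) _ _ _ _ _ _ _)) _.
  rewrite [X in ccomp _ X]PP2; exact: (@ccompm1 (repA K tau)).
have F2 : (bm clab clab Q : mor (ivl_sum K tau clab) (ivl_sum K tau clab), idmor (ivl_sum K tau rlab)) \in
   @arr_square (repA K tau) (Arrow (bm rlab clab (mask rlab clab (A *m Q)))) (Arrow (bm rlab clab A)).
  by rewrite unfold_in; apply/eqP; rewrite [LHS]ccomp1m; apply: esym E.
exists (ArrHom F1), (ArrHom F2); split; apply: val_inj; congr pair;
  first [exact: PP1 | exact: PP2 | exact: (@ccomp1m (repA K tau))].
Qed.

End BlockMorphisms.

(** * Ladders and arrows *)

Section LadderEquivalence.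
Variables (K : fieldType) (m : nat) (tau : 'I_m -> direction).

Definition is_fwd (d : direction) : bool := if d is fwd then true else false.

(** Neighboring vertices are joined by a single arrow, so a path cannot turn back: it runs
    monotonically and all edges between its ends point its way. *)
Lemma path_sign (s t : 'I_m.+1) (p : @qpath (An tau) s t) :
  (forall i : 'I_m, (s <= i < t)%N -> is_fwd (tau i)) /\
  (forall i : 'I_m, (t <= i < s)%N -> ~~ is_fwd (tau i)).
Proof.
elim: p => [v|a w p [IHf IHb]]; first by split=> i /andP[l1 l2]; have := leq_trans l2 l1; rewrite ltnn.
move: IHf IHb; rewrite /=; case Ea: (tau a) => /= IHf IHb.
  have lt_aw : (a < w)%N.
    rewrite ltnNge; apply/negP=> le_wa; have := IHb a; rewrite Ea /= /bump /= le_wa add1n ltnSn.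
    by move=> /(_ isT).
  split=> i /andP[l1 l2].
    have [->|ne] := eqVneq i a; first by rewrite Ea.
    by apply: IHf; rewrite l2 andbT /bump /= add1n ltn_neqAle eq_sym ne.
  by have := leq_ltn_trans l1 l2; rewrite ltnNge (ltnW lt_aw).
have le_wa : (w <= a)%N.
  rewrite leqNgt; apply/negP=> lt_aw; have := IHf a; rewrite Ea /= leqnn lt_aw.
  by move=> /(_ isT).
split=> i /andP[l1 l2].
  have := leq_trans l2 le_wa; rewrite ltnNge; rewrite /bump /= add1n in l1.
  by rewrite (ltnW (leq_trans _ l1)).
have [->|ne] := eqVneq i a; first by rewrite Ea.
by apply: IHb; rewrite l1 /=; move: l2; rewrite /bump /= add1n ltnS ltn_neqAle ne.
Qed.

Lemma path_first (a : 'I_m) (t : 'I_m.+1) (p : @qpath (An tau) (tgt (q:=An tau) a) t) :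
  if is_fwd (tau a) then (a < t)%N else (t <= a)%N.
Proof.
have [pf pb] := path_sign p; move: pf pb; rewrite /=.
case Ea: (tau a) => /= pf pb; [rewrite ltnNge | rewrite leqNgt]; apply/negP=> l.
  by have := pb a; rewrite l /bump /= add1n ltnSn Ea => /(_ isT).
by have := pf a; rewrite l leqnn Ea => /(_ isT).
Qed.

Lemma srcE (a : 'I_m) :
  nat_of_ord (src (q:=An tau) a : 'I_m.+1) = if is_fwd (tau a) then nat_of_ord a else a.+1.
Proof. by rewrite /=; case: (tau a); rewrite //= /bump. Qed.

Lemma path_nonnil (a : 'I_m) (t : 'I_m.+1) (p : @qpath (An tau) (tgt (q:=An tau) a) t) :
  t <> src (q:=An tau) a.
Proof.
move=> /(congr1 (@nat_of_ord m.+1)); have := path_first p; rewrite srcE.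
by case: ifP => _ l E; move: l; rewrite E ltnn.
Qed.

Section PathIndependence.
Variable X : rep K (An tau).

(** Case analysis on a path needs its end points to be variables, so the other path is compared
    along an equation of vertices; [eq_axiomK] removes the cast. *)
Definition hom_cast s t t' (e : t = t') (h : 'Hom(rep_space X s, rep_space X t)) :
    'Hom(rep_space X s, rep_space X t') :=
  eq_rect t (fun t => 'Hom(rep_space X s, rep_space X t)) h t' e.

Definition hom_cast_src s s' t (e : s = s') (h : 'Hom(rep_space X s, rep_space X t)) :
    'Hom(rep_space X s', rep_space X t) :=
  eq_rect s (fun s => 'Hom(rep_space X s, rep_space X t)) h s' e.

Lemma act_loop s t (q : @qpath (An tau) s t) (e : s = t) : act_path X q = hom_cast e \1%VF.
Proof.
case: q e => [v e|a t' q e]; first by rewrite (eq_axiomK e).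
by case: (path_nonnil q).
Qed.

Lemma act_cons a t (p : @qpath (An tau) (tgt a) t) s (q : qpath s t) (e : s = src a) :
  (forall q, act_path X p = act_path X q) ->
  (act_path X p \o rep_act X a)%VF = hom_cast_src e (act_path X q).
Proof.
move=> IH; case: q e p IH => [v e p|a' t' q e p IH]; first by case: (path_nonnil p); rewrite -e.
have aa : a' = a.
  have := path_first p; have := path_first q; have := congr1 (@nat_of_ord m.+1) e.
  rewrite !srcE; case: (is_fwd (tau a')); case: (is_fwd (tau a)) => /= E l1 l2; apply: val_inj => //=.
  - by move: l1 l2; rewrite E => l1 l2; have := leq_trans l1 l2; rewrite ltnNge leqnSn.
  - by move: l1 l2; rewrite -E => l1 l2; have := leq_trans l2 l1; rewrite ltnNge leqnSn.
  - by case: E.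
move: q e; rewrite aa => q e; rewrite (eq_axiomK e) /=; by rewrite (IH q).
Qed.

Lemma act_path_unique s t (p q : @qpath (An tau) s t) : act_path X p = act_path X q.
Proof.
elim: p q => [v q|a t' p IH q]; first by rewrite (act_loop q erefl).
by rewrite /= (act_cons q erefl IH).
Qed.

End PathIndependence.

Section OfArrow.
Variable X : arr (repA K tau).

Definition arr_row (b : bool) : rep K (An tau) := if b then arr_cod X else arr_dom X.

Definition unladder_rep : rep K (ladder tau) :=
  @Rep K (ladder tau) (fun v => rep_space (arr_row v.2) v.1)
    (fun e => match e with
              | inl (a, b) => rep_act (arr_row b) a
              | inr v => rep_fun (arr_map X : rep_hom _ _) v
              end).

Fixpoint row_path s t (p : @qpath (ladder tau) s t) : @qpath (An tau) s.1 t.1 :=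
  match p with
  | qpath_nil v => qpath_nil v.1
  | qpath_cons e t p => match e return @qpath (ladder tau) (@tgt (ladder tau) e) t -> @qpath (An tau) (@src (ladder tau) e).1 t.1 with
      | inl (a, b) => fun p => @qpath_cons (An tau) a _ (row_path p)
      | inr v => fun p => row_path p
      end p
  end.

(** The vertical part of a path. Paths never lead down, so the value from the top to the bottom row
    is arbitrary; 0 keeps [row_change_act] true. *)
Definition row_change (b c : bool) v : 'Hom(rep_space (arr_row b) v, rep_space (arr_row c) v) :=
  match b, c with
  | false, true => rep_fun (arr_map X : rep_hom _ _) v
  | true, false => 0
  | true, true | false, false => \1%VF
  end.

Lemma row_change_act b c a :
  (row_change b c (tgt a) \o rep_act (arr_row b) a = rep_act (arr_row c) a \o row_change b c (src a))%VF.
Proof.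
case: b c => [] []; rewrite /= ?comp_lfun1l ?comp_lfun1r ?comp_lfun0l ?comp_lfun0r //.
by have /forallP/(_ a)/eqP := rep_homP (arr_map X : rep_hom _ _).
Qed.

Lemma path_up s t (p : @qpath (ladder tau) s t) : s.2 -> t.2.
Proof. by elim: p => [//|[[a b]|v] t' p IH] //= _; apply: IH. Qed.

(** Commuting squares move the vertical step to the start of the path. What remains lies in one row,
    where a path is determined by its end points up to action, and commutativity follows. *)
Lemma unladder_act s t (p : @qpath (ladder tau) s t) :
  act_path unladder_rep p = (act_path (arr_row t.2) (row_path p) \o row_change s.2 t.2 s.1)%VF.
Proof.
elim: p => [[v b]|[[a b]|v] t' p /= ->]; first by case: b; rewrite /= comp_lfun1l.
  by rewrite -!comp_lfunA; congr (_ \o _)%VF; apply: row_change_act.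
by rewrite -comp_lfunA; have := path_up p isT; case: t'.2 => // _; rewrite comp_lfun1l.
Qed.

Lemma unladder_subproof : @commutative_rep K (ladder tau) unladder_rep.
Proof. by move=> s t p q; rewrite !unladder_act (act_path_unique _ (row_path p) (row_path q)). Qed.

Definition unladder : repCL K tau := exist _ unladder_rep unladder_subproof.

End OfArrow.

Lemma unladderK X : ladder_arrow (unladder X) = X.
Proof.
case: X => [[V fV] [W fW] [f hf]]; rewrite /ladder_arrow.
apply: (congr1 (@Arrow (repA K tau) (Rep fV) (Rep fW))).
by apply: val_inj; apply/ffunP=> v; rewrite /= ffunE.
Qed.


Section OnMorphisms.
Variables M N : repCL K tau.

Definition ladder_hom_row (f : mor M N) b :
    rep_family (ladder_row (sval M) b) (ladder_row (sval N) b) :=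
  [ffun v => rep_fun (f : rep_hom _ _) (v, b)].

Lemma ladder_hom_row_subproof (f : mor M N) b : ladder_hom_row f b \in @intertwines K (An tau) _ _.
Proof.
apply/forallP=> a; rewrite !ffunE; apply/eqP.
by have /forallP/(_ (inl (a, b)))/eqP := rep_homP (f : rep_hom _ _).
Qed.

Lemma ladder_hom_subproof (f : mor M N) :
  (RepHom (ladder_hom_row_subproof f false) : mor (_ : repA K tau) _,
   RepHom (ladder_hom_row_subproof f true) : mor (_ : repA K tau) _) \in
    @arr_square (repA K tau) (ladder_arrow M) (ladder_arrow N).
Proof.
rewrite unfold_in; apply/eqP/val_inj/ffunP=> v; rewrite /= !ffunE.
by have /forallP/(_ (inr v))/eqP := rep_homP (f : rep_hom _ _).
Qed.

Definition ladder_hom (f : mor M N) : mor (ladder_arrow M) (ladder_arrow N) :=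
  ArrHom (ladder_hom_subproof f).

Definition unladder_hom_fam (F : mor (ladder_arrow M) (ladder_arrow N)) :
    rep_family (sval M) (sval N) :=
  [ffun v : vertex (ladder tau) =>
    match v return 'Hom(rep_space (sval M) v, rep_space (sval N) v) with
    | (v, b) => match b return 'Hom(rep_space (sval M) (v, b), rep_space (sval N) (v, b)) with
        | true => rep_fun ((arr_pair (F : arr_hom _ _)).2 : rep_hom _ _) v
        | false => rep_fun ((arr_pair (F : arr_hom _ _)).1 : rep_hom _ _) v
        end
    end].

Lemma unladder_hom_subproof F : unladder_hom_fam F \in @intertwines K (ladder tau) _ _.
Proof.
apply/forallP=> -[[a b]|v]; rewrite !ffunE /=; apply/eqP.
  case: b; first by have /forallP/(_ a)/eqP := rep_homP ((arr_pair (F : arr_hom _ _)).2 : rep_hom _ _).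
  by have /forallP/(_ a)/eqP := rep_homP ((arr_pair (F : arr_hom _ _)).1 : rep_hom _ _).
have := arr_homP (F : arr_hom _ _); rewrite unfold_in => /eqP.
by move=> /(congr1 (fun h : rep_hom _ _ => rep_fun h v)); rewrite /= !ffunE.
Qed.

Definition unladder_hom F : mor M N := RepHom (unladder_hom_subproof F).

Lemma ladder_homK : cancel ladder_hom unladder_hom.
Proof. by move=> f; apply/val_inj/ffunP=> -[v []]; rewrite /= !ffunE. Qed.

Lemma unladder_homK : cancel unladder_hom ladder_hom.
Proof.
move=> F; apply: val_inj; rewrite /= [RHS]surjective_pairing.
by congr pair; apply/val_inj/ffunP=> v; rewrite /= !ffunE.
Qed.

End OnMorphisms.

Lemma ladder_hom1 (M : repCL K tau) : ladder_hom (idmor M) = idmor (ladder_arrow M).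
Proof. by apply: val_inj; congr pair; apply/val_inj/ffunP=> v; rewrite /= !ffunE. Qed.

Lemma ladder_homM (L M N : repCL K tau) (g : mor M N) (f : mor L M) :
  ladder_hom (ccomp g f) = ccomp (ladder_hom g) (ladder_hom f).
Proof. by apply: val_inj; congr pair; apply/val_inj/ffunP=> v; rewrite /= !ffunE. Qed.

Lemma ladder_homD (M N : repCL K tau) (f g : mor M N) : ladder_hom (f + g) = ladder_hom f + ladder_hom g.
Proof. by apply: val_inj; congr pair; apply/val_inj/ffunP=> v; rewrite /= !ffunE. Qed.

Definition ladder_direct_sum J X_ X :=
  @direct_sum_functor _ _ _ _ _ ladder_homK unladder_homK ladder_hom1 ladder_homM ladder_homD J X_ X.

Lemma ladder_arrow_surj Y : exists M : repCL K tau, ladder_arrow M = Y.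
Proof. by exists (unladder Y); apply: unladderK. Qed.

Lemma ladder_indecomposable (M : repCL K tau) : indecomposable (ladder_arrow M) <-> indecomposable M.
Proof.
exact: (indecomposable_functor ladder_homK unladder_homK ladder_hom1 ladder_homM ladder_homD M
  ladder_arrow_surj).
Qed.

Lemma ladder_decomposition (M : repCL K tau) (J : finType) (X : J -> arr (repA K tau)) :
  indecomposable_decomposition X (ladder_arrow M) ->
  exists N : J -> repCL K tau,
    (forall j, ladder_arrow (N j) = X j) /\ indecomposable_decomposition N M.
Proof.
move=> [indX sumX]; exists (fun j => unladder (X j)); split=> [j|]; first exact: unladderK.
split=> [j|]; first by apply/ladder_indecomposable; rewrite unladderK.
apply/ladder_direct_sum; rewrite (_ : (fun j => _) = X) //.
by apply: funext => j; apply: unladderK.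
Qed.

End LadderEquivalence.

(** * Dimensions and combinatorial intervals *)

Section Dimension.
Variable K : fieldType.

Lemma retract_dim (U W : vectType K) (f : 'Hom(U, W)) (g : 'Hom(W, U)) :
  (g \o f = \1)%VF -> (\dim {:U} <= \dim {:W})%N.
Proof.
move=> gf; have f0 : lker f == 0%VS.
  by apply/lker0P=> u v fuv; rewrite -[u]id_lfunE -[v]id_lfunE -gf !comp_lfunE fuv.
by rewrite -(limg_dim_eq (f := f)) ?dimvS ?subvf // (eqP f0) capv0.
Qed.

(** The images of [f] and [f'] meet in 0 only, because [g] is injective on the first and kills the
    second. *)
Lemma biretract_dim (U V W : vectType K) (f : 'Hom(U, W)) (g : 'Hom(W, U))
    (f' : 'Hom(V, W)) (g' : 'Hom(W, V)) :
  (g \o f = \1)%VF -> (g' \o f' = \1)%VF -> (g \o f' = 0)%VF ->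
  (\dim {:U} + \dim {:V} <= \dim {:W})%N.
Proof.
move=> gf gf' gf0; have f0 : lker f == 0%VS.
  by apply/lker0P=> u v fuv; rewrite -[u]id_lfunE -[v]id_lfunE -gf !comp_lfunE fuv.
have f0' : lker f' == 0%VS.
  by apply/lker0P=> u v fuv; rewrite -[u]id_lfunE -[v]id_lfunE -gf' !comp_lfunE fuv.
rewrite -(limg_dim_eq (f := f) (U := fullv)) ?(eqP f0) ?capv0 //.
rewrite -(limg_dim_eq (f := f') (U := fullv)) ?(eqP f0') ?capv0 //.
rewrite -dimv_disjoint_sum ?dimvS ?subvf //; apply/eqP; rewrite -subv0.
apply/subvP=> w; rewrite memv_cap => /andP[/memv_imgP[u _ ->] /memv_imgP[v _ E]].
have := congr1 g E; rewrite -comp_lfunE gf id_lfunE -comp_lfunE gf0 lfunE /= => ->.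
by rewrite linear0 mem0v.
Qed.

Variables (m : nat) (tau : 'I_m -> direction).

Definition arrow_dim (X : arr (repA K tau)) : nat :=
  \sum_(v : 'I_m.+1) (\dim {:rep_space (arr_dom X) v} + \dim {:rep_space (arr_cod X) v}).

Definition dom_at (X Y : arr (repA K tau)) (f : mor X Y) v :
    'Hom(rep_space (arr_dom X) v, rep_space (arr_dom Y) v) :=
  rep_fun ((arr_pair (f : arr_hom _ _)).1 : rep_hom _ _) v.
Definition cod_at (X Y : arr (repA K tau)) (f : mor X Y) v :
    'Hom(rep_space (arr_cod X) v, rep_space (arr_cod Y) v) :=
  rep_fun ((arr_pair (f : arr_hom _ _)).2 : rep_hom _ _) v.

Lemma dom_atM (X Y Z : arr (repA K tau)) (g : mor Y Z) (f : mor X Y) v :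
  dom_at (ccomp g f) v = (dom_at g v \o dom_at f v)%VF.
Proof. by rewrite /dom_at /= ffunE. Qed.
Lemma cod_atM (X Y Z : arr (repA K tau)) (g : mor Y Z) (f : mor X Y) v :
  cod_at (ccomp g f) v = (cod_at g v \o cod_at f v)%VF.
Proof. by rewrite /cod_at /= ffunE. Qed.
Lemma dom_at1 (X : arr (repA K tau)) v : dom_at (idmor X) v = \1%VF.
Proof. by rewrite /dom_at /= ffunE. Qed.
Lemma cod_at1 (X : arr (repA K tau)) v : cod_at (idmor X) v = \1%VF.
Proof. by rewrite /cod_at /= ffunE. Qed.
Lemma dom_at0 (X Y : arr (repA K tau)) v : dom_at (0 : mor X Y) v = 0.
Proof. by rewrite /dom_at /= ffunE. Qed.
Lemma cod_at0 (X Y : arr (repA K tau)) v : cod_at (0 : mor X Y) v = 0.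
Proof. by rewrite /cod_at /= ffunE. Qed.

Lemma isomorphic_dim X Y : isomorphic X Y -> arrow_dim X = arrow_dim Y.
Proof.
suff le X' Y' : isomorphic X' Y' -> (arrow_dim X' <= arrow_dim Y')%N.
  by move=> XY; apply/eqP; rewrite eqn_leq !le //; apply: isomorphic_sym.
move=> [f [g [gf _]]]; apply: leq_sum => v _; apply: leq_add.
  by apply: (@retract_dim _ _ (dom_at f v) (dom_at g v)); rewrite -dom_atM gf dom_at1.
by apply: (@retract_dim _ _ (cod_at f v) (cod_at g v)); rewrite -cod_atM gf cod_at1.
Qed.

Lemma arrow_dim0 (X : arr (repA K tau)) : arrow_dim X = 0%N -> zero_object X.
Proof.
move=> /eqP; rewrite sum_nat_eq0 => /forallP X0.
have lf0 (U : vectType K) (f : 'Hom(U, U)) : \dim {:U} = 0%N -> f = 0.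
  move=> /eqP; rewrite dimv_eq0 => /eqP U0; apply/lfunP=> u.
  by have := memvf u; rewrite U0 memv0 => /eqP ->; rewrite !linear0.
have {}X0 v : \dim {:rep_space (arr_dom X) v} = 0%N /\ \dim {:rep_space (arr_cod X) v} = 0%N.
  by have /implyP/(_ isT) := X0 v; rewrite addn_eq0 => /andP[/eqP -> /eqP ->].
apply: val_inj; rewrite /=; congr pair; apply/val_inj/ffunP=> v; rewrite !ffunE;
  by apply: lf0; have [] := X0 v.
Qed.

Lemma arrow_dim_sum X Y Z : direct_sum (fun b : bool => if b then Y else Z) X ->
  (arrow_dim Y + arrow_dim Z <= arrow_dim X)%N.
Proof.
move=> /direct_sum_pair[iY [iZ [pY [pZ [YY ZZ YZ _ _]]]]].
rewrite /arrow_dim -big_split /=; apply: leq_sum => v _; rewrite addnACA; apply: leq_add.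
  apply: (@biretract_dim _ _ _ (dom_at iY v) (dom_at pY v) (dom_at iZ v) (dom_at pZ v)).
  - by rewrite -dom_atM YY dom_at1.
  - by rewrite -dom_atM ZZ dom_at1.
  - by rewrite -dom_atM YZ dom_at0.
apply: (@biretract_dim _ _ _ (cod_at iY v) (cod_at pY v) (cod_at iZ v) (cod_at pZ v)).
- by rewrite -cod_atM YY cod_at1.
- by rewrite -cod_atM ZZ cod_at1.
- by rewrite -cod_atM YZ cod_at0.
Qed.

Lemma arrow_decomposition_exists (X : arr (repA K tau)) :
  exists (J : finType) (X_ : J -> arr (repA K tau)), indecomposable_decomposition X_ X.
Proof.
apply: (@decomposition_exists _ arrow_dim) => {}X Y Z /arrow_dim_sum le_X Y0 Z0.
have Yp : (0 < arrow_dim Y)%N by rewrite lt0n; apply/eqP=> /arrow_dim0.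
have Zp : (0 < arrow_dim Z)%N by rewrite lt0n; apply/eqP=> /arrow_dim0.
by split; apply: leq_trans le_X; [rewrite -{1}[arrow_dim Y]addn0 ltn_add2l | rewrite -{1}[arrow_dim Z]add0n ltn_add2r].
Qed.

Lemma ladder_isomorphic (M N : repCL K tau) :
  isomorphic M N -> isomorphic (ladder_arrow M) (ladder_arrow N).
Proof.
move=> [f [g [gf fg]]]; exists (ladder_hom f), (ladder_hom g).
by split; rewrite -ladder_homM ?gf ?fg ladder_hom1.
Qed.

End Dimension.

(** * Idempotents commuting with a nilpotent Jordan block *)

Section ShiftMatrix.
Variables (K : fieldType) (k : nat).

Definition shift_mx : 'M[K]_k.+1 := \matrix_(i, j) (i.+1 == j :> nat)%:R.

(** The commutant consists of upper triangular Toeplitz matrices and is a local ring. The corner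
    entry of [e] is an idempotent of the field. If it is 0, the matrix is strictly triangular and
    idempotency kills its first row from left to right, hence everything; if it is 1, the same
    applies to [1 - e]. *)
Lemma shift_commutant (e : 'M[K]_k.+1) :
  e *m e = e -> e *m shift_mx = shift_mx *m e -> e = 0 \/ e = 1%:M.
Proof.
pose E (e : 'M[K]_k.+1) a b := e (inord a) (inord b).
have commE e' : e' *m shift_mx = shift_mx *m e' ->
    (forall a, (a < k)%N -> E e' a.+1 0%N = 0) /\
    (forall a b, (a < k)%N -> (b < k)%N -> E e' a.+1 b.+1 = E e' a b).
  move=> eJ; have J_l a b : (a < k)%N -> (shift_mx *m e') (inord a) b = e' (inord a.+1) b.
    move=> lt_a; rewrite mxE (bigD1 (inord a.+1)) //= big1 => [|l ne]; rewrite mxE !inordK ?ltnS // ?(ltnW lt_a) //.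
      by rewrite eqxx mul1r addr0.
    case: eqP => [El|]; last by rewrite mul0r.
    by move: ne; rewrite El inord_val eqxx.
  split=> [a lt_a|a b lt_a lt_b].
    have := congr1 (fun M : 'M_k.+1 => M (inord a) (inord 0)) eJ; rewrite /= J_l // /E => <-.
    by rewrite mxE big1 // => l _; rewrite mxE inordK // mulr0.
  have := congr1 (fun M : 'M_k.+1 => M (inord a) (inord b.+1)) eJ; rewrite /= J_l // /E => <-.
  rewrite mxE (bigD1 (inord b)) //= big1 => [|l ne]; rewrite mxE !inordK ?ltnS // ?(ltnW lt_b) //.
    by rewrite eqxx mulr1 addr0.
  rewrite eqSS; case: eqP => [El|]; last by rewrite mulr0.
  by move: ne; rewrite -El inord_val eqxx.
have zero e' : e' *m e' = e' -> e' *m shift_mx = shift_mx *m e' -> E e' 0%N 0%N = 0 -> e' = 0.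
  move=> ee /commE[low diag] c0.
  have lowE a b : (b <= a <= k)%N -> E e' a b = 0.
    elim: b a => [|b IHb] [|a] //= l; first by apply: low.
    case/andP: l => l1 l2; rewrite diag ?(leq_ltn_trans (l1 : b <= a)%N l2) // IHb //.
    by rewrite (l1 : b <= a)%N ltnW.
  have row0 b : (b <= k)%N -> E e' 0%N b = 0.
    elim/ltn_ind: b => b IHb le_b; rewrite /E -ee mxE big1 // => l _.
    have [lt_l|le_l] := ltnP l b.
      have := IHb l lt_l (leq_trans (ltnW lt_l) le_b); rewrite /E inord_val => ->; by rewrite mul0r.
    have := lowE l b; rewrite le_l -ltnS ltn_ord /E inord_val => ->; by rewrite ?mulr0.
  have allE a b : (a <= k)%N -> (b <= k)%N -> E e' a b = 0.
    elim: a b => [|a IHa] b la lb; first exact: row0.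
    case: b lb => [|b] lb; first exact: low.
    by rewrite diag // IHa // ltnW.
  apply/matrixP=> i j; rewrite mxE; have := allE i j; rewrite /E !inord_val; apply; by rewrite -ltnS.
move=> ee eJ; have [low _] := commE _ eJ.
have : E e 0%N 0%N * E e 0%N 0%N = E e 0%N 0%N.
  rewrite [RHS]/E -{3}ee mxE (bigD1 (inord 0)) //= big1 ?addr0 // => l ne.
  have l0 : (0 < l)%N by rewrite lt0n; apply: contraNneq ne => l0; rewrite -l0 inord_val.
  have := low l.-1; rewrite prednK // -ltnS ltn_ord /E inord_val => -> //; by rewrite mulr0.
move=> /eqP; rewrite -subr_eq0 -{3}[E e 0%N 0%N]mulr1 -mulrBr mulf_eq0 subr_eq0.
case/orP=> /eqP c; first by left; apply: zero.
right; apply/eqP; rewrite eq_sym -subr_eq0; apply/eqP/zero.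
- by rewrite mulmxBl mul1mx mulmxBr mulmx1 ee subrr subr0.
- by rewrite mulmxBl mulmxBr mul1mx mulmx1 eJ.
- by rewrite /E !mxE eqxx; move: c; rewrite /E => ->; rewrite subrr.
Qed.

End ShiftMatrix.

(* Intervals as pairs of natural numbers and the relation of nonzero homomorphisms
   between them, computed from the orientation [tc] (true for a forward edge). *)
Definition code m (x : ivl m) : nat * nat := (nat_of_ord (val x).1, nat_of_ord (val x).2).

Definition tcode m (tau : 'I_m -> direction) : seq bool := [seq is_fwd (tau i) | i <- enum 'I_m].

Definition code_in (x : nat * nat) (v : nat) : bool := (x.1 <= v)%N && (v <= x.2)%N.

Definition edge_ge (t : bool) (x y : nat * nat) (i : nat) : bool :=
  let s := if t then i else i.+1 in let e := if t then i.+1 else i in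
  ~~ (code_in x s && code_in y e) || (code_in y s == code_in x e).

Definition code_ge (tc : seq bool) (x y : nat * nat) : bool :=
  (maxn x.1 y.1 <= minn x.2 y.2)%N &&
  all (fun i => edge_ge (nth true tc i) x y i) (iota 0 (size tc)).

Section Codes.
Variables (K : fieldType) (m : nat) (tau : 'I_m -> direction).

Lemma size_tcode : size (tcode tau) = m.
Proof. by rewrite size_map size_enum_ord. Qed.

Lemma nth_tcode (i : 'I_m) : nth true (tcode tau) i = is_fwd (tau i).
Proof. by rewrite (nth_map i) ?size_enum_ord // nth_ord_enum. Qed.

Lemma code_inj : injective (@code m).
Proof.
move=> x y [E1 E2]; apply: val_inj; rewrite [LHS]surjective_pairing [RHS]surjective_pairing.
by congr pair; apply: val_inj.
Qed.

Lemma edge_geE x y (a : 'I_m) :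
  edge_ge (is_fwd (tau a)) (code x) (code y) a =
  (in_ivl x (src (q:=An tau) a) && in_ivl y (tgt (q:=An tau) a) ==>
     (in_ivl y (src (q:=An tau) a) == in_ivl x (tgt (q:=An tau) a))).
Proof. by rewrite implybE /edge_ge /code_in /in_ivl /=; case: (tau a); rewrite /= /bump /= ?add1n. Qed.

Lemma code_geE x y : ivl_ge K tau x y = code_ge (tcode tau) (code x) (code y).
Proof.
rewrite ivl_geE /code_ge; congr andb.
  rewrite /= leq_min !geq_max; have := valP x; have := valP y; rewrite /= => -> ->; rewrite andbT /=.
  apply/existsP/idP => [[v]|].
    rewrite /in_ivl => /andP[/andP[l1 l2] /andP[l3 l4]].
    by rewrite (leq_trans l3 l2) (leq_trans l1 l4).
  move=> /andP[l1 l2]; have [l|/ltnW l] := leqP (val x).1 (val y).1.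
    by exists (val y).1; rewrite /in_ivl /= leqnn l; move: l1 l2 (valP x) (valP y) => /= -> _ _ ->.
  by exists (val x).1; rewrite /in_ivl /= leqnn l; move: l1 l2 (valP x) (valP y) => /= _ -> -> _.
rewrite size_tcode; apply/forallP/allP => [H i|H a].
  rewrite mem_iota add0n => /= lt_i; have := H (Ordinal lt_i).
  by rewrite -edge_geE (nth_tcode (Ordinal lt_i)).
by rewrite -edge_geE -nth_tcode; apply: H; rewrite mem_iota add0n /=.
Qed.

(** Edges beyond [n] cannot violate the condition on intervals that end by [n], so intervals found
    on four edges serve on every longer line. *)
Lemma code_ge_take x y n : (x.2 <= n)%N -> (y.2 <= n)%N -> (n <= m)%N ->
  code_ge (tcode tau) x y = code_ge (take n (tcode tau)) x y.
Proof.
move=> xn yn nm; rewrite /code_ge; congr andb; rewrite size_takel ?size_tcode //.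
rewrite (_ : iota 0 m = iota 0 n ++ iota n (m - n)) -?[in RHS]iotaD ?subnKC // all_cat [X in _ && X](_ : _ = true) ?andbT.
  by apply: eq_in_all => i; rewrite mem_iota => /= lt_i; rewrite nth_take.
apply/allP=> i; rewrite mem_iota => /andP[le_i _]; rewrite /edge_ge /code_in.
have xi : (i.+1 <= x.2)%N = false by rewrite ltnNge (leq_trans xn le_i).
have yi : (i.+1 <= y.2)%N = false by rewrite ltnNge (leq_trans yn le_i).
by case: (nth _ _ _); rewrite /= ?xi ?yi ?andbF.
Qed.

End Codes.

(** * Ladders of finite type *)

Section JordanFamily.
Variables (K : fieldType) (m : nat) (tau : 'I_m -> direction).
Variables x1 x2 y1 y2 : ivl m.
Local Notation ge := (ivl_ge K tau).
Local Notation mask := (strongly_zero_mask tau).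
Local Notation bm := (block_morphism tau).
Hypotheses (x12 : ~~ ge x1 x2) (x21 : ~~ ge x2 x1) (y12 : ~~ ge y1 y2) (y21 : ~~ ge y2 y1).
Hypotheses (xy11 : ge x1 y1) (xy12 : ge x1 y2) (xy21 : ge x2 y1) (xy22 : ge x2 y2).
Variable k : nat.

Definition two_labels (x y : ivl m) (i : 'I_(k.+1 + k.+1)) : ivl m :=
  match split i with inl _ => x | inr _ => y end.

Lemma two_labels_l x y i : two_labels x y (lshift k.+1 i) = x.
Proof. by rewrite /two_labels -[lshift _ _]/(unsplit (inl i)) unsplitK. Qed.
Lemma two_labels_r x y i : two_labels x y (rshift k.+1 i) = y.
Proof. by rewrite /two_labels -[rshift _ _]/(unsplit (inr i)) unsplitK. Qed.

Local Notation xl := (two_labels x1 x2).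
Local Notation yl := (two_labels y1 y2).

Definition jordan_mx : 'M[K]_(k.+1 + k.+1) := block_mx 1%:M 1%:M 1%:M (shift_mx K k).

Definition jordan_arrow : arr (repA K tau) := Arrow (bm yl xl jordan_mx).

Lemma mask0 p q (rlab : 'I_q -> ivl m) (clab : 'I_p -> ivl m) :
  mask rlab clab (0 : 'M[K]_(q, p)) = 0.
Proof. by apply/matrixP=> i j; rewrite !mxE if_same. Qed.

Lemma mask1 x y : mask (two_labels x y) (two_labels x y) 1%:M = 1%:M :> 'M[K]_(k.+1 + k.+1).
Proof.
apply/matrixP=> i j; rewrite maskE !mxE; have [->|] := eqVneq i j; last by rewrite mulr0.
by rewrite ivl_ge_refl mul1r.
Qed.

Lemma mask_xy (A : 'M[K]_(k.+1 + k.+1)) : mask yl xl A = A.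
Proof.
apply/matrixP=> r c; rewrite maskE /two_labels.
by case: (split c) => _; case: (split r) => _; rewrite ?xy11 ?xy12 ?xy21 ?xy22 mul1r.
Qed.

Lemma mask_diag x y (A : 'M[K]_(k.+1 + k.+1)) : ~~ ge x y -> ~~ ge y x ->
  mask (two_labels x y) (two_labels x y) A = block_mx (ulsubmx A) 0 0 (drsubmx A).
Proof.
move=> xy yx; rewrite -[LHS]submxK; congr block_mx; apply/matrixP=> i j;
  by rewrite !mxE ?two_labels_l ?two_labels_r ?ivl_ge_refl ?(negPf xy) ?(negPf yx).
Qed.

(** A splitting gives an idempotent endomorphism [e], whose two components are block diagonal
    because each pair of intervals is orthogonal. The three identity blocks of [jordan_mx] make the
    four diagonal blocks equal, and the shift block makes them commute with the shift. So [e] is 0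
    or 1, and one summand vanishes. *)
Lemma jordan_indecomposable : indecomposable jordan_arrow.
Proof.
pose VX : repA K tau := ivl_sum K tau xl; pose VY : repA K tau := ivl_sum K tau yl.
split=> [|Y Z].
  move=> /(congr1 (fun f : arr_hom _ _ => (arr_pair f).1)) /= id0.
  have : bm xl xl (1%:M : 'M[K]_(k.+1 + k.+1)) = bm xl xl 0.
    by rewrite block_morphism1 block_morphism0 [LHS]id0.
  move=> /block_morphism_inj/matrixP/(_ (lshift _ ord0) (lshift _ ord0)).
  by rewrite !maskE ivl_ge_refl !mxE eqxx !mul1r => /eqP; rewrite oner_eq0.
move=> /direct_sum_pair[iY [iZ [pY [pZ [YY ZZ YZ ZY ip]]]]].
pose e := ccomp iY pY.
have ee : ccomp e e = e by rewrite /e -ccompA (ccompA pY) YY ccomp1m.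
have [E eE] := block_morphism_full ((arr_pair (e : arr_hom _ _)).1 : mor VX VX).
have [F eF] := block_morphism_full ((arr_pair (e : arr_hom _ _)).2 : mor VY VY).
have sq : mask yl yl F *m jordan_mx = jordan_mx *m mask xl xl E.
  have := arr_homP (e : arr_hom _ _); rewrite unfold_in => /eqP.
  rewrite eE eF [LHS]block_morphism_comp [RHS]block_morphism_comp => /block_morphism_inj.
  by rewrite !mask_xy.
have EE : mask xl xl (mask xl xl E *m mask xl xl E) = mask xl xl E.
  apply: (@block_morphism_inj K m tau); rewrite -[LHS]block_morphism_comp -eE.
  exact: (congr1 (fun f : arr_hom _ _ => (arr_pair f).1) ee).
have mE := mask_diag E x12 x21; have mF := mask_diag F y12 y21.
move: (ulsubmx E) (drsubmx E) (ulsubmx F) (drsubmx F) mE mF => E1 E2 F1 F2 mE mF.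
move: sq EE; rewrite mE mF !mulmx_block !mul0mx !mulmx0 !mul1mx !mulmx1 !addr0 !add0r.
rewrite mask_diag // block_mxKul block_mxKdr => /eq_block_mx[F1E1 F1E2 F2E1].
rewrite F2E1 -F1E2 -F1E1 => F1J /eq_block_mx[FF _ _ _].
rewrite F2E1 -F1E1 in mF; rewrite -F1E2 -F1E1 in mE.
have [F0|F1E] := shift_commutant FF F1J.
  left; rewrite /zero_object -[idmor Y]ccomp1m -{1}YY -ccompA -YY.
  rewrite (ccompA iY) -/e (_ : e = 0) ?ccomp0m ?ccompm0 //.
  apply: val_inj; rewrite [LHS]surjective_pairing eE eF /=; congr pair.
    by rewrite -block_morphism0; apply: block_morphism_eq; rewrite mE F0 block_mx0 mask0.
  by rewrite -block_morphism0; apply: block_morphism_eq; rewrite mF F0 block_mx0 mask0.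
right; have e1 : e = idmor _.
  apply: val_inj; rewrite [LHS]surjective_pairing eE eF /=; congr pair.
    rewrite -[RHS]block_morphism1; apply: block_morphism_eq.
    by rewrite mE F1E -scalar_mx_block mask1.
  rewrite -[RHS]block_morphism1; apply: block_morphism_eq.
  by rewrite mF F1E -scalar_mx_block mask1.
rewrite /zero_object -[idmor Z]ccompm1 -{2}ZZ ccompA ccomp1m -[pZ]ccompm1 -e1 /e.
by rewrite (ccompA pZ) ZY !ccomp0m.
Qed.

Lemma jordan_dim : (k < arrow_dim jordan_arrow)%N.
Proof.
have /asboolP[f /hom_neq0_ex[v [x1v _ _]]] := xy11.
rewrite /arrow_dim (bigD1 v) //= -addnA; apply: leq_trans (leq_addr _ _).
rewrite dimvf /dim /= mul1n.
rewrite -[X in (X <= _)%N]card_ord -(card_imset _ (@lshift_inj k.+1 k.+1)).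
apply: subset_leq_card; apply/subsetP=> _ /imsetP[i _ ->].
by rewrite unfold_in /alive two_labels_l.
Qed.

End JordanFamily.

(* Found by search. Two intervals orthogonal to each other, each with nonzero morphisms to
   both of two further intervals orthogonal to each other, support Jordan blocks of any size. *)
Definition orthogonal_square (t1 t2 t3 t4 : bool) :
    (nat * nat) * (nat * nat) * (nat * nat) * (nat * nat) :=
  match t1, t2, t3, t4 with
  | true, true, true, true => ((2, 3), (1, 4), (1, 2), (0, 3))
  | true, true, true, false => ((2, 4), (1, 3), (1, 2), (0, 4))
  | true, true, false, true => ((2, 4), (1, 2), (1, 3), (0, 4))
  | true, true, false, false => ((2, 3), (1, 2), (1, 4), (0, 3))
  | true, false, true, true => ((3, 4), (1, 1), (1, 3), (0, 4))
  | true, false, true, false => ((3, 3), (1, 1), (1, 4), (0, 3))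
  | true, false, false, true => ((1, 4), (0, 2), (2, 4), (0, 3))
  | true, false, false, false => ((1, 3), (0, 2), (2, 3), (0, 4))
  | false, true, true, true => ((2, 3), (0, 4), (1, 3), (0, 2))
  | false, true, true, false => ((2, 4), (0, 3), (1, 4), (0, 2))
  | false, true, false, true => ((2, 4), (0, 2), (1, 4), (0, 3))
  | false, true, false, false => ((2, 3), (0, 2), (1, 3), (0, 4))
  | false, false, true, true => ((3, 4), (0, 1), (1, 4), (0, 3))
  | false, false, true, false => ((3, 3), (0, 1), (1, 3), (0, 4))
  | false, false, false, true => ((1, 2), (0, 4), (2, 4), (1, 3))
  | false, false, false, false => ((1, 2), (0, 3), (2, 3), (1, 4))
  end%N.

Definition is_orthogonal_square (tc : seq bool) (x1 x2 y1 y2 : nat * nat) : bool :=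
  [&& all (fun x => x.1 <= x.2 <= 4)%N [:: x1; x2; y1; y2],
      ~~ code_ge tc x1 x2, ~~ code_ge tc x2 x1, ~~ code_ge tc y1 y2, ~~ code_ge tc y2 y1
    & all (fun x => all (code_ge tc x) [:: y1; y2]) [:: x1; x2]].

Lemma orthogonal_squareP t1 t2 t3 t4 :
  let: (x1, x2, y1, y2) := orthogonal_square t1 t2 t3 t4 in
  is_orthogonal_square [:: t1; t2; t3; t4] x1 x2 y1 y2.
Proof. by case: t1 t2 t3 t4 => [] [] [] []; vm_compute. Qed.

Lemma finite_type_small (K : fieldType) m (tau : 'I_m -> direction) :
  finite_type (repCL K tau) -> (m <= 3)%N.
Proof.
move=> [c [L L_all]]; rewrite leqNgt; apply/negP=> m4.
have [c1 [c2 [d1 [d2]]]] : exists c1 c2 d1 d2, is_orthogonal_square (take 4 (tcode tau)) c1 c2 d1 d2.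
  have : size (take 4 (tcode tau)) = 4 by rewrite size_takel ?size_tcode.
  move: (take 4 _) => tc tc4.
  have [t1 [t2 [t3 [t4 ->]]]] : exists t1 t2 t3 t4, tc = [:: t1; t2; t3; t4].
    by case: tc tc4 => [|t1 [|t2 [|t3 [|t4 []]]]] // _; exists t1, t2, t3, t4.
  have := orthogonal_squareP t1 t2 t3 t4; case: (orthogonal_square _ _ _ _) => [[[c1 c2] d1] d2].
  by exists c1, c2, d1, d2.
case/and5P=> /and5P[ic1 ic2 id1 id2 _] c12 c21 d12 /andP[d21 c_d].
have ivl_of x : (x.1 <= x.2 <= 4)%N -> exists2 y : ivl m, code y = x & (x.2 <= 4)%N.
  case: x => a b /= /andP[ab b4].
  have lb : (b < m.+1)%N by rewrite ltnS; apply: leq_trans b4 m4.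
  have la : (a < m.+1)%N by apply: leq_ltn_trans ab lb.
  by exists (exist _ (Ordinal la, Ordinal lb) ab).
have [x1 x1E l1] := ivl_of _ ic1; have [x2 x2E l2] := ivl_of _ ic2.
have [y1 y1E l3] := ivl_of _ id1; have [y2 y2E l4] := ivl_of _ id2.
have geE x y : ((code x).2 <= 4)%N -> ((code y).2 <= 4)%N ->
    code_ge (take 4 (tcode tau)) (code x) (code y) = ivl_ge K tau x y.
  by move=> lx ly; rewrite (code_geE K) (code_ge_take tau lx ly m4).
rewrite -x1E -x2E -y1E -y2E in l1 l2 l3 l4 c12 c21 d12 d21 c_d.
move: c_d; rewrite /= !geE // in c12 c21 d12 d21 *; rewrite !andbT.
move=> /andP[/andP[g11 g12] /andP[g21 g22]].
(* This bounds the dimension of every listed object, while the arrow with Jordan block of size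
   [k.+1] has dimension above [k]. *)
pose k := \sum_i arrow_dim (ladder_arrow (L i)).
pose X := jordan_arrow K tau x1 x2 y1 y2 k.
have [|i iso] := L_all (unladder X).
  by apply/ladder_indecomposable; rewrite unladderK; apply: jordan_indecomposable.
have := isomorphic_dim (ladder_isomorphic iso); rewrite unladderK => E.
have : (k < arrow_dim X)%N by apply: jordan_dim.
by rewrite -E /k (bigD1 i) //= ltnNge leq_addr.
Qed.

(** * Irreducible morphisms between intervals *)

Section LinearAlgebra.
Variable K : fieldType.
Implicit Types A B : vectType K.

Definition lfun_of A B (f : A -> B) (lf : linear f) : 'Hom(A, B) :=
  linfun (HB.pack f (GRing.isLinear.Build K A B *:%R f lf) : {linear A -> B}).

Lemma lfun_ofE A B (f : A -> B) (lf : linear f) u : lfun_of lf u = f u.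
Proof. by rewrite lfunE. Qed.

(** [phi] vanishes on the kernel of the map from [A] to [B] modulo [U], hence factors through it;
    the quotient is realized as a complement by [1 - projv U]. *)
Lemma functional_extension A B (f : 'Hom(A, B)) (U : {vspace B}) (phi : 'Hom(A, K^o)) :
  (forall a, f a \in U -> phi a = 0) ->
  exists psi : 'Hom(B, K^o), (forall u, u \in U -> psi u = 0) /\ (psi \o f = phi)%VF.
Proof.
move=> phiU; pose p := (\1 - projv U)%VF; pose h := (p \o f)%VF.
have pU u : u \in U -> p u = 0 by move=> uU; rewrite add_lfunE opp_lfunE id_lfunE projv_id ?subrr.
have hU a : h a = 0 -> f a \in U.
  rewrite comp_lfunE add_lfunE opp_lfunE id_lfunE => /eqP; rewrite subr_eq0 => /eqP ->.
  exact: memv_proj.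
exists (phi \o h^-1 \o p)%VF; split=> [u uU|].
  by rewrite comp_lfunE pU ?linear0.
apply/lfunP=> a; rewrite !comp_lfunE -[p (f a)]comp_lfunE -/h.
apply/eqP; rewrite -subr_eq0 -linearB; apply/eqP/phiU/hU.
rewrite linearB /= limg_lfunVK ?subrr //; exact: memv_img (memvf _).
Qed.

Lemma separating_functional B (U : {vspace B}) w : w \notin U ->
  exists psi : 'Hom(B, K^o), (forall u, u \in U -> psi u = 0) /\ psi w = 1.
Proof.
move=> wU; have f_lin : linear (fun c : K^o => (c : K) *: w).
  by move=> c a b; rewrite scalerDl scalerA.
have [a|psi [psiU E]] := @functional_extension K^o B (lfun_of f_lin) U \1%VF.
  rewrite lfun_ofE => aw; rewrite id_lfunE; apply/eqP; apply: contraNT wU => a0.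
  by rewrite -[w]scale1r -(mulVf a0) -scalerA memvZ.
exists psi; split=> //; have /lfunP/(_ 1) := E.
by rewrite comp_lfunE lfun_ofE scale1r id_lfunE.
Qed.

End LinearAlgebra.

(** * Splitting off an interval from a representation *)

Section IntervalSummand.
Variables (K : fieldType) (m : nat) (tau : 'I_m -> direction).
Variable Z : rep K (An tau).
Local Notation V v := (rep_space Z v).
Local Notation left_end i := (widen_ord (leqnSn m) i : vertex (An tau)).
Local Notation right_end i := (lift ord0 i : vertex (An tau)).

Lemma vertex_ind (P : 'I_m.+1 -> Prop) :
  P ord0 -> (forall i : 'I_m, P (widen_ord (leqnSn m) i) -> P (lift ord0 i)) -> forall v, P v.
Proof.
move=> P0 PS v; case: v => n; elim: n => [|n IHn] lt_n.
  by rewrite (_ : Ordinal _ = ord0) //; apply: val_inj.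
rewrite (_ : Ordinal _ = lift ord0 (Ordinal (lt_n : (n < m)%N))); last exact: val_inj.
apply: PS; rewrite (_ : widen_ord _ _ = Ordinal (ltnW lt_n)) //; exact: val_inj.
Qed.

(** An interval can be made to end at an edge that is not good: a forward map has a nonzero vector
    in its kernel, or a nonzero functional kills the image of a backward map. *)
Definition good (a : edge (An tau)) : bool :=
  if is_fwd (tau a) then lker (rep_act Z a) == 0%VS else limg (rep_act Z a) == fullv.

(** [N] and [U] are the constraints accumulated from the right end of the interval: on the
    generating vector of the summand and on the functional that splits it off. *)
Definition pair_ok v (N U : {vspace V v}) (w : V v) (phi : 'Hom(V v, K^o)) : Prop :=
  [/\ w \in N, forall u, u \in U -> phi u = 0 & phi w = 1].

Definition family_ok (vec : forall v, V v) (fn : forall v, 'Hom(V v, K^o)) (a : edge (An tau)) : Prop :=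
  (fn (tgt a) \o rep_act Z a = fn (src a))%VF /\ rep_act Z a (vec (src a)) = vec (tgt a).

(** [vec] defines a map from the interval [I] to [Z] and [fn] a map back. The square of an edge
    constrains [fn] only if the target lies in [I], and [vec] only if the source does. *)
Definition boundary_ok (vec : forall v, V v) (fn : forall v, 'Hom(V v, K^o)) (I : pred 'I_m.+1)
    (a : edge (An tau)) : Prop :=
  (I (tgt a) -> (fn (tgt a) \o rep_act Z a = fn (src a))%VF) /\
  (I (src a) -> rep_act Z a (vec (src a)) = vec (tgt a)).

Lemma strict_mem v (N U : {vspace V v}) : ~~ (N <= U)%VS -> exists2 w, w \in N & w \notin U.
Proof. by move=> /subvPn. Qed.

Lemma pair_exists v (N U : {vspace V v}) : ~~ (N <= U)%VS -> exists w phi, pair_ok N U w phi.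
Proof.
move=> /strict_mem[w wN wU]; have [phi [phiU phiw]] := separating_functional wU.
by exists w, phi.
Qed.

(* One step to the left across the edge i: either the pair [U < N] is transported to
   the left end and the chosen data extend back, or the interval can start at the
   right end of i. *)
Lemma step_left (i : 'I_m) (N U : {vspace V (right_end i)}) :
  good i -> (U <= N)%VS -> ~~ (N <= U)%VS ->
  (exists N' U' : {vspace V (left_end i)}, [/\ (U' <= N')%VS, ~~ (N' <= U')%VS &
     forall w' phi', pair_ok N' U' w' phi' -> exists w phi, pair_ok N U w phi /\
       forall (vec : forall v, V v) (fn : forall v, 'Hom(V v, K^o)), vec (left_end i) = w' -> fn (left_end i) = phi' ->
         vec (right_end i) = w -> fn (right_end i) = phi -> family_ok vec fn i]) \/
  (exists w phi, pair_ok N U w phi /\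
     forall (vec : forall v, V v) (fn : forall v, 'Hom(V v, K^o)), vec (left_end i) = 0 -> fn (left_end i) = 0 ->
       vec (right_end i) = w -> fn (right_end i) = phi ->
       boundary_ok vec fn (pred1 (right_end i)) i).
Proof.
rewrite /good /family_ok /boundary_ok; move: (rep_act Z i); rewrite /=.
have lr : (left_end i == right_end i) = false.
  by apply/negbTE/eqP => /(congr1 val) /= /eqP; rewrite /bump /= add1n -eqSS ltn_eqF.
case: (tau i) => /= f f_good UN NU.
  have [sub|nsub] := boolP (f @^-1: N <= f @^-1: U)%VS; last first.
    left; exists (f @^-1: N)%VS, (f @^-1: U)%VS; split=> //; first exact: lpreimS.
    move=> w' phi' [w'N phi'U phi'w'].
    have fU a : f a \in U -> phi' a = 0 by rewrite memv_preim; apply: phi'U.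
    have [psi [psiU psif]] := functional_extension fU.
    exists (f w'), psi; split.
      by split=> //; rewrite ?memv_preim // -comp_lfunE psif.
    by move=> vec fn vl fl vr fr; rewrite vl fl vr fr psif.
  (* Otherwise each [n] in [N] is [u + f a] with [u] in [U]; then [f a] is in [N], hence in [U] as
     the preimages of [N] and [U] agree, and [N] would lie in [U]. *)
  right; have nNU : ~~ (N <= U + limg f)%VS.
    apply: contra NU => NUf; apply/subvP=> n nN; have := subvP NUf n nN.
    case/memv_addP=> u uU [_ /memv_imgP[a _ ->] nE]; rewrite nE memvD //.
    rewrite memv_preim; apply: (subvP sub); rewrite -memv_preim.
    have -> : f a = n - u by rewrite nE addrC addKr.
    by rewrite memvB // (subvP UN).
  have [w [phi [wN phiU phiw]]] := pair_exists nNU; exists w, phi; split.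
    by split=> // u uU; apply: phiU; apply: subvP (addvSl _ _) _ uU.
  move=> vec fn vl fl vr fr; split=> [_|]; last by rewrite /= lr.
  apply/lfunP=> a; rewrite fl comp_lfunE fr lfunE /= phiU //.
  by apply: subvP (addvSr _ _) _ (memv_img _ (memvf _)).
have [sub|nsub] := boolP (f @: N <= f @: U)%VS; last first.
  left; exists (f @: N)%VS, (f @: U)%VS; split=> //; first exact: limgS.
  move=> w' phi' [/memv_imgP[w wN ->] phi'U phi'w'].
  exists w, (phi' \o f)%VF; split; last by move=> vec fn vl fl vr fr; rewrite vl fl vr fr.
  by split; rewrite ?comp_lfunE // => u uU; rewrite comp_lfunE phi'U ?memv_img.
right; have nNU : ~~ (N :&: lker f <= U)%VS.
  apply: contra NU => NUf; apply/subvP=> n nN.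
  have /memv_imgP[u uU fE] := subvP sub _ (memv_img f nN).
  rewrite -(subrK u n) memvD //; apply: (subvP NUf).
  by rewrite memv_cap memvB ?(subvP UN u uU) //= memv_ker linearB /= fE subrr.
have [w [phi [wN phiU phiw]]] := pair_exists nNU; exists w, phi; split.
  by split=> //; move: wN; rewrite memv_cap => /andP[].
move=> vec fn vl fl vr fr; split=> [|_]; first by rewrite /= lr.
by rewrite vr vl; move: wN; rewrite memv_cap memv_ker => /andP[_ /eqP].
Qed.

Definition summand_upto (v : 'I_m.+1) (N U : {vspace V v}) : Prop :=
  exists (a : nat) (vec : forall v, V v) (fn : forall v, 'Hom(V v, K^o)),
    let I := fun u : 'I_m.+1 => (a <= u <= v)%N in
    [/\ (a <= v)%N, forall u, ~~ I u -> vec u = 0 /\ fn u = 0,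
        forall u, I u -> fn u (vec u) = 1, vec v \in N /\ (forall u, u \in U -> fn v u = 0)
      & forall j : 'I_m, (j < v)%N -> boundary_ok vec fn I j].

Lemma edge_ends (j : 'I_m) : (src (q:=An tau) j <= j.+1)%N /\ (tgt (q:=An tau) j <= j.+1)%N.
Proof. by rewrite /=; case: (tau j); rewrite /= /bump. Qed.

(** Induction on the right end, with the constraints varying: they are transported to the left until
    the interval can start, and the data chosen there are then extended back one vertex at a time by
    [dfwith]. *)
Lemma summand_upto_exists (v : 'I_m.+1) : (forall j : 'I_m, (j < v)%N -> good j) ->
  forall N U : {vspace V v}, (U <= N)%VS -> ~~ (N <= U)%VS -> summand_upto N U.
Proof.
pose zv (u : vertex (An tau)) : V u := 0; pose zf (u : vertex (An tau)) : 'Hom(V u, K^o) := 0.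
elim/vertex_ind: v => [_|i IHi i_good] N U UN NU.
  have [w [phi [wN phiU phiw]]] := pair_exists NU.
  exists 0%N, (dfwith zv w), (dfwith zf phi); split=> //.
  - move=> u; rewrite /= leqn0 => u0; have {}u0 : ord0 != u by rewrite eq_sym.
    by rewrite !dfwith_out.
  - move=> u; rewrite /= leqn0 => /eqP u0; have -> : u = ord0 by apply: val_inj.
    by rewrite !dfwith_in.
  - by rewrite !dfwith_in.
have rE : (lift ord0 i : nat) = i.+1 by [].
have bE : bump 0 i = i.+1 by [].
have ne_lr : right_end i != left_end i.
  by apply/eqP=> /(congr1 val) /= /eqP; rewrite /bump /= add1n gtn_eqF.
have {}IHi := IHi (fun j lt_j => i_good j (ltnW lt_j)).
have ends (j : 'I_m) : (j < i)%N -> right_end i != src (q:=An tau) j /\ right_end i != tgt (q:=An tau) j.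
  move=> lt_j; have [ls lt] := edge_ends j.
  by split; apply/eqP=> /(congr1 (@nat_of_ord m.+1)); rewrite ?bE ?rE => E;
    [move: ls|move: lt]; rewrite -E ltnS leqNgt lt_j.
have [] := step_left (i_good i (ltnSn i)) UN NU.
  move=> [N' [U' [UN' NU' ext]]]; have [a [vec [fn [le_a supp one [vN fU] ok]]]] := IHi N' U' UN' NU'.
  have [|w [phi [[wN phiU phiw] ok_i]]] := ext (vec (left_end i)) (fn (left_end i)).
    by split=> //; apply: one; rewrite /= le_a leqnn.
  exists a, (dfwith vec w), (dfwith fn phi); split=> /=.
  - exact: leqW.
  - move=> u; rewrite ?bE ?rE => nu; have ne : right_end i != u.
      by apply: contraNneq nu => <-; rewrite ?bE ?rE leqnn leqW.
    rewrite !dfwith_out //; apply: supp; apply: contra nu => /andP[-> /= l]; exact: leqW.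
  - move=> u; rewrite ?bE ?rE; have [<-|ne] := eqVneq (right_end i) u; first by rewrite !dfwith_in.
    move=> /andP[l1 l2]; rewrite !dfwith_out //; apply: one; rewrite l1 /= -ltnS ltn_neqAle l2 andbT.
    by apply: contraNneq ne => E; apply/eqP/val_inj.
  - by rewrite !dfwith_in.
  move=> j; rewrite ?bE ?rE ltnS leq_eqVlt => /orP[/eqP/val_inj->|lt_j].
    have [E1 E2] : family_ok (dfwith vec w) (dfwith fn phi) i.
      by apply: ok_i; rewrite ?dfwith_in ?dfwith_out.
    by split.
  have [ns nt] := ends j lt_j; have [ls lt] := edge_ends j; have [ok1 ok2] := ok j lt_j.
  split=> /andP[l1 _]; rewrite !dfwith_out //; [apply: ok1|apply: ok2]; rewrite l1 /=;
    exact: leq_trans lt_j.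
move=> [w [phi [[wN phiU phiw] ok_i]]].
exists i.+1, (dfwith zv w), (dfwith zf phi); split=> /=.
- by rewrite ?bE ?rE.
- move=> u; rewrite ?bE ?rE => nu; have ne : right_end i != u.
    by apply: contraNneq nu => <-; rewrite ?bE ?rE leqnn.
  by rewrite !dfwith_out.
- move=> u; rewrite ?bE ?rE -eqn_leq => /eqP E; have -> : u = right_end i by apply: val_inj.
  by rewrite !dfwith_in.
- by rewrite !dfwith_in.
move=> j; rewrite ?bE ?rE ltnS leq_eqVlt => /orP[/eqP/val_inj->|lt_j].
  have [E1 E2] : boundary_ok (dfwith zv w) (dfwith zf phi) (pred1 (right_end i)) i.
    by apply: ok_i; rewrite ?dfwith_in ?dfwith_out.
  by split=> l; [apply: E1|apply: E2]; apply/eqP/val_inj; rewrite /= ?bE ?rE; apply/eqP; rewrite eqn_leq andbC.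
have [ns nt] := ends j lt_j; split=> _; rewrite !dfwith_out //; last by rewrite linear0.
by rewrite comp_lfun0l.
Qed.

End IntervalSummand.

Section IrreducibleMorphisms.
Variables (K : fieldType) (m : nat) (tau : 'I_m -> direction).
Local Notation ge := (ivl_ge K tau).
Implicit Types (x y z : ivl m) (X Y Z : rep K (An tau)).

Lemma sum_pid_mx1 (b c : bool) (u : 'rV[K]_b) : b -> c ->
  \sum_i (u *m (pid_mx 1 : 'M_(b, c))) 0 i = \sum_i u 0 i.
Proof. by case: b c u => [] [] // u _ _; rewrite pid_mx_1 mulmx1. Qed.

Lemma src_or (j : 'I_m) : src (q:=An tau) j = widen_ord (leqnSn m) j \/ src (q:=An tau) j = lift ord0 j.
Proof. by rewrite /=; case: (tau j); [left|right]. Qed.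

Lemma tgt_or (j : 'I_m) : tgt (q:=An tau) j = widen_ord (leqnSn m) j \/ tgt (q:=An tau) j = lift ord0 j.
Proof. by rewrite /=; case: (tau j); [right|left]. Qed.

Lemma pid_mx_1_bool (b : bool) : pid_mx 1 = 1%:M :> 'M[K]_b.
Proof. by case: b; rewrite ?pid_mx_1 // [LHS]thinmx0 [RHS]thinmx0. Qed.

Lemma good_dim Z (v0 u : 'I_m.+1) : (forall j : 'I_m, good Z j) ->
  (0 < \dim {:rep_space Z v0})%N -> (v0 <= u)%N -> (0 < \dim {:rep_space Z u})%N.
Proof.
move=> all_good v0_pos; elim/vertex_ind: u => [|i IHi].
  by rewrite leqn0 => /eqP E; rewrite (_ : ord0 = v0) //; apply: val_inj.
rewrite leq_eqVlt => /orP[/eqP/val_inj <- //|]; rewrite /bump /= ltnS => /IHi.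
have := all_good i; rewrite /good; move: (rep_act Z i); rewrite /=.
case: (tau i) => /= f f_good pos.
  by apply: leq_trans pos _; rewrite -(limg_dim_eq (f := f)) ?dimvS ?subvf // (eqP f_good) capv0.
by apply: leq_trans pos _; rewrite -(eqP f_good) -(limg_ker_dim f fullv) leq_addl.
Qed.

(** The interval ends at the first edge that is not good, with constraints [(lker f, 0)] or
    [(fullv, limg f)] according to its direction. If all edges are good, [Z] is still nonzero at the
    last vertex and the interval ends there, without constraints. The value 1 of each functional on
    its vector makes the two maps a retraction. *)
Lemma interval_summand Z (v0 : 'I_m.+1) : (0 < \dim {:rep_space Z v0})%N ->
  exists x (g : mor (ivl_rep K tau x) (Z : repA K tau)) (r : mor (Z : repA K tau) (ivl_rep K tau x)),
    ccomp r g = idmor (ivl_rep K tau x).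
Proof.
move=> Z0.
have [b [N [U [b_good UN NU b_ok]]]] : exists (b : 'I_m.+1) (N U : {vspace rep_space Z b}),
   [/\ forall j : 'I_m, (j < b)%N -> good Z j, (U <= N)%VS, ~~ (N <= U)%VS
     & forall (vec : forall v, rep_space Z v) (fn : forall v, 'Hom(rep_space Z v, K^o)),
         vec b \in N -> (forall u, u \in U -> fn b u = 0) ->
         forall j : 'I_m, j = b :> nat -> vec (lift ord0 j) = 0 -> fn (lift ord0 j) = 0 ->
         boundary_ok vec fn (pred1 b) j].
  have [all_good|] := boolP [forall j : 'I_m, good Z j].
    have nz : (0 < \dim {:rep_space Z (ord_max : vertex (An tau))})%N.
      apply: (good_dim (v0 := v0)) => // [j|]; [exact: (forallP all_good)|exact: leq_ord].
    exists ord_max, fullv, 0%VS; split=> [j _||//|vec fn _ _ j jb]; [exact: (forallP all_good)|..].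
    - by rewrite sub0v.
    - by rewrite subv0 -dimv_eq0 -lt0n nz.
    - by have := ltn_ord j; rewrite jb ltnn.
  rewrite negb_forall => /existsP[j0 bad0].
  have [j jbad jmin] := @arg_minnP _ j0 (fun j : 'I_m => ~~ good Z j) (fun j : 'I_m => j : nat) bad0.
  pose b := widen_ord (leqnSn m) j.
  have b_good (i : 'I_m) : (i < b)%N -> good Z i.
    by apply: contraLR => ibad; rewrite -leqNgt; apply: jmin.
  have : exists N U : {vspace rep_space Z b}, [/\ (U <= N)%VS, ~~ (N <= U)%VS
     & forall (vec : forall v, rep_space Z v) (fn : forall v, 'Hom(rep_space Z v, K^o)),
         vec b \in N -> (forall u, u \in U -> fn b u = 0) ->
         vec (lift ord0 j) = 0 -> fn (lift ord0 j) = 0 ->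
         boundary_ok vec fn (pred1 b) j].
    move: jbad; rewrite /good /boundary_ok; move: (rep_act Z j); rewrite /= -/b.
    have rb : (lift ord0 j == b) = false.
      by apply/negbTE/eqP => /(congr1 val) /= /eqP; rewrite /bump /= add1n gtn_eqF.
    case: (tau j) => /= f f_bad.
      exists (lker f), 0%VS; split; rewrite ?sub0v ?subv0 // => vec fn vN fU vr fr.
      split=> [|_]; first by rewrite rb.
      by rewrite vr; apply/eqP; rewrite -memv_ker.
    exists fullv, (limg f); split; rewrite ?subvf //.
      by apply: contra f_bad => H; rewrite eqEsubv subvf.
    move=> vec fn vN fU vr fr; split=> [_|]; last by rewrite rb.
    by rewrite fr; apply/lfunP=> u; rewrite comp_lfunE lfunE /= fU // memv_img ?memvf.
  move=> [N [U [UN NU ok]]]; exists b, N, U; split=> // vec fn vN fU i ib.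
  have -> : i = j by apply: val_inj.
  exact: ok.
have [a [vec [fn [/= le_ab supp one [vN fU] ok]]]] := summand_upto_exists b_good UN NU.
pose x : ivl m := exist _ (Ordinal (leq_ltn_trans le_ab (ltn_ord b)), b) le_ab.
have inE v : in_ivl x v = (a <= v <= b)%N by [].
have all_ok (j : 'I_m) : boundary_ok vec fn (in_ivl x) j.
  have [lt_j|le_j] := ltnP j b; first exact: ok.
  have out (v : 'I_m.+1) : (b < v)%N -> in_ivl x v = false by move=> l; rewrite inE andbC leqNgt l.
  have outr : in_ivl x (lift ord0 j) = false by rewrite out.
  have [vr fr] := supp _ (negbT outr).
  have [jb|ne] := eqVneq (j : nat) b.
    have lb : widen_ord (leqnSn m) j = b by apply: val_inj.
    have [h1 h2] := b_ok vec fn vN fU j jb vr fr.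
    have [ls lt] := (src_or j, tgt_or j).
    split=> l; [apply: h1; case: lt|apply: h2; case: ls] => E; move: l; rewrite E ?outr // => _;
      exact/eqP.
  have outl : in_ivl x (widen_ord (leqnSn m) j) = false.
    by rewrite out //= ltn_neqAle eq_sym ne.
  have os : in_ivl x (src (q:=An tau) j) = false by case: (src_or j) => ->.
  have ot : in_ivl x (tgt (q:=An tau) j) = false by case: (tgt_or j) => ->.
  by split; rewrite ?os ?ot.
have g_lin v : linear (fun u : 'rV[K]_(in_ivl x v) => (\sum_i u 0 i) *: vec v).
  move=> c u w; rewrite scalerA -scalerDl mulr_sumr -big_split /=; congr (_ *: _).
  by apply: eq_bigr => i _; rewrite !mxE.
have r_lin v : linear (fun u : rep_space Z v => (fn v u : K) *: (const_mx 1 : 'rV[K]_(in_ivl x v))).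
  by move=> c u w; rewrite linearP scalerDl scalerA.
pose gf : rep_family (ivl_rep K tau x) Z := [ffun v => lfun_of (g_lin v)].
pose rf : rep_family Z (ivl_rep K tau x) := [ffun v => lfun_of (r_lin v)].
have pid_const (c d : bool) : c -> (const_mx 1 : 'rV[K]_c) *m pid_mx 1 = const_mx 1 :> 'rV_d.
  case: c d => // -[] _; last by rewrite [LHS]thinmx0 [RHS]thinmx0.
  by rewrite pid_mx_1 mulmx1.
have gP : gf \in @intertwines K (An tau) _ _.
  apply/forallP=> j; rewrite !ffunE; apply/eqP/lfunP=> u; rewrite !comp_lfunE ivl_actE !lfun_ofE.
  have [_ ok2] := all_ok j; rewrite linearZ /=.
  have /orP[xs|xs] := orbN (in_ivl x (src (q:=An tau) j)); last first.
    by rewrite (rV_bool_eq xs u 0) mul0mx !big1 ?scale0r // => i _; rewrite mxE.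
  rewrite ok2 //.
  have /orP[xt|xt] := orbN (in_ivl x (tgt (q:=An tau) j)); last first.
    by have [-> _] := supp _ xt; rewrite !scaler0.
  by rewrite sum_pid_mx1.
have rP : rf \in @intertwines K (An tau) _ _.
  apply/forallP=> j; rewrite !ffunE; apply/eqP/lfunP=> u; rewrite !comp_lfunE ivl_actE !lfun_ofE.
  have [ok1 _] := all_ok j; rewrite -scalemxAl.
  have /orP[xt|xt] := orbN (in_ivl x (tgt (q:=An tau) j)); last exact: rV_bool_eq.
  rewrite -[fn _ _]comp_lfunE ok1 //.
  have /orP[xs|xs] := orbN (in_ivl x (src (q:=An tau) j)); last first.
    by have [_ ->] := supp _ xs; rewrite lfunE /= !scale0r.
  by rewrite pid_const.
exists x, (RepHom gP), (RepHom rP); apply: val_inj; apply/ffunP=> v; apply/lfunP=> u.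
rewrite !ffunE comp_lfunE; apply: etrans _ (esym (id_lfunE _)); rewrite lfun_ofE lfun_ofE. rewrite linearZ /=.
have /orP[xv|xv] := orbN (in_ivl x v); last exact: rV_bool_eq.
rewrite -[_ *: fn v (vec v)]/(_ * _ : K) one // mulr1; apply/rowP=> i; rewrite !mxE mulr1.
rewrite (sum_const_bool (x := u 0 i)) => [|i0]; last by rewrite (ord_bool_eq i0 i).
have -> : (nat_of_bool (in_ivl x v))%:R = 1 :> K by rewrite xv.
by rewrite mul1r.
Qed.

Lemma idempotent_split Z (e : mor (Z : repA K tau) Z) : ccomp e e = e ->
  exists (Y : repA K tau) (i : mor Y Z) (p : mor (Z : repA K tau) Y),
    ccomp p i = idmor Y /\ ccomp i p = e.
Proof.
move=> ee; pose ev v := rep_fun (e : rep_hom _ _) v.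
have eeE v u : ev v (ev v u) = ev v u.
  by have := congr1 (fun f : rep_hom _ _ => rep_fun f v u) ee; rewrite /= ffunE comp_lfunE.
have e_act (a : edge (An tau)) u : ev (tgt a) (rep_act Z a u) = rep_act Z a (ev (src a) u).
  by have /forallP/(_ a)/eqP/lfunP/(_ u) := rep_homP (e : rep_hom _ _); rewrite !comp_lfunE.
have e_id v u : u \in limg (ev v) -> ev v u = u by move=> /memv_imgP[w _ ->]; apply: eeE.
have e_mem v u : ev v u \in limg (ev v) by rewrite memv_img ?memvf.
pose Y : rep K (An tau) := @Rep K (An tau) (fun v => subvs_of (limg (ev v)))
  (fun a => (linfun (vsproj (limg (ev (tgt a)))) \o rep_act Z a \o linfun vsval)%VF).
pose iF : rep_family Y Z := [ffun v => linfun vsval].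
pose pF : rep_family Z Y := [ffun v => (linfun (vsproj (limg (ev v))) \o ev v)%VF].
have iP : iF \in @intertwines K (An tau) _ _.
  apply/forallP=> a; rewrite !ffunE; apply/eqP/lfunP=> u; rewrite !comp_lfunE !lfunE /=.
  rewrite vsprojK //; have := e_act a (vsval u); rewrite (e_id _ (vsval u)) ?subvsP // => <-.
  exact: e_mem.
have pP : pF \in @intertwines K (An tau) _ _.
  apply/forallP=> a; rewrite !ffunE; apply/eqP/lfunP=> u; rewrite !comp_lfunE !lfunE /=.
  by rewrite (vsprojK (e_mem _ _)) -e_act.
exists Y, (RepHom iP), (RepHom pP); split; apply: val_inj; apply/ffunP=> v; apply/lfunP=> u.
  rewrite !ffunE !comp_lfunE !lfunE /= e_id ?subvsP //; apply: val_inj.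
  by rewrite /= vsprojK ?subvsP // id_lfunE.
by rewrite !ffunE !comp_lfunE !lfunE /= (vsprojK (e_mem _ _)).
Qed.

Lemma ivl_endo_inv x (f : mor (ivl_rep K tau x) (ivl_rep K tau x)) : f <> 0 ->
  exists g, ccomp g f = idmor (ivl_rep K tau x) /\ ccomp f g = idmor (ivl_rep K tau x).
Proof.
move=> f0; have [v [xv _ c0]] := hom_neq0_ex f0.
have l w0 (c : K) : linear (fun u : 'rV[K]_(in_ivl x w0) => c *: u).
  by move=> c' u w; rewrite scalerDr !scalerA mulrC.
pose gF : rep_family (ivl_rep K tau x) (ivl_rep K tau x) := [ffun w => lfun_of (l w (hom_coef f v)^-1)].
have gP : gF \in @intertwines K (An tau) _ _.
  apply/forallP=> a; rewrite !ffunE; apply/eqP/lfunP=> u; rewrite !comp_lfunE !ivl_actE !lfun_ofE.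
  by rewrite scalemxAl.
have fE w (u : 'rV_(in_ivl x w)) : rep_fun (f : rep_hom _ _) w u = hom_coef f v *: u.
  rewrite hom_coefE; have /orP[xw|xw] := orbN (in_ivl x w); last exact: rV_bool_eq.
  by rewrite (hom_coef_const f (u := w) (v := v)) ?xv ?xw // pid_mx_1_bool mulmx1.
exists (RepHom gP); split; apply: val_inj; apply/ffunP=> w; apply/lfunP=> u;
  rewrite !ffunE !comp_lfunE; apply: etrans _ (esym (id_lfunE _)).
  by rewrite [X in fun_of_lfun _ X]fE lfun_ofE scalerA mulVf // scale1r.
by rewrite lfun_ofE [LHS]fE scalerA mulfV // scale1r.
Qed.

(** The scalars of [g f] are nonzero on all of [x], which puts [x] inside [y]. Scalars commute, so
    [f g] is nonzero as well, and symmetrically [y] lies inside [x]. *)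
Lemma ivl_retract_eq x y (f : mor (ivl_rep K tau x) (ivl_rep K tau y)) g :
  ccomp g f = idmor (ivl_rep K tau x) -> x = y.
Proof.
move=> gf1; have id0 : idmor (ivl_rep K tau x) <> 0.
  have : ge x x by apply: ivl_ge_refl.
  by move=> /asboolP[h h0] E; apply: h0; rewrite -[h]ccomp1m E ccomp0m.
have gf0 : ccomp g f <> 0 by rewrite gf1.
have [v [xv _ c0]] := hom_neq0_ex gf0.
have /andP[yv cgf] : in_ivl y v && (hom_coef g v * hom_coef f v != 0).
  move: c0; rewrite [hom_coef _ _]hom_coef_comp //; case: in_ivl; rewrite ?mul1r // !mul0r eqxx //.
have sub_xy w : in_ivl x w -> in_ivl y w.
  move=> xw; have := hom_coef_neq0 xw xw gf0; rewrite [hom_coef _ _]hom_coef_comp //.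
  by case: in_ivl => //; rewrite !mul0r eqxx.
have fg0 : ccomp f g <> 0.
  move=> fg0; move: cgf; have := hom_coef_comp f g yv yv; rewrite xv mul1r mulrC => <-.
  by rewrite [rep_comp _ _]fg0 /hom_coef big1 ?eqxx // => l _; rewrite ffunE lfunE mxE.
have sub_yx w : in_ivl y w -> in_ivl x w.
  move=> yw; have := hom_coef_neq0 yw yw fg0; rewrite [hom_coef _ _]hom_coef_comp //.
  by case: in_ivl => //; rewrite !mul0r eqxx.
have x1 : in_ivl x (val x).1 by rewrite /in_ivl leqnn; apply: (valP x).
have x2 : in_ivl x (val x).2 by rewrite /in_ivl leqnn andbT; apply: (valP x).
have y1 : in_ivl y (val y).1 by rewrite /in_ivl leqnn; apply: (valP y).
have y2 : in_ivl y (val y).2 by rewrite /in_ivl leqnn andbT; apply: (valP y).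
move: (sub_xy _ x1) (sub_xy _ x2) (sub_yx _ y1) (sub_yx _ y2); rewrite /in_ivl.
move=> /andP[a1 _] /andP[_ a2] /andP[b1 _] /andP[_ b2].
apply: val_inj; rewrite [LHS]surjective_pairing [RHS]surjective_pairing; congr pair; apply: val_inj;
  by apply/eqP; rewrite eqn_leq ?a1 ?b1 ?a2 ?b2.
Qed.

(** For a factorization of [f] through [Z], split an interval [z] off [Z]. If the part of [f]
    through [z] is nonzero, then [z] is [x] or [y] and one factor splits, since nonzero
    endomorphisms of intervals are invertible. If it is 0, then [f] factors through the smaller
    complement of [z]. *)
Lemma irreducible_between x y : x != y -> ge x y ->
  (forall z, ge x z -> ge z y -> z = x \/ z = y) -> AR_arrow K tau x y.
Proof.
move=> xy /asboolP[f f0] btw; exists f; split=> [[g gf]|[g fg]|].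
- by move: xy; rewrite (ivl_retract_eq gf) eqxx.
- by move: xy; rewrite (ivl_retract_eq fg) eqxx.
pose d (Z : rep K (An tau)) := \sum_(v : 'I_m.+1) \dim {:rep_space Z v}.
move=> Z; have [k] := ubnP (d Z); elim: k Z => // k IHk Z; rewrite ltnS => le_k h g fE.
have [v Zv|Z0] := pickP (fun v : 'I_m.+1 => (0 < \dim {:rep_space Z v})%N); last first.
  case: f0; rewrite fE; have -> : g = 0; last by rewrite ccompm0.
  apply: val_inj; apply/ffunP=> v; apply/lfunP=> u; have := memvf (rep_fun (g : rep_hom _ _) v u).
  have /negbT := Z0 v; rewrite lt0n negbK dimv_eq0 => /eqP ->; rewrite memv0 => /eqP ->.
  by rewrite ffunE lfunE.
have [z [i [p pi]]] := interval_summand Zv.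
have [ip0|ip0] := EM (ccomp (ccomp h i) (ccomp p g) = 0); last first.
  have pg0 : ccomp p g <> 0 by move=> E; apply: ip0; rewrite E ccompm0.
  have hi0 : ccomp h i <> 0 by move=> E; apply: ip0; rewrite E ccomp0m.
  have xz : ge x z by apply/asboolP; exists (ccomp p g).
  have zy : ge z y by apply/asboolP; exists (ccomp h i).
  have [zE|zE] := btw z xz zy; move: i p pi ip0 pg0 hi0; rewrite zE => i p pi ip0 pg0 hi0.
    left; have [q [qpg _]] := ivl_endo_inv pg0; exists (ccomp q p); by rewrite -ccompA.
  right; have [q [_ hiq]] := ivl_endo_inv hi0; exists (ccomp i q); by rewrite ccompA.
pose e := idmor (Z : repA K tau) - ccomp i p.
have ipip : ccomp (ccomp i p) (ccomp i p) = ccomp i p by rewrite -ccompA (ccompA p) pi ccomp1m.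
have ipe : ccomp (ccomp i p) e = 0 by rewrite /e ccompDr ccompm1 ccompmN ipip subrr.
have ee : ccomp e e = e by rewrite {1}/e ccompDl ccomp1m ccompNm ipe subr0.
have [Y [i' [p' [pi' ip']]]] := idempotent_split ee.
have fE' : f = ccomp (ccomp h i') (ccomp p' g).
  rewrite -ccompA (ccompA i') ip' /e ccompDl ccomp1m ccompDr -fE ccompNm ccompmN.
  by rewrite -(ccompA i) ccompA ip0 subr0.
have pe : ccomp p e = 0 by rewrite /e ccompDr ccompm1 ccompmN ccompA pi ccomp1m subrr.
have pi0 : ccomp p i' = 0 by rewrite -[i']ccompm1 -pi' ccompA ccompA -(ccompA p) ip' pe ccomp0m.
have dz v' : (\dim {:rep_space Y v'} + \dim {:rep_space (ivl_rep K tau z) v'} <= \dim {:rep_space Z v'})%N.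
  rewrite addnC; apply: (@biretract_dim K _ _ _ (rep_fun (i : rep_hom _ _) v') (rep_fun (p : rep_hom _ _) v')
    (rep_fun (i' : rep_hom _ _) v') (rep_fun (p' : rep_hom _ _) v')).
  - by have := congr1 (fun f : rep_hom _ _ => rep_fun f v') pi; rewrite /= !ffunE.
  - by have := congr1 (fun f : rep_hom _ _ => rep_fun f v') pi'; rewrite /= !ffunE.
  - by have := congr1 (fun f : rep_hom _ _ => rep_fun f v') pi0; rewrite /= !ffunE.
have lt_d : (d Y < d Z)%N.
  have zz : in_ivl z (val z).1 by rewrite /in_ivl leqnn; apply: (valP z).
  rewrite /d (bigD1 (val z).1) //= [X in (_ < X)%N](bigD1 (val z).1) //= -addSn; apply: leq_add.
    apply: leq_trans (dz _); rewrite -addn1 leq_add2l dimvf /dim /=; by rewrite zz.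
  by apply: leq_sum => v' _; apply: leq_trans (dz v'); apply: leq_addr.
have [||[q qE]|[q qE]] := IHk Y _ (ccomp h i') (ccomp p' g).
- exact: leq_trans lt_d le_k.
- exact: fE'.
- by left; exists (ccomp q p'); rewrite -ccompA.
- by right; exists (ccomp i' q); rewrite ccompA.
Qed.

End IrreducibleMorphisms.

(** * The order on intervals *)

Definition codes (n : nat) : seq (nat * nat) := [seq (a, b) | a <- iota 0 n, b <- iota a (n - a)].

Lemma codesP n x : (x \in codes n) = (x.1 <= x.2 < n)%N.
Proof.
apply/allpairsPdep/idP => [[a [b []]]|/andP[l1 l2]].
  by rewrite !mem_iota add0n => la lb -> /=; lia.
by exists x.1, x.2; split; rewrite ?mem_iota -?surjective_pairing //; lia.
Qed.

Lemma codes_uniq n : uniq (codes n).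
Proof.
apply: allpairs_uniq_dep => [|a _|[a b] [a' b'] _ _ [-> ->]//]; exact: iota_uniq.
Qed.

Section Levels.
Variable tc : seq bool.
Let n := (size tc).+1.

(** The sufficient criterion of [irreducible_between] for an arrow of the Auslander-Reiten
    quiver. *)
Definition code_arrow (x y : nat * nat) : bool :=
  [&& x != y, code_ge tc x y
    & all (fun z => code_ge tc x z && code_ge tc z y ==> (z == x) || (z == y)) (codes n)].

Definition relax_levels (A : seq ((nat * nat) * (nat * nat))) (L : seq ((nat * nat) * nat)) :=
  foldl (fun L y => if y \in [seq p.1 | p <- L] then L else
     if [seq p.2.+1 | p <- L & (p.1, y) \in A] ++ [seq p.2.-1 | p <- L & (y, p.1) \in A] is k :: _
     then rcons L (y, k) else L) L (codes n).

(* Levels propagate from the interval at the vertex 0, whose level 20 keeps all the others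
   positive. *)
Definition levels : seq ((nat * nat) * nat) :=
  let A := [seq p <- [seq (x, y) | x <- codes n, y <- codes n] | code_arrow p.1 p.2] in
  iter n (relax_levels A) [:: ((0, 0), 20)]%N.

Definition level (L : seq ((nat * nat) * nat)) (x : nat * nat) : nat :=
  nth 0%N [seq p.2 | p <- L] (index x [seq p.1 | p <- L]).

Definition code_le (L : seq ((nat * nat) * nat)) (x y : nat * nat) : bool :=
  (level L x < level L y)%N ||
  (level L x == level L y) && ((y.1 < x.1)%N || (y.1 == x.1) && (y.2 <= x.2)%N).

Definition order_codes : seq (nat * nat) := let L := levels in sort (code_le L) (codes n).

(** Each entry after the first must be joined to an earlier one by an arrow that accounts for its
    level. The list then carries a spanning tree, along which the values of a grading are forced. *)
Definition levels_ok : bool :=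
  let L := levels in
  all (mem [seq p.1 | p <- L]) (codes n) &&
  all (fun i => let p := nth ((0, 0), 0)%N L i in
    [&& nth (0, 0)%N [seq q.1 | q <- L] i \in codes n &
    has (fun q => code_arrow q.1 p.1 && (p.2 == q.2.+1) || code_arrow p.1 q.1 && (q.2 == p.2.+1))
        (take i L)]) (iota 1 (size L).-1).

End Levels.

Lemma code_le_total L : total (code_le L).
Proof. by move=> x y; rewrite /code_le; lia. Qed.

Lemma code_le_trans L : transitive (code_le L).
Proof. by move=> y x z; rewrite /code_le; lia. Qed.

Lemma code_le_anti L : antisymmetric (code_le L).
Proof.
move=> [a b] [c d] H; have [-> ->] : a = c /\ b = d by move: H; rewrite /code_le /=; lia.
by [].
Qed.

Fixpoint orientations (k : nat) : seq (seq bool) :=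
  if k is k.+1 then [seq b :: s | b <- [:: true; false], s <- orientations k] else [:: [::]].

Lemma mem_orientations tc : tc \in orientations (size tc).
Proof.
elim: tc => // b tc IH; apply/allpairsP; exists (b, tc); rewrite /= IH.
by split=> //; case: b.
Qed.

Definition small_orientations : seq (seq bool) := flatten [seq orientations k | k <- iota 0 4].

Lemma mem_small_orientations tc : (size tc <= 3)%N -> tc \in small_orientations.
Proof.
move=> le3; apply/flatten_mapP; exists (size tc); last exact: mem_orientations.
by rewrite mem_iota.
Qed.

Lemma levels_okP tc : (size tc <= 3)%N -> levels_ok tc.
Proof.
move=> /mem_small_orientations; apply/allP: tc.
by vm_compute.
Qed.

Section Order.
Variables (K : fieldType) (m : nat) (tau : 'I_m -> direction) (ell : ivl m -> int).
Hypotheses (ell_grading : AR_grading K tau ell) (m3 : (m <= 3)%N).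
Local Notation tc := (tcode tau).

Lemma code_codes (x : ivl m) : code x \in codes (size tc).+1.
Proof. by rewrite codesP size_tcode /= ltn_ord (valP x). Qed.

Lemma codes_ivl c : c \in codes (size tc).+1 -> exists x : ivl m, code x = c.
Proof.
rewrite codesP size_tcode => /andP[l1 l2]; have l3 := leq_ltn_trans l1 l2.
by exists (exist _ (Ordinal l3, Ordinal l2) l1); rewrite /code /= -surjective_pairing.
Qed.

Lemma code_arrow_ell (x y : ivl m) : code_arrow tc (code x) (code y) -> ell y = ell x + 1.
Proof.
case/and3P=> xy; rewrite -(code_geE K) => g /allP btw; apply: ell_grading; apply: irreducible_between => //.
move=> z; rewrite !(code_geE K) => xz zy; have := btw _ (code_codes z); rewrite xz zy /=.
by case/orP=> /eqP/code_inj; [left|right].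
Qed.

Lemma level_ell : exists c : int, forall x, ell x = (level (levels tc) (code x))%:Z + c.
Proof.
have /andP[/allP lev_all /allP lev_tree] : levels_ok tc by apply: levels_okP; rewrite size_tcode.
have [x0 x0E] : exists x0 : ivl m, code x0 = (0, 0)%N.
  by apply: codes_ivl; rewrite codesP size_tcode.
pose L := levels tc; pose d := ((0, 0), 0)%N : (nat * nat) * nat.
have L0 : exists L', L = ((0, 0), 20)%N :: L'.
  rewrite /L /levels; move: (filter _ _) => A; elim: ((size tc).+1) => [|k [L' IH]]; first by exists [::].
  rewrite iterS IH /relax_levels; move: L' {IH}; elim: (codes _) => [|c cs IHcs] L' /=; first by exists L'.
  case: ifP => _; first exact: IHcs.
  by case: (_ ++ _) => [|k' _]; exact: IHcs.
(* A grading is determined up to a constant, fixed here at the first entry of the list, the root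
   with level 20. *)
exists (ell x0 - 20); suff H i x : (i < size L)%N -> code x = (nth d L i).1 ->
    ell x = (nth d L i).2%:Z + (ell x0 - 20).
  move=> x; have xL := lev_all _ (code_codes x); rewrite /level (nth_map d); last first.
    by rewrite -(size_map (fun p => p.1)) index_mem.
  apply: H; first by rewrite -(size_map (fun p => p.1)) index_mem.
  rewrite -(nth_map d (0, 0)%N (fun p => p.1)); last by rewrite -(size_map (fun p => p.1)) index_mem.
  by rewrite nth_index.
elim/ltn_ind: i x => -[|i] IH x lt_i xE.
  have [L' LE] := L0; move: xE; rewrite LE /= -x0E => /code_inj ->; lia.
have := lev_tree i.+1; rewrite mem_iota; have -> : (1 <= i.+1 < 1 + (size L).-1)%N by lia.
move=> /(_ isT)/andP[_ /hasP[q /(nthP d)[j]]]; rewrite size_take lt_i => lt_j.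
rewrite nth_take // -/L => qE.
have lt_jL : (j < size L)%N by lia.
have [z zE] : exists z : ivl m, code z = (nth d L j).1.
  apply: codes_ivl; case: j lt_j lt_jL {qE} => [|j] lt_j lt_jL.
    by have [L' ->] := L0; rewrite codesP.
  have := lev_tree j.+1; rewrite mem_iota; have -> : (1 <= j.+1 < 1 + (size L).-1)%N by lia.
  by move=> /(_ isT)/andP[]; rewrite (nth_map d).
have {}IH := IH j lt_j z lt_jL zE; rewrite -qE -/L -/d -zE -xE.
case/orP=> /andP[/code_arrow_ell E /eqP E2]; move: IH E E2;
  move: (nth d L j).2 (nth d L i.+1).2 (ell x0) (ell x) (ell z) => a b c e f; lia.
Qed.

Lemma code_leE (x y : ivl m) : code_le (levels tc) (code x) (code y) = ivl_le ell x y.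
Proof.
have [c cE] := level_ell; rewrite /code_le /ivl_le !cE.
have -> : (val y).1 == (val x).1 = ((code y).1 == (code x).1) by [].
by rewrite ltrD2r (inj_eq (addIr c)).
Qed.

(** The order on codes is total and antisymmetric, so a sorted list is determined by its elements,
    whatever the order of enumeration of the intervals. *)
Lemma order_codesE : [seq code x | x <- sort (ivl_le ell) (enum {: ivl m})] = order_codes tc.
Proof.
have -> : ivl_le ell = relpre (@code m) (code_le (levels tc)).
  by apply: funext => x; apply: funext => y; rewrite /= code_leE.
rewrite -sort_map /order_codes.
apply/(perm_sortP (@code_le_total _) (@code_le_trans _) (@code_le_anti _)).
apply: uniq_perm; rewrite ?codes_uniq ?(map_inj_uniq (@code_inj m)) ?enum_uniq //.
move=> c; apply/mapP/idP => [[x _ ->]|/codes_ivl[x <-]]; first exact: code_codes.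
by exists x; rewrite ?mem_enum.
Qed.

End Order.

(** * Inner operations and additions of lines *)

Section Parts.
Variable m : nat.
Implicit Types (t : seq (part m)) (i j r : nat).

Lemma part_start_cons0 x t : part_start (x :: t) 0 = 0%N. Proof. by []. Qed.
Lemma part_start_consS x t i : part_start (x :: t) i.+1 = (x.2 + part_start t i)%N. Proof. by []. Qed.

Lemma part_start_nil i : part_start ([::] : seq (part m)) i = 0%N.
Proof. by case: i. Qed.

Lemma part_size_nil i : part_size ([::] : seq (part m)) i = 0%N.
Proof. by rewrite /part_size nth_nil. Qed.

Lemma part_end t i : (part_start t i + part_size t i <= total_size t)%N.
Proof.
elim: t i => [|x t IH] [|i]; rewrite ?part_start_nil ?part_size_nil //.
- by rewrite part_start_cons0 add0n /part_size /= /total_size /= leq_addr.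
by rewrite part_start_consS -addnA /total_size /= leq_add2l; apply: IH.
Qed.

Lemma part_next t i j : (i < j)%N -> (part_start t i + part_size t i <= part_start t j)%N.
Proof.
elim: t i j => [|x t IH] [|i] [|j] // lt_ij; rewrite ?part_start_nil ?part_size_nil //.
- by rewrite part_start_consS part_start_cons0 add0n leq_addr.
by rewrite !part_start_consS -addnA leq_add2l; apply: IH.
Qed.

Lemma in_part_inj t i j r : in_part t i r -> in_part t j r -> i = j.
Proof.
rewrite /in_part => /andP[l1 l2] /andP[l3 l4].
by case: (ltngtP i j) => // l; have := part_next t l; lia.
Qed.

Lemma in_part_ex t r : (r < total_size t)%N -> exists2 i, (i < size t)%N & in_part t i r.
Proof.
elim: t r => [|x t IH] r //; rewrite /total_size /= => lt_r.
have [l|l] := ltnP r x.2; first by exists 0%N; rewrite // /in_part part_start_cons0 /part_size /= add0n.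
have [i lt_i ir] := IH (r - x.2)%N ltac:(rewrite /total_size; lia).
exists i.+1 => //; move: ir; rewrite /in_part part_start_consS /part_size /=; lia.
Qed.

Lemma line_label_part t i r : in_part t i r -> line_label t r = part_label t i.
Proof.
elim: t i r => [|x t IH] [|i] r; rewrite /in_part ?part_start_nil ?part_size_nil ?andbF //.
  by rewrite part_start_cons0 add0n /part_size /= => lt_r; rewrite /line_label /= nth_cat size_nseq lt_r nth_nseq lt_r.
rewrite part_start_consS => /andP[l1 l2]; rewrite /part_size /= in l2; rewrite /line_label /= nth_cat size_nseq ltnNge.
have -> : (x.2 <= r)%N by lia.
by rewrite /=; apply: (IH i); rewrite /in_part /part_size; lia.
Qed.

End Parts.

Section Selection.
Variables (K : fieldType) (m n : nat).
Implicit Types (t : seq (part m)) (i j : nat).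

(** The rows of the identity matrix that belong to part [i]. Multiplying by it on the left, or by
    its transpose on the right, cuts out a block, so matrix algebra replaces index arithmetic. *)
Definition sel t i : 'M[K]_(part_size t i, n) := \matrix_(k, a) (a == part_start t i + k :> nat)%N%:R.

Variable t : seq (part m).
Hypothesis tn : total_size t = n.

Lemma line_lt i (k : 'I_(part_size t i)) : (part_start t i + k < n)%N.
Proof. by rewrite -tn; apply: leq_trans (part_end t i); rewrite ltn_add2l. Qed.

Definition line i (k : 'I_(part_size t i)) : 'I_n := Ordinal (line_lt k).

Lemma line_in i (k : 'I_(part_size t i)) : in_part t i (line k).
Proof. by rewrite /in_part /= leq_addr ltn_add2l ltn_ord. Qed.

Lemma in_part_line i (a : 'I_n) : in_part t i a -> exists k : 'I_(part_size t i), a = line k.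
Proof.
rewrite /in_part => /andP[l1 l2]; have lt : (a - part_start t i < part_size t i)%N by lia.
by exists (Ordinal lt); apply: val_inj; rewrite /= subnKC.
Qed.

Lemma sel_mul i p (A : 'M_(n, p)) k c : (sel t i *m A) k c = A (line k) c.
Proof.
rewrite mxE (bigD1 (line k)) //= big1 => [|a ne]; rewrite mxE; first by rewrite eqxx mul1r addr0.
by rewrite (_ : (_ == _) = false) ?mul0r //; apply/negbTE; apply: contra ne => /eqP E; apply/eqP/val_inj.
Qed.

Lemma mul_selT i p (A : 'M_(p, n)) r k : (A *m (sel t i)^T) r k = A r (line k).
Proof. by rewrite -[A]trmxK -trmx_mul mxE sel_mul !mxE. Qed.

Lemma sel_selT i : sel t i *m (sel t i)^T = 1%:M.
Proof.
apply/matrixP=> k l; rewrite sel_mul !mxE /= eqn_add2l.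
by rewrite (inj_eq val_inj).
Qed.

Lemma sel_selT0 i j : i != j -> sel t i *m (sel t j)^T = 0.
Proof.
move=> ij; apply/matrixP=> k l; rewrite sel_mul !mxE /=; case: eqP => // E; case/eqP: ij.
apply: (@in_part_inj m t i j (line k)); first exact: line_in.
by rewrite /in_part /= E leq_addr ltn_add2l ltn_ord.
Qed.

Lemma supported_sel i j (X : 'M_n) :
  (forall a b, X a b != 0 -> in_part t i a && in_part t j b) ->
  X = (sel t i)^T *m (sel t i *m X *m (sel t j)^T) *m sel t j.
Proof.
move=> Xij; apply/matrixP=> a b; have [ha|ha] := boolP (in_part t i a && in_part t j b).
  case/andP: ha => /in_part_line[k ->] /in_part_line[l ->].
  by rewrite -!mul_selT -!sel_mul !mulmxA sel_selT mul1mx -(mulmxA _ (sel t j)) sel_selT mulmx1.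
have X0 (a' b' : 'I_n) : ~~ (in_part t i a' && in_part t j b') -> X a' b' = 0 by apply: contraNeq => /Xij.
rewrite X0 // mxE big1 // => l _; rewrite !mxE.
case: eqP => [bE|_]; last by rewrite mulr0.
rewrite big1 ?mul0r // => k _; rewrite !mxE; case: eqP => [aE|_]; last by rewrite mul0r.
by move: ha; rewrite /in_part aE bE !leq_addr !ltn_add2l !ltn_ord.
Qed.

(** [Y] inside the part and the identity elsewhere, written as a perturbation of 1 so that its
    products reduce to those of [sel]. With [Y] invertible these are exactly the inner
    operations. *)
Definition emb i (Y : 'M[K]_(part_size t i)) : 'M[K]_n := 1%:M + (sel t i)^T *m (Y - 1%:M) *m sel t i.

Lemma embM i (Y Z : 'M[K]_(part_size t i)) : emb Y *m emb Z = emb (Y *m Z).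
Proof.
have YZ : Y *m Z - 1%:M = (Z - 1%:M) + (Y - 1%:M) + (Y - 1%:M) *m (Z - 1%:M).
  rewrite mulmxBr mulmx1 mulmxBl mul1mx -[RHS]addrA [X in _ = _ + X]addrC subrK.
  by rewrite [RHS]addrC addrA subrK.
pose f X := (sel t i)^T *m X *m sel t i.
have fD X X' : f (X + X') = f X + f X' by rewrite /f mulmxDr mulmxDl.
have fM X X' : f X *m f X' = f (X *m X') by rewrite /f !mulmxA -(mulmxA _ (sel t i)) sel_selT mulmx1.
have embf X : emb X = 1%:M + f (X - 1%:M) by [].
rewrite !embf YZ [in RHS]fD [f (_ - _ + _)]fD mulmxDl mul1mx mulmxDr mulmx1 fM.
by rewrite !addrA.
Qed.

Lemma emb1 i : emb (1%:M : 'M[K]_(part_size t i)) = 1%:M.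
Proof. by rewrite /emb subrr mulmx0 mul0mx addr0. Qed.

Lemma sel_emb i (Y : 'M[K]_(part_size t i)) : sel t i *m emb Y = Y *m sel t i.
Proof. by rewrite /emb mulmxDr mulmx1 !mulmxA sel_selT mul1mx mulmxBl mul1mx addrC subrK. Qed.

Lemma sel_emb_ne i j (Y : 'M[K]_(part_size t i)) : j != i -> sel t j *m emb Y = sel t j.
Proof. by move=> ji; rewrite /emb mulmxDr mulmx1 !mulmxA sel_selT0 // !mul0mx addr0. Qed.

Lemma emb_selT i (Y : 'M[K]_(part_size t i)) : emb Y *m (sel t i)^T = (sel t i)^T *m Y.
Proof. by rewrite /emb mulmxDl mul1mx -!mulmxA sel_selT mulmx1 mulmxBr mulmx1 addrC subrK. Qed.

Lemma emb_selT_ne i j (Y : 'M[K]_(part_size t i)) : i != j -> emb Y *m (sel t j)^T = (sel t j)^T.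
Proof. by move=> ij; rewrite /emb mulmxDl mul1mx -!mulmxA sel_selT0 // !mulmx0 addr0. Qed.

Lemma embE i (Y : 'M[K]_(part_size t i)) (a b : 'I_n) :
  ~~ (in_part t i a && in_part t i b) -> emb Y a b = (a == b)%:R.
Proof.
move=> ab; rewrite !mxE [X in _ + X]big1 ?addr0 // => l _; rewrite !mxE.
case: eqP => [bE|_]; last by rewrite mulr0.
rewrite big1 ?mul0r // => k _; rewrite !mxE; case: eqP => [aE|_]; last by rewrite mul0r.
by move: ab; rewrite /in_part aE bE !leq_addr !ltn_add2l !ltn_ord.
Qed.

Lemma emb_unit i (Y : 'M[K]_(part_size t i)) : Y \in unitmx -> emb Y \in unitmx.
Proof.
by move=> uY; have /mulmx1_unit[] : emb Y *m emb (invmx Y) = 1%:M by rewrite embM mulmxV // emb1.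
Qed.

Lemma emb_inner i (Y : 'M[K]_(part_size t i)) : Y \in unitmx -> inner t i (emb Y).
Proof. by move=> uY; split; [apply: emb_unit|exact: embE]. Qed.

Lemma inner_emb i (P : 'M[K]_n) : inner t i P ->
  exists2 Y : 'M[K]_(part_size t i), Y \in unitmx & P = emb Y.
Proof.
move=> [uP PE]; pose Y := sel t i *m P *m (sel t i)^T.
have PY : P = emb Y.
  have supp a b : (P - 1%:M) a b != 0 -> in_part t i a && in_part t i b.
    by apply: contraNT => /PE; rewrite !mxE => ->; rewrite subrr.
  rewrite -[LHS](subrK 1%:M) addrC {1}(supported_sel supp) /emb mulmxBr mulmx1 mulmxBl sel_selT.
  by [].
exists Y => //; have /mulmx1_unit[//] : Y *m (sel t i *m invmx P *m (sel t i)^T) = 1%:M.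
by rewrite !mulmxA -sel_emb -PY -(mulmxA (sel t i)) mulmxV // mulmx1 sel_selT.
Qed.

Lemma inner_inv i (P : 'M[K]_n) : inner t i P -> exists2 P', inner t i P' & P *m P' = 1%:M.
Proof.
move=> /inner_emb[Y uY ->]; exists (emb (invmx Y)); last by rewrite embM mulmxV // emb1.
by apply: emb_inner; rewrite unitmx_inv.
Qed.

End Selection.

Section PidMx.
Variable K : fieldType.

(** The two sides of an identity block have equal but not convertible sizes, so [pid_mx p] stands in
    for the identity matrix and invertible factors are moved across it. *)
Lemma pid_mxMl p q (e : p = q) (Y : 'M[K]_q) : Y \in unitmx ->
  exists2 X : 'M[K]_p, X \in unitmx & (pid_mx p : 'M_(p, q)) *m Y = X *m pid_mx p.
Proof. by case: _ / e Y => Y uY; exists Y; rewrite // pid_mx_1 mul1mx mulmx1. Qed.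

Lemma pid_mx_sqr p q (e : p = q) : (pid_mx p : 'M[K]_(p, q)) *m (pid_mx p : 'M_(q, p)) = 1%:M.
Proof. by case: _ / e; rewrite pid_mx_1 mulmx1. Qed.

Lemma pid_mx_sqr' p q (e : p = q) : (pid_mx p : 'M[K]_(q, p)) *m (pid_mx p : 'M_(p, q)) = 1%:M.
Proof. by case: _ / e; rewrite pid_mx_1 mulmx1. Qed.

End PidMx.

Section Blocks.
Variables (K : fieldType) (m : nat) (tau : 'I_m -> direction) (R C : nat).
Local Notation ge := (ivl_ge K tau).
Implicit Types (v w u : position) (r : nat) (A : 'M[K]_(R, C)).

Variable s : block_matrix K m R C.
Hypotheses (sR : total_size (rows s) = R) (sC : total_size (cols s) = C).

Local Notation selr i := (sel K R (rows s) i).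
Local Notation selc j := (sel K C (cols s) j).

Definition blk A v : 'M[K]_(part_size (rows s) v.1, part_size (cols s) v.2) :=
  selr v.1 *m A *m (selc v.2)^T.

Lemma blkE A v k l : blk A v k l = A (line sR k) (line sC l).
Proof. by rewrite /blk (mul_selT sC) (sel_mul sR). Qed.

Lemma blkD A B v : blk (A + B) v = blk A v + blk B v.
Proof. by rewrite /blk mulmxDr mulmxDl. Qed.

Lemma zero_blockP A v : zero_block s A v <-> blk A v = 0.
Proof.
split=> [z|z a b /(in_part_line sR)[k ->] /(in_part_line sC)[l ->]].
  by apply/matrixP=> k l; rewrite blkE mxE z //; apply: line_in.
by rewrite -blkE z mxE.
Qed.

Lemma echelon_blockP A v r : echelon_block s A v r <->
  (r <= minn (part_size (rows s) v.1) (part_size (cols s) v.2))%N /\ blk A v = pid_mx r.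
Proof.
split=> -[le_r E]; split=> //.
  apply/matrixP=> k l; rewrite blkE mxE (E (line sR k) (line sC l)) ?line_in //=.
  by rewrite !addKn.
move=> a b /(in_part_line sR)[k ->] /(in_part_line sC)[l ->] /=.
by rewrite -blkE E mxE !addKn.
Qed.

Lemma identity_blockP A v : identity_block s A v <->
  part_size (rows s) v.1 = part_size (cols s) v.2 /\ blk A v = pid_mx (part_size (rows s) v.1).
Proof.
split=> -[E] H; split=> //; first by have /echelon_blockP[] := H.
by apply/echelon_blockP; split=> //; rewrite leq_min leqnn /= E.
Qed.

Lemma zero_block_same A B v : blk A v = blk B v -> zero_block s A v -> zero_block s B v.
Proof. by move=> E /zero_blockP z; apply/zero_blockP; rewrite -E. Qed.

Lemma identity_block_same A B v : blk A v = blk B v -> identity_block s A v -> identity_block s B v.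
Proof. by move=> E /identity_blockP z; apply/identity_blockP; rewrite -E. Qed.

(** What inner operations leave of an identity block; an inner operation on either side alone can
    restore it. *)
Definition inv_block A v : Prop :=
  part_size (rows s) v.1 = part_size (cols s) v.2 /\
  exists2 X, X \in unitmx & blk A v = X *m pid_mx (part_size (rows s) v.1).

Lemma identity_inv A v : identity_block s A v -> inv_block A v.
Proof.
move=> /identity_blockP[E B]; split=> //; exists 1%:M; first exact: unitmx1.
by rewrite mul1mx.
Qed.

Section InnerOperations.
Variable A : 'M[K]_(R, C).

Lemma blk_row_op i P v : inner (rows s) i P -> v.1 != i -> blk (P *m A) v = blk A v.
Proof. by move=> /(inner_emb sR)[Y _ ->] vi; rewrite /blk mulmxA (sel_emb_ne sR). Qed.

Lemma blk_col_op j Q v : inner (cols s) j Q -> v.2 != j -> blk (A *m Q) v = blk A v.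
Proof.
by move=> /(inner_emb sC)[Y _ ->] vj; rewrite /blk -!mulmxA (emb_selT_ne sC) // eq_sym.
Qed.

Lemma blk_row_op_in i P : inner (rows s) i P ->
  exists2 Y : 'M[K]_(part_size (rows s) i), Y \in unitmx & forall j, blk (P *m A) (i, j) = Y *m blk A (i, j).
Proof.
move=> /(inner_emb sR)[Y uY ->]; exists Y => // j.
by rewrite /blk mulmxA (sel_emb sR) !mulmxA.
Qed.

Lemma blk_col_op_in j Q : inner (cols s) j Q ->
  exists2 Y : 'M[K]_(part_size (cols s) j), Y \in unitmx & forall i, blk (A *m Q) (i, j) = blk A (i, j) *m Y.
Proof.
move=> /(inner_emb sC)[Y uY ->]; exists Y => // i.
by rewrite /blk -!mulmxA (emb_selT sC) !mulmxA.
Qed.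

Lemma zero_row_op i P v : inner (rows s) i P -> zero_block s A v -> zero_block s (P *m A) v.
Proof.
case: v => a b iP /zero_blockP z; apply/zero_blockP.
move: iP; have [<- iP|ne iP] := eqVneq a i; last by rewrite (blk_row_op iP).
by have [Y _ ->] := blk_row_op_in iP; rewrite z mulmx0.
Qed.

Lemma zero_col_op j Q v : inner (cols s) j Q -> zero_block s A v -> zero_block s (A *m Q) v.
Proof.
case: v => a b iQ /zero_blockP z; apply/zero_blockP.
move: iQ; have [<- iQ|ne iQ] := eqVneq b j; last by rewrite (blk_col_op iQ).
by have [Y _ ->] := blk_col_op_in iQ; rewrite z mul0mx.
Qed.

Lemma inv_row_op i P v : inner (rows s) i P -> inv_block A v -> inv_block (P *m A) v.
Proof.
case: v => a b iP [e [X uX E]]; split=> //.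
move: iP; have [<- iP|ne iP] := eqVneq a i; last by exists X; rewrite ?(blk_row_op iP).
have [Y uY ->] := blk_row_op_in iP; exists (Y *m X); first by rewrite unitmx_mul uY.
by rewrite E mulmxA.
Qed.

Lemma inv_col_op j Q v : inner (cols s) j Q -> inv_block A v -> inv_block (A *m Q) v.
Proof.
case: v => a b iQ [/= e [/= X uX E]]; split=> //.
move: iQ; have [<- iQ|ne iQ] := eqVneq b j; last by exists X; rewrite ?(blk_col_op iQ).
have [Y uY ->] := blk_col_op_in iQ; have [X' uX' E'] := pid_mxMl e uY.
by exists (X *m X'); rewrite ?unitmx_mul ?uX // E -mulmxA E' mulmxA.
Qed.

Lemma row_fix_exists v : inv_block A v -> exists2 P, inner (rows s) v.1 P & identity_block s (P *m A) v.
Proof.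
case: v => a b [e [X uX E]].
have uX' : invmx X \in unitmx by rewrite unitmx_inv.
exists (emb R (invmx X)); first exact: emb_inner.
apply/identity_blockP; split=> //=.
by rewrite /blk mulmxA (sel_emb sR) -!mulmxA (mulmxA (selr a)) -/(blk A (a, b)) E mulKmx.
Qed.

Lemma col_fix_exists v : inv_block A v -> exists2 Q, inner (cols s) v.2 Q & identity_block s (A *m Q) v.
Proof.
case: v => a b [/= e [X uX E]].
have uX' : invmx X \in unitmx by rewrite unitmx_inv.
have [Y uY EY] := pid_mxMl (esym e) uX'.
have e2 : (pid_mx (part_size (cols s) b) : 'M[K]_(part_size (cols s) b, part_size (rows s) a)) = pid_mx (part_size (rows s) a) by rewrite -e.
exists (emb C Y); first exact: emb_inner.
apply/identity_blockP; split=> //=.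
rewrite /blk -!mulmxA (emb_selT sC) !mulmxA -/(blk A (a, b)) E -mulmxA.
have -> : (pid_mx (part_size (rows s) a) : 'M[K]_(part_size (rows s) a, part_size (cols s) b)) *m Y
   = invmx X *m pid_mx (part_size (rows s) a).
  rewrite -[LHS]mulmx1 -(pid_mx_sqr' K e) mulmxA -(mulmxA _ Y) -e2 -EY mulmxA.
  by rewrite e2 (pid_mx_sqr K e) mul1mx.
by rewrite mulKVmx.
Qed.

Lemma echelon_exists v : exists P Q r,
  [/\ inner (rows s) v.1 P, inner (cols s) v.2 Q & echelon_block s (P *m A *m Q) v r].
Proof.
pose B := blk A v; exists (emb R (invmx (col_ebase B))), (emb C (invmx (row_ebase B))), (\rank B).
split; try by apply: emb_inner; rewrite ?unitmx_inv ?col_ebase_unit ?row_ebase_unit.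
apply/echelon_blockP; rewrite leq_min rank_leq_row rank_leq_col; split=> //.
rewrite /blk !mulmxA (sel_emb sR) -!mulmxA (emb_selT sC) !mulmxA -(mulmxA _ (selr _)) -(mulmxA _ _ (_^T)).
rewrite -/(blk A v) -/B -{2}[B]mulmx_ebase !mulmxA mulVmx ?col_ebase_unit // mul1mx mulmxK //.
exact: row_ebase_unit.
Qed.

Lemma inner_row_label i (P : 'M[K]_R) a b : inner (rows s) i P -> P a b != 0 -> row_line s a = row_line s b.
Proof.
move=> [_ PE]; have [|/PE ->] := boolP (in_part (rows s) i a && in_part (rows s) i b).
  by move=> /andP[ia ib] _; rewrite /row_line (line_label_part ia) (line_label_part ib).
by have [->|] := eqVneq a b; rewrite ?eqxx.
Qed.

Lemma inner_col_label j (Q : 'M[K]_C) a b : inner (cols s) j Q -> Q a b != 0 -> col_line s a = col_line s b.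
Proof.
move=> [_ QE]; have [|/QE ->] := boolP (in_part (cols s) j a && in_part (cols s) j b).
  by move=> /andP[ia ib] _; rewrite /col_line (line_label_part ia) (line_label_part ib).
by have [->|] := eqVneq a b; rewrite ?eqxx.
Qed.

End InnerOperations.

Local Notation mask := (strongly_zero_mask tau (row_line s) (col_line s)).

Definition masked A : Prop := mask A = A.

Lemma masked_row_op A i P : inner (rows s) i P -> masked A -> masked (P *m A).
Proof.
move=> iP mA; apply/matrixP=> a b; rewrite maskE !mxE mulr_sumr; apply: eq_bigr => k _.
have [->|/(inner_row_label iP) E] := eqVneq (P a k) 0; first by rewrite !mul0r mulr0.
by have /matrixP/(_ k b) := mA; rewrite maskE -E mulrCA => ->.
Qed.

Lemma masked_col_op A j Q : inner (cols s) j Q -> masked A -> masked (A *m Q).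
Proof.
move=> iQ mA; apply/matrixP=> a b; rewrite maskE !mxE mulr_sumr; apply: eq_bigr => k _.
have [->|/(inner_col_label iQ) E] := eqVneq (Q k b) 0; first by rewrite !mulr0.
by have /matrixP/(_ a k) := mA; rewrite maskE -E mulrA => ->.
Qed.

Lemma iso_row_op A i P : inner (rows s) i P -> masked A ->
  isomorphic (block_arrow tau (set_mat s A)) (block_arrow tau (set_mat s (P *m A))).
Proof.
move=> iP mA; have [P' iP' PP'] := inner_inv sR iP.
have adm (Q : 'M[K]_R) : inner (rows s) i Q -> admissible tau (row_line s) Q.
  by move=> iQ a b /(inner_row_label iQ) ->; apply: ivl_ge_refl.
have := block_row_iso mA (adm _ iP) (adm _ iP') PP'.
by rewrite [strongly_zero_mask _ _ _ _](masked_row_op iP mA).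
Qed.

Lemma iso_col_op A j Q : inner (cols s) j Q -> masked A ->
  isomorphic (block_arrow tau (set_mat s A)) (block_arrow tau (set_mat s (A *m Q))).
Proof.
move=> iQ mA; have [Q' iQ' QQ'] := inner_inv sC iQ.
have adm (P : 'M[K]_C) : inner (cols s) j P -> admissible tau (col_line s) P.
  by move=> iP a b /(inner_col_label iP) ->; apply: ivl_ge_refl.
have := block_col_iso mA (adm _ iQ) (adm _ iQ') QQ'.
by rewrite [strongly_zero_mask _ _ _ _](masked_col_op iQ mA).
Qed.

Lemma blk_mask A v : blk (mask A) v = if strongly_zero tau s v then 0 else blk A v.
Proof.
apply/matrixP=> k l; rewrite blkE maskE /row_line /col_line.
rewrite (line_label_part (line_in sR k)) (line_label_part (line_in sC l)) /strongly_zero.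
by case: (ge _ _); rewrite ?mul1r ?mul0r ?blkE ?mxE.
Qed.

Lemma masked_strongly_zero A v : masked A -> strongly_zero tau s v -> blk A v = 0.
Proof. by move=> mA sz; rewrite -mA blk_mask sz. Qed.

(** The last clause is the locality that confines side effects to the columns where the row of [vE]
    is nonzero. *)
Lemma add_rows_effect A A' vE vt : masked A -> add_multiples tau s Row_mode vE vt A A' ->
  permissible tau s Row_mode vE vt -> vE.1 != vt.1 ->
  [/\ masked A', isomorphic (block_arrow tau (set_mat s A)) (block_arrow tau (set_mat s A'))
    & forall v, v.1 != vt.1 \/ blk A (vE.1, v.2) = 0 -> blk A' v = blk A v].
Proof.
move=> mA [X [X_supp ->]] perm ne.
(* Rows are read from one part and written to another, so [1 - X] is inverse to [1 + X]. *)
have XX : X *m X = 0.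
  apply/matrixP=> a b; rewrite !mxE big1 // => k _.
  have [->|/X_supp/andP[_ k1]] := eqVneq (X a k) 0; first by rewrite mul0r.
  have [->|/X_supp/andP[k2 _]] := eqVneq (X k b) 0; first by rewrite mulr0.
  by move: ne; rewrite (in_part_inj k1 k2) eqxx.
have adm (c : K) : admissible tau (row_line s) (1%:M + c *: X).
  move=> a b; rewrite !mxE; have [->|ab] := eqVneq a b; first by move=> _; apply: ivl_ge_refl.
  rewrite add0r mulf_eq0 negb_or => /andP[_ /X_supp/andP[ia ib]].
  by rewrite /row_line (line_label_part ia) (line_label_part ib).
have inv : (1%:M + 1 *: X) *m (1%:M + (-1) *: X) = 1%:M.
  rewrite scale1r scaleN1r mulmxDl mul1mx mulmxDr mulmx1 mulmxN XX oppr0 addr0.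
  by rewrite subrK.
split; first by rewrite /masked mask_id.
  have := block_row_iso mA (adm 1) (adm (-1)) inv; by rewrite scale1r mulmxDl mul1mx.
move=> v v_ok; rewrite blk_mask; case: ifP => [sz|_]; first by rewrite masked_strongly_zero.
rewrite blkD (supported_sel sR X_supp) /blk !mulmxA.
case: v_ok => [ne'|z]; first by rewrite (sel_selT0 K sR) // !mul0mx addr0.
rewrite -!(mulmxA _ A) -(mulmxA _ (selr vE.1)) [selr vE.1 *m _]mulmxA.
by rewrite [selr vE.1 *m A *m _]z !mulmx0 addr0.
Qed.

Lemma add_cols_effect A A' vE vt : masked A -> add_multiples tau s Col_mode vE vt A A' ->
  permissible tau s Col_mode vE vt -> vE.2 != vt.2 ->
  [/\ masked A', isomorphic (block_arrow tau (set_mat s A)) (block_arrow tau (set_mat s A'))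
    & forall v, v.2 != vt.2 \/ blk A (v.1, vE.2) = 0 -> blk A' v = blk A v].
Proof.
move=> mA [X [X_supp ->]] perm ne.
have XX : X *m X = 0.
  apply/matrixP=> a b; rewrite !mxE big1 // => k _.
  have [->|/X_supp/andP[_ k1]] := eqVneq (X a k) 0; first by rewrite mul0r.
  have [->|/X_supp/andP[k2 _]] := eqVneq (X k b) 0; first by rewrite mulr0.
  by move: ne; rewrite (in_part_inj k1 k2) eqxx.
have adm (c : K) : admissible tau (col_line s) (1%:M + c *: X).
  move=> a b; rewrite !mxE; have [->|ab] := eqVneq a b; first by move=> _; apply: ivl_ge_refl.
  rewrite add0r mulf_eq0 negb_or => /andP[_ /X_supp/andP[ia ib]].
  by rewrite /col_line (line_label_part ia) (line_label_part ib).
have inv : (1%:M + 1 *: X) *m (1%:M + (-1) *: X) = 1%:M.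
  rewrite scale1r scaleN1r mulmxDl mul1mx mulmxDr mulmx1 mulmxN XX oppr0 addr0.
  by rewrite subrK.
split; first by rewrite /masked mask_id.
  have := block_col_iso mA (adm 1) (adm (-1)) inv; by rewrite scale1r mulmxDr mulmx1.
move=> v v_ok; rewrite blk_mask; case: ifP => [sz|_]; first by rewrite masked_strongly_zero.
rewrite blkD (supported_sel sC X_supp) /blk -!mulmxA.
case: v_ok => [ne'|z]; first by rewrite (sel_selT0 K sC) 1?eq_sym // !mulmx0 addr0.
by rewrite (mulmxA A) !(mulmxA (selr v.1)) [selr v.1 *m A *m (selc vE.2)^T]z !mul0mx addr0.
Qed.

Lemma add_rows_exists A vE vt : vE.2 = vt.2 -> identity_block s A vE ->
  exists2 A', add_multiples tau s Row_mode vE vt A A' & zero_block s A' vt.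
Proof.
case: vE vt => a b [c d] /= -> /identity_blockP[/= e E].
pose Y := - (blk A (c, d) *m (pid_mx (part_size (rows s) a) : 'M_(_, part_size (rows s) a))).
pose X := (selr c)^T *m Y *m selr a.
exists (mask (A + X *m A)).
  exists X; split=> // i j; apply: contraNT => ij; rewrite /X mxE big1 // => l _; rewrite !mxE.
  case: eqP => [jE|_]; last by rewrite mulr0.
  rewrite big1 ?mul0r // => k _; rewrite !mxE; case: eqP => [iE|_]; last by rewrite mul0r.
  by move: ij; rewrite /in_part iE jE !leq_addr !ltn_add2l !ltn_ord.
apply/zero_blockP; rewrite blk_mask; case: ifP => // _; rewrite blkD.
have -> : blk (X *m A) (c, d) = Y *m blk A (a, d).
  by rewrite /blk /X !mulmxA (sel_selT K sR) mul1mx.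
by rewrite E /Y mulNmx -mulmxA (pid_mx_sqr' K e) mulmx1 subrr.
Qed.

Lemma add_cols_exists A vE vt : vE.1 = vt.1 -> identity_block s A vE ->
  exists2 A', add_multiples tau s Col_mode vE vt A A' & zero_block s A' vt.
Proof.
case: vE vt => a b [c d] /= -> /identity_blockP[/= e E].
pose Y := - ((pid_mx (part_size (rows s) c) : 'M_(part_size (cols s) b, _)) *m blk A (c, d)).
pose X := (selc b)^T *m Y *m selc d.
exists (mask (A + A *m X)).
  exists X; split=> // i j; apply: contraNT => ij; rewrite /X mxE big1 // => l _; rewrite !mxE.
  case: eqP => [jE|_]; last by rewrite mulr0.
  rewrite big1 ?mul0r // => k _; rewrite !mxE; case: eqP => [iE|_]; last by rewrite mul0r.
  by move: ij; rewrite /in_part iE jE !leq_addr !ltn_add2l !ltn_ord.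
apply/zero_blockP; rewrite blk_mask; case: ifP => // _; rewrite blkD.
have -> : blk (A *m X) (c, d) = blk A (c, b) *m Y.
  by rewrite /blk /X -!mulmxA (sel_selT K sC) mulmx1.
by rewrite E /Y mulmxN mulmxA (pid_mx_sqr K e) mul1mx subrr.
Qed.

End Blocks.

(** * Splitting lines *)

Section Pieces.
Variable S : pred nat.

(** [pieces] started at an arbitrary index [o], as inductions on the number of parts require. *)
Definition pieces_from (o n : nat) : seq (nat * bool) :=
  flatten [seq if S i then [:: (i, false); (i, true)] else [:: (i, false)] | i <- iota o n].

Lemma pieces_from_head o n d : nth d (pieces_from o n.+1) 0 = (o, false).
Proof. by rewrite /pieces_from /=; case: (S o). Qed.

Lemma pieces_next o n k d : (k.+1 < size (pieces_from o n))%N ->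
  let x := nth d (pieces_from o n) k in
  nth d (pieces_from o n) k.+1 = if S x.1 && ~~ x.2 then (x.1, true) else (x.1.+1, false).
Proof.
elim: n o k => [|n IH] o k //=; rewrite /pieces_from /= -/(pieces_from o.+1 n).
have head : (0 < size (pieces_from o.+1 n))%N -> nth d (pieces_from o.+1 n) 0 = (o.+1, false).
  by case: n {IH} => // n' _; apply: pieces_from_head.
case So: (S o) => /=; case: k => [|[|k]] //= lt_k; rewrite ?So //=; try exact: head.
- exact: IH.
- by have := IH o.+1 0%N lt_k.
by have := IH o.+1 k.+1 lt_k.
Qed.

Lemma mem_pieces_from o n x : (x \in pieces_from o n) = (o <= x.1 < o + n)%N && (x.2 ==> S x.1).
Proof.
elim: n o x => [|n IH] o x; first by rewrite addn0 in_nil; apply/esym/negbTE; lia.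
rewrite /pieces_from /= mem_cat -/(pieces_from o.+1 n) IH; case: x => i b /=.
have -> : ((i, b) \in (if S o then [:: (o, false); (o, true)] else [:: (o, false)]))
        = (i == o) && (b ==> S i).
  case: eqVneq => [->|ne]; last by case: ifP => _; rewrite !inE !xpair_eqE (negPf ne).
  by case So: (S o); rewrite !inE !xpair_eqE eqxx /=; case: b.
by case: (b ==> S i); rewrite ?andbF ?andbT //; lia.
Qed.

End Pieces.

Section SplitParts.
Variables (m : nat) (S : pred nat) (r : nat) (t : seq (part m)).
Hypothesis r_le : forall i, S i -> (i < size t)%N -> (r <= part_size t i)%N.

Local Notation P := (pieces S (size t)).
Local Notation d := (0%N, false).
Local Notation t' := (split_parts S r t).

Lemma mem_piece k : (k < size P)%N ->
  ((nth d P k).1 < size t)%N /\ ((nth d P k).2 -> S (nth d P k).1).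
Proof.
move=> lt_k; have := mem_nth d lt_k.
by rewrite -[pieces _ _]/(pieces_from _ 0 _) mem_pieces_from add0n => /andP[/andP[_ ->] /implyP].
Qed.

Lemma size_split_parts : size t' = size P.
Proof. by rewrite size_map. Qed.

Definition piece_size (x : nat * bool) : nat :=
  if S x.1 then (if x.2 then part_size t x.1 - r else r)%N else part_size t x.1.

Lemma split_part_label k : (k < size P)%N -> part_label t' k = part_label t (nth d P k).1.
Proof. by move=> lt_k; rewrite /part_label (nth_map d). Qed.

Lemma split_part_size k : (k < size P)%N -> part_size t' k = piece_size (nth d P k).
Proof. by move=> lt_k; rewrite {1}/part_size (nth_map d). Qed.

Lemma part_start_succ (u : seq (part m)) i : (i < size u)%N -> part_start u i.+1 = (part_start u i + part_size u i)%N.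
Proof.
move=> lt_i; rewrite /part_start (take_nth (part0 m)) // map_rcons sumn_rcons.
by [].
Qed.

Lemma split_part_start k : (k < size P)%N ->
  part_start t' k = (part_start t (nth d P k).1 + (if (nth d P k).2 then r else 0))%N.
Proof.
elim: k => [|k IH] lt_k.
  case: t lt_k => [|x u] lt_k //; rewrite -[pieces _ _]/(pieces_from _ 0 _) pieces_from_head.
  by rewrite /part_start !take0.
have lt_k' := ltnW lt_k; rewrite part_start_succ ?size_split_parts // IH // split_part_size //.
have := @pieces_next S 0 (size t) k d lt_k; rewrite -/(pieces S (size t)) => /= ->.
have [lt_i] := mem_piece lt_k'; rewrite /piece_size; case: (nth d P k) lt_i => i b /= lt_i.
case Si: (S i) => /=; last by case: b => [/(_ isT)|] //= _; rewrite part_start_succ // addn0 addn0.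
case: b => _ /=; last by rewrite addn0.
by rewrite part_start_succ // addn0 -addnA subnKC // r_le.
Qed.

Lemma sumn_part_sizes (u : seq (part m)) : sumn [seq part_size u i | i <- iota 0 (size u)] = total_size u.
Proof.
rewrite /total_size; congr sumn; apply: (@eq_from_nth _ 0%N); rewrite !size_map ?size_iota // => i lt_i.
by rewrite (nth_map 0%N) ?size_iota // nth_iota // add0n (nth_map (part0 m)).
Qed.

Lemma split_total_size : total_size t' = total_size t.
Proof.
rewrite -(sumn_part_sizes t) /total_size /split_parts -map_comp /pieces.
have : forall i, i \in iota 0 (size t) -> (i < size t)%N by move=> i; rewrite mem_iota.
elim: (iota 0 (size t)) => //= i s IH s_lt; rewrite map_cat sumn_cat.
congr addn; last by apply: IH => j js; apply: s_lt; rewrite inE js orbT.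
case Si: (S i); rewrite /= Si addn0 //; apply: subnKC; apply: r_le Si _.
by apply: s_lt; rewrite inE eqxx.
Qed.

Lemma split_in_part k a : (k < size P)%N -> in_part t' k a -> in_part t (nth d P k).1 a.
Proof.
move=> lt_k; rewrite /in_part split_part_start // split_part_size // /piece_size.
have [lt_i xS] := mem_piece lt_k; case: (nth d P k) lt_i xS => i b /= lt_i.
by case Si: (S i) => /=; [have := r_le Si lt_i; case: b => /=|case: b => /= [/(_ isT)|]] => *; lia.
Qed.

Lemma split_line_label a : (a < total_size t)%N -> line_label t' a = line_label t a.
Proof.
rewrite -split_total_size => /in_part_ex[k]; rewrite size_split_parts => lt_k ka.
rewrite (line_label_part ka) split_part_label // (line_label_part (split_in_part lt_k ka)).
by [].
Qed.

End SplitParts.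

Scheme split_row_mut := Minimality for split_row Sort Prop
with split_col_mut := Minimality for split_col Sort Prop.
Combined Scheme split_mut from split_row_mut, split_col_mut.

Section SplitBlocks.
Variables (K : fieldType) (m : nat) (tau : 'I_m -> direction) (R C : nat).
Variables (s : block_matrix K m R C) (v : position) (r : nat).
Hypotheses (sR : total_size (rows s) = R) (sC : total_size (cols s) = C).

(** Strongly zero blocks are left to [masked], which speaks of labels instead of statuses. *)
Definition agrees (s : block_matrix K m R C) (A : 'M[K]_(R, C)) (u : position) (x : status) : Prop :=
  match x with
  | Identity => identity_block s A u
  | Zero => zero_block s A u
  | _ => True
  end.

Let SR i := `[< split_row s v i >].
Let SC j := `[< split_col s v j >].
Hypothesis v_in : in_range s v.
Hypothesis s_agrees : forall u, in_range s u -> agrees s (mat s) u (stat s u).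
Hypothesis v_echelon : echelon_block s (mat s) v r.

(** Identity blocks are square, so the sizes of the row and the column of the pivot propagate to
    every line that is split along with them. *)
Lemma split_line_le : (forall i, split_row s v i -> (r <= part_size (rows s) i)%N) /\
  (forall j, split_col s v j -> (r <= part_size (cols s) j)%N).
Proof.
have [] := v_echelon; rewrite leq_min => /andP[r1 r2] _.
have id_size i j : in_range s (i, j) -> is_identity (stat s (i, j)) ->
    part_size (rows s) i = part_size (cols s) j.
  by move=> u_in; have := s_agrees u_in; case: (stat s (i, j)) => //= -[].
by apply: split_mut => // i j u_in u_id _; rewrite (id_size _ _ u_in u_id).
Qed.

Let s' := split_at s v r.
Let pr (w : position) := nth (0%N, false) (pieces SR (size (rows s))) w.1.
Let pc (w : position) := nth (0%N, false) (pieces SC (size (cols s))) w.2.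

Let SR_le i : SR i -> (i < size (rows s))%N -> (r <= part_size (rows s) i)%N.
Proof. by move=> /asboolP h _; have [H _] := split_line_le; apply: H. Qed.

Let SC_le j : SC j -> (j < size (cols s))%N -> (r <= part_size (cols s) j)%N.
Proof. by move=> /asboolP h _; have [_ H] := split_line_le; apply: H. Qed.

Lemma split_rows_total : total_size (rows s') = R.
Proof. by rewrite split_total_size. Qed.

Lemma split_cols_total : total_size (cols s') = C.
Proof. by rewrite split_total_size. Qed.

Lemma split_row_line : row_line s' = row_line s.
Proof. by apply: funext => a; apply: split_line_label; rewrite ?sR. Qed.

Lemma split_col_line : col_line s' = col_line s.
Proof. by apply: funext => a; apply: split_line_label; rewrite ?sC. Qed.

Lemma split_in_range w : in_range s' w ->
  (w.1 < size (pieces SR (size (rows s))))%N /\ (w.2 < size (pieces SC (size (cols s))))%N.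
Proof. by rewrite /in_range !size_map => /andP[]. Qed.

Lemma split_old_in_range w : in_range s' w -> in_range s ((pr w).1, (pc w).1).
Proof.
move=> /split_in_range[l1 l2]; have [h1 _] := mem_piece l1; have [h2 _] := mem_piece l2.
by rewrite /in_range h1.
Qed.

Lemma split_strongly_zero w : in_range s' w ->
  strongly_zero tau s' w = strongly_zero tau s ((pr w).1, (pc w).1).
Proof.
by move=> /split_in_range[l1 l2]; rewrite /strongly_zero !split_part_label.
Qed.

Lemma split_statE w : stat s' w =
  let x := pr w in let y := pc w in let u := (x.1, y.1) in
  if u == v then (if x.2 || y.2 then Zero else Identity)
  else if is_identity (stat s u) then (if x.2 == y.2 then Identity else Zero)
  else stat s u.
Proof. by []. Qed.

Lemma split_zero w : in_range s' w -> zero_block s (mat s) ((pr w).1, (pc w).1) ->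
  zero_block s' (mat s') w.
Proof.
move=> /split_in_range[l1 l2] z a b aw bw; apply: z; [exact: split_in_part aw|exact: split_in_part bw].
Qed.

(** [r] is the place of the cut and [k] the rank of the old block: [k] is [r] for the pivot and the
    full size for an identity block, so both kinds of pieces are covered at once. *)
Lemma split_echelon w k (x := pr w) (y := pc w) : in_range s' w ->
  SR x.1 -> SC y.1 -> echelon_block s (mat s) (x.1, y.1) k ->
  ((x.2 == y.2) && (if x.2 then k == part_size (rows s) x.1 else (r <= k)%N) ->
     part_size (rows s') w.1 = part_size (cols s') w.2 -> identity_block s' (mat s') w) /\
  ((x.2 != y.2) || [&& x.2, y.2 & (k == r)] -> zero_block s' (mat s') w).
Proof.
move=> w_in Sx Sy [le_k E]; have [l1 l2] := split_in_range w_in.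
have [hx _] := mem_piece l1; have [hy _] := mem_piece l2.
have rx := SR_le Sx hx; have ry := SC_le Sy hy.
have szx : part_size (rows s') w.1 = if x.2 then (part_size (rows s) x.1 - r)%N else r.
  by rewrite split_part_size // /piece_size -/(pr w) -/x [`[< _ >]]Sx.
have szy : part_size (cols s') w.2 = if y.2 then (part_size (cols s) y.1 - r)%N else r.
  by rewrite split_part_size // /piece_size -/(pc w) -/y [`[< _ >]]Sy.
have stx : part_start (rows s') w.1 = (part_start (rows s) x.1 + if x.2 then r else 0)%N.
  by rewrite split_part_start.
have sty : part_start (cols s') w.2 = (part_start (cols s) y.1 + if y.2 then r else 0)%N.
  by rewrite split_part_start.
split=> [/andP[/eqP xy kk] sz|xy a b aw bw].
  split=> //; split; first by rewrite -sz minnn.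
  move=> a b aw bw; rewrite /= E; [|exact: split_in_part aw|exact: split_in_part bw].
  move: aw bw; rewrite /in_part stx sty sz szy -xy /=; move: sz kk le_k; rewrite szx szy -xy.
  move: rx ry; clear; move: (part_size _ _) (part_size _ _) (part_start _ _) (part_start _ _) => p q p0 q0.
  by case: x.2 => /= rx ry sz kk le_k /andP[a1 a2] /andP[b1 b2]; congr ((nat_of_bool _)%:R); lia.
rewrite /= E; [|exact: split_in_part aw|exact: split_in_part bw].
move: aw bw; rewrite /in_part stx sty szx szy /= => /andP[a1 a2] /andP[b1 b2].
rewrite (_ : _ && _ = false) //; apply/negbTE; move: xy a1 a2 b1 b2.
by case: x.2; case: y.2 => /=; lia.
Qed.

Lemma split_agrees w : in_range s' w -> agrees s' (mat s') w (stat s' w).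
Proof.
move=> w_in; have old_in := split_old_in_range w_in; have [l1 l2] := split_in_range w_in.
have := s_agrees old_in; rewrite split_statE /=; set x := pr w; set y := pc w.
have [uv|ne] := eqVneq (x.1, y.1) v.
  have Sx : SR x.1 by apply/asboolP; have -> : x.1 = v.1 by [rewrite -uv]; apply: Split_row_pivot.
  have Sy : SC y.1 by apply/asboolP; have -> : y.1 = v.2 by [rewrite -uv]; apply: Split_col_pivot.
  have v_ech : echelon_block s (mat s) (x.1, y.1) r by rewrite uv.
  have [h_id h_z] := split_echelon w_in Sx Sy v_ech.
  move=> _; case: ifP => xy /=.
    by apply: h_z; move: xy; rewrite -/x -/y; case: x.2; case: y.2 => //=; rewrite eqxx.
  apply: h_id; move: xy; rewrite -/x -/y; first by case: x.2; case: y.2 => //=; rewrite leqnn.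
  move=> xy; rewrite !split_part_size // /piece_size -/(pr w) -/(pc w) -/x -/y [`[< split_row _ _ _ >]]Sx [`[< split_col _ _ _ >]]Sy.
  by move: xy; case: x.2; case: y.2.
case u_stat: (stat s (x.1, y.1)) => //= u_ok; last exact: split_zero.
(* The closure in [split_row] and [split_col] makes the row and the column of an identity block
   split together. *)
have SRC : SR x.1 = SC y.1.
  by apply/asboolP/asboolP => h; [apply: Split_col_identity h|apply: Split_row_identity h]; rewrite ?u_stat.
have [sz ech] := u_ok; rewrite /= in sz ech.
have [Sx|nSx] := boolP (SR x.1).
  have Sy : SC y.1 by rewrite -SRC.
  have [h_id h_z] := split_echelon w_in Sx Sy ech.
  have [hx _] := mem_piece l1; have rx := SR_le Sx hx.
  case: ifP => xy /=.
    apply: h_id; first by rewrite xy /= eqxx rx if_same.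
    rewrite !split_part_size // /piece_size -/(pr w) -/(pc w) -/x -/y [`[< split_row _ _ _ >]]Sx [`[< split_col _ _ _ >]]Sy (eqP xy) sz.
    by [].
  by apply: h_z; rewrite -/x -/y xy.
have nSy : ~~ SC y.1 by rewrite -SRC.
have [_ x2] := mem_piece l1; have [_ y2] := mem_piece l2.
have x0 : x.2 = false by apply: contraNF nSx; apply: x2.
have y0 : y.2 = false by apply: contraNF nSy; apply: y2.
rewrite x0 y0 /=.
have szx : part_size (rows s') w.1 = part_size (rows s) x.1.
  by rewrite split_part_size // /piece_size -/(pr w) -/x [`[< _ >]](negbTE nSx).
have szy : part_size (cols s') w.2 = part_size (cols s) y.1.
  by rewrite split_part_size // /piece_size -/(pc w) -/y [`[< _ >]](negbTE nSy).
have stx : part_start (rows s') w.1 = part_start (rows s) x.1.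
  by rewrite split_part_start // -/(pr w) -/x x0 addn0.
have sty : part_start (cols s') w.2 = part_start (cols s) y.1.
  by rewrite split_part_start // -/(pc w) -/y y0 addn0.
split; first by rewrite szx szy.
split; first by rewrite szx szy sz minnn.
move=> a b aw bw; rewrite /= stx sty szx; have [_ E] := ech.
by apply: E; [exact: split_in_part aw|exact: split_in_part bw].
Qed.

End SplitBlocks.

Local Close Scope ring_scope.

(** * Erasable blocks *)

Definition is_zero (x : status) : bool := if x is Zero then true else false.

(** The virtual machine evaluates both arguments of [&&], but only the selected branch of an [if];
    short circuits keep the searches affordable. *)
Fixpoint all_lazy (T : Type) (a : T -> bool) (s : seq T) : bool :=
  if s is x :: s' then if a x then all_lazy a s' else false else true.

Fixpoint has_lazy (T : Type) (a : T -> bool) (s : seq T) : bool :=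
  if s is x :: s' then if a x then true else has_lazy a s' else false.

Fixpoint first (T : Type) (a : T -> bool) (s : seq T) : option T :=
  if s is x :: s' then if a x then Some x else first a s' else None.

Lemma all_lazyE T (a : T -> bool) s : all_lazy a s = all a s.
Proof. by elim: s => //= x s ->; case: (a x). Qed.

Lemma has_lazyE T (a : T -> bool) s : has_lazy a s = has a s.
Proof. by elim: s => //= x s ->; case: (a x). Qed.

Definition mode_row (d : mode) : bool := if d is Row_mode then true else false.

Lemma mode_rowK : cancel mode_row (fun b : bool => if b then Row_mode else Col_mode).
Proof. by case. Qed.
HB.instance Definition _ := Equality.copy mode (can_type mode_rowK).

(* A target together with the block that may not be used to erase it. *)
Definition target := (position * option position)%type.

Section Erasability.
(* [st0] holds the statuses of the blocks when an erasing phase starts, and [T] contains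
   every block erased in the phase, so that a block of T may have become zero. *)
Variables (st0 : position -> status) (pm : mode -> position -> position -> bool).
Variables (row_nonzero row_identity col_nonzero col_identity : nat -> seq nat).
Variable T : seq position.

Definition line_candidates (x : target) : seq (mode * position) :=
  [seq (Row_mode, (i, x.1.2)) | i <- col_identity x.1.2 &
     [&& i != x.1.1, Some (i, x.1.2) != x.2 & pm Row_mode (i, x.1.2) x.1]] ++
  [seq (Col_mode, (x.1.1, j)) | j <- row_identity x.1.1 &
     [&& j != x.1.2, Some (x.1.1, j) != x.2 & pm Col_mode (x.1.1, j) x.1]].

Definition effects (x : position) (c : mode * position) : seq (position * position) :=
  if c.1 is Row_mode then [seq ((c.2.1, j), (x.1, j)) | j <- row_nonzero c.2.1 & j != c.2.2]
  else [seq ((i, c.2.2), (i, x.2)) | i <- col_nonzero c.2.2 & i != c.2.1].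

(* Whether ERASABLE could succeed, whatever it has visited and whichever blocks of T are
   erased; sound for any bound n on the depth. *)
Fixpoint may_erase (n : nat) (x : target) : bool :=
  if n is n.+1 then
    has_lazy (fun c => all_lazy (fun e =>
       if e.1 \in T then true else
       if is_identity (st0 e.2) then e.2 \in T else
       if is_zero (st0 e.2) then may_erase n (e.2, Some e.1) else true) (effects x.1 c))
    (line_candidates x)
  else true.

Definition may_use (n : nat) (x : position) (c : mode * position) : bool :=
  all_lazy (fun e =>
       if e.1 \in T then true else
       if is_identity (st0 e.2) then e.2 \in T else
       if is_zero (st0 e.2) then may_erase n (e.2, Some e.1) else true) (effects x c).

Definition maybe_zero (w : position) : bool := if is_zero (st0 w) then true else w \in T.

(** Blocks of [Z] have certainly been erased, so they neither serve as candidates nor cause effects;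
    the other blocks of [T] may have status 0 or not. *)
Definition subtargets (Z : seq position) (x : position) (c : mode * position) : seq target :=
  if c.2 \in Z then [::] else
  [seq (e.2, Some e.1) | e <- effects x c & if maybe_zero e.2 then e.1 \notin Z else false].

Section Tree.
Variables (n : nat) (t : position).

Definition tree_candidates (x : target) : seq (mode * position) :=
  [seq c <- line_candidates x | (c.2 != t) && may_use n x.1 c].

Definition tree_targets (x : target) : seq target :=
  [seq y <- flatten [seq subtargets [::] x.1 c | c <- tree_candidates x] | (y.1 != t) && may_erase n y].

Definition tree_closed (L : seq target) : bool :=
  ((t, None) \in L) && all (fun x => all (mem L) (tree_targets x)) L.

Definition same_line (d : mode) (v w : position) : bool :=
  if d is Row_mode then v.1 == w.1 else v.2 == w.2.

(* No target of a process tree with root t lies in the line of an identity block used by the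
   tree, so that pending targets do not spoil the operations. *)
Definition tree_lines_clean (L : seq target) : bool :=
  all (fun x => all (fun c => all (fun y => (y.1 == t) || ~~ same_line c.1 y.1 c.2) L)
     (tree_candidates x)) L.

Definition grow (f : target -> seq target) (L : seq target) : seq target :=
  foldl (fun L y => if y \in L then L else y :: L) L (flatten [seq f x | x <- L]).

(** Closure is tested on the iterated set itself, so any number of iterations that passes the test
    is sufficient. *)
Definition tree_ok : bool :=
  let L := iter n (grow tree_targets) [:: (t, None)] in
  if tree_closed L then tree_lines_clean L else false.

End Tree.

Section Must.
Variables (n : nat) (Z : seq position).

Definition next_targets (x : target) : seq target :=
  flatten [seq subtargets Z x.1 c | c <- line_candidates x].

Definition reach (L : seq target) : seq target := iter n (grow next_targets) L.

Definition closed (L : seq target) : bool := all (fun x => all (mem L) (next_targets x)) L.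

(* Whether ERASABLE succeeds on x for every order of enumeration, when the blocks in Z and
   possibly others in T are erased. The set P bounds the visited targets; a candidate is
   certain to be usable if it stays unvisited while the other candidates are tried. *)
Fixpoint must_erase (k : nat) (P : seq position) (x : target) : bool :=
  if k is k.+1 then
    let cs := line_candidates x in
    has_lazy (fun c =>
      if c.2 \in T then false else
      let L := reach (flatten [seq subtargets Z x.1 c' | c' <- cs & c' != c]) in
      if closed L then
        let P1 := x.1 :: P ++ [seq y.1 | y <- L] in
        if c.2 \in P1 then false else
        let ys := subtargets Z x.1 c in
        all_lazy (fun e =>
          if e.1 \in Z then true else
          if is_identity (st0 e.2) && (e.2 \notin Z) then false else
          let y := (e.2, Some e.1) in
          let L' := reach [seq y' <- ys | y' != y] in
          if closed L' then
            let P2 := P1 ++ [seq y.1 | y <- L'] in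
            if e.2 \in P2 then false else
            if maybe_zero e.2 then must_erase k P2 y else true
          else false) (effects x.1 c)
      else false) cs
  else false.

End Must.

(* Any set of erased blocks that does not contain [rest] leaves an erasable block in [rest]. *)
Fixpoint must_order (n k : nat) (Z rest : seq position) : bool :=
  if rest is [::] then true else
  if k is k.+1 then
    if first (fun t => must_erase n Z n [::] (t, None)) rest is Some t
    then must_order n k (t :: Z) [seq v <- rest | v != t] else false
  else false.

(** The first test bounds the erased blocks from above by [T], the last one from below, so that
    exactly [T] is erased in every run; the trees must also be safe to traverse. *)
Definition erasure_ok (n : nat) (nonzeros : seq position) : bool :=
  [&& all (fun v => if v \in T then true else ~~ may_erase n (v, None)) nonzeros,
      all (mem nonzeros) T, all (tree_ok n) T & must_order n (size T) [::] T].

End Erasability.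

Scheme erasable_ind' := Minimality for erasable Sort Prop
with erasable_by_ind' := Minimality for erasable_by Sort Prop
with try_candidates_ind' := Minimality for try_candidates Sort Prop
with clear_effects_ind' := Minimality for clear_effects Sort Prop.
Combined Scheme erasable_mut from erasable_ind', erasable_by_ind', try_candidates_ind', clear_effects_ind'.

Section Runs.
Variables (K : fieldType) (m : nat) (tau : 'I_m -> direction) (R C : nat).
Variable s : block_matrix K m R C.

Lemma visited_mono :
  (forall x vf vis res vis', erasable tau s x vf vis res vis' -> {subset x :: vis <= vis'}) /\
  (forall d x vf vis res vis', erasable_by tau s d x vf vis res vis' -> {subset x :: vis <= vis'}) /\
  (forall d x vf es vis res vis', try_candidates tau s d x vf es vis res vis' -> {subset vis <= vis'}) /\
  (forall d x us vis res vis', clear_effects tau s d x us vis res vis' -> {subset vis <= vis'}).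
Proof.
apply: erasable_mut => //.
- by move=> vt vf vis vis' res vis'' _ h1 _ h2 v /h1 v1; apply: h2; rewrite inE v1 orbT.
- by move=> _ _ _ vis v.
- by move=> d vt vf vE es vis us vis2 res vis3 _ _ _ h1 _ h2 v /h1/h2.
- by move=> _ _ vis v.
- by move=> _ _ _ _ vis _ v.
- by move=> d vt u us vis vis' _ _ _ h1 v v1; apply: h1; rewrite inE v1 orbT.
- by move=> d vt u us vis p vis' res vis'' _ _ _ h1 _ h2 v v1; apply/h2/h1; rewrite inE v1 orbT.
Qed.

Variable t : position.

(** What is kept of a successful search once the visited set is forgotten: local conditions, and
    that the root [t], visited before all else, is neither used nor affected again. *)
Inductive valid : target -> process_tree -> Prop :=
| Valid d x vf vE us ps :
    vE \in candidates s d x -> permissible tau s d vE x -> Some vE != vf -> vE != t ->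
    perm_eq us (affecting s d vE) -> valid_all d x us ps -> valid (x, vf) (Process d x vE ps)
with valid_all : mode -> position -> seq position -> seq process_tree -> Prop :=
| Valid_nil d x : valid_all d x [::] [::]
| Valid_harmless d x u us ps :
    affected d x u != t ->
    stat s (affected d x u) = Unprocessed \/ stat s (affected d x u) = Strongly_zero ->
    valid_all d x us ps -> valid_all d x (u :: us) ps
| Valid_subtree d x u us p ps :
    affected d x u != t -> stat s (affected d x u) = Zero ->
    valid (affected d x u, Some u) p -> valid_all d x us ps -> valid_all d x (u :: us) (p :: ps).

Lemma run_valid :
  (forall x vf vis res vis', erasable tau s x vf vis res vis' ->
     t \in x :: vis -> forall p, res = Some p -> valid (x, vf) p) /\
  (forall d x vf vis res vis', erasable_by tau s d x vf vis res vis' ->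
     t \in x :: vis -> forall p, res = Some p -> valid (x, vf) p) /\
  (forall d x vf es vis res vis', try_candidates tau s d x vf es vis res vis' ->
     {subset es <= candidates s d x} -> t \in vis -> forall p, res = Some p -> valid (x, vf) p) /\
  (forall d x us vis res vis', clear_effects tau s d x us vis res vis' ->
     t \in vis -> forall ps, res = Some ps -> valid_all d x us ps).
Proof.
have [mono [mono_by [_ mono_clear]]] := visited_mono.
apply: erasable_mut => //.
- move=> vt vf vis vis' res vis'' h1 _ h2 IH tv; apply: IH.
  by rewrite inE (mono_by _ _ _ _ _ _ h1 _ tv) orbT.
- move=> d vt vf vis es res vis2 p_es _ IH tv p E; apply: IH => //.
  by move=> v; rewrite (perm_mem p_es).
- move=> d vt vf vE es vis res vis' _ _ IH sub tv; apply: IH => // v vs; apply: sub.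
  by rewrite inE vs orbT.
- move=> d vt vf vE es vis us ps vis' /and3P[nvis nvf perm] p_us _ IH sub tv p [<-].
  apply: (@Valid d vt vf vE us) => //; [exact: sub (mem_head _ _)| |exact: IH].
  by apply: contraNneq nvis => ->.
- move=> d vt vf vE es vis us vis' res vis'' _ _ h1 _ _ IH sub tv; apply: IH.
    by move=> v vs; apply: sub; rewrite inE vs orbT.
  exact: mono_clear h1 _ tv.
- by move=> d vt vis _ ps [<-]; apply: Valid_nil.
- move=> d vt u us vis res vis' nvis stw _ IH tv ps E; apply: Valid_harmless => //; last exact: IH.
  by apply: contraNneq nvis => ->.
- move=> d vt u us vis p vis' res vis'' nvis stw h1 IH1 _ IH2 tv ps.
  case: res IH2 => // ps' IH2 [<-].
  apply: Valid_subtree => //; first by apply: contraNneq nvis => ->.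
    by apply: IH1 => //; rewrite inE tv orbT.
  by apply: IH2 => //; apply: mono h1 _ _; rewrite inE tv orbT.
Qed.

End Runs.

Lemma first_some T (a : T -> bool) (s : seq T) x : first a s = Some x -> a x.
Proof. by elim: s => //= y s IH; case: ifP => // ay [<-]. Qed.

Lemma first_mem (T : eqType) (a : T -> bool) (s : seq T) x : first a s = Some x -> x \in s.
Proof.
elim: s => //= y s IH; case: ifP => [_ [->]|_ /IH]; first exact: mem_head.
by rewrite inE orbC => ->.
Qed.

Section FuelLists.
Variables (st0 : position -> status) (pm : mode -> position -> position -> bool).
Variables (row_nonzero row_identity col_nonzero col_identity : nat -> seq nat).
Variable T : seq position.

Local Notation may_erase := (may_erase st0 pm row_nonzero row_identity col_nonzero col_identity T).
Local Notation may_use := (may_use st0 pm row_nonzero row_identity col_nonzero col_identity T).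
Local Notation line_candidates := (line_candidates pm row_identity col_identity).

Lemma may_eraseS n x : may_erase n.+1 x = has (may_use n x.1) (line_candidates x).
Proof. by rewrite /= has_lazyE. Qed.

Local Notation must_erase := (must_erase st0 pm row_nonzero row_identity col_nonzero col_identity T).
Local Notation must_order := (must_order st0 pm row_nonzero row_identity col_nonzero col_identity T).

(** Entries of the order that already lie in [D] are skipped and join [Z]. The first entry outside
    [D] was certified assuming only that the entries before it are erased. *)
Lemma must_order_next n k Z rest (D : seq position) : must_order n k Z rest -> {subset Z <= D} ->
  (exists2 t, t \in rest & t \notin D) -> exists Z' t,
  [/\ {subset Z' <= D}, t \in rest, t \notin D & must_erase n Z' n [::] (t, None)].
Proof.
elim: k Z rest => [|k IH] Z [|t0 rest]; try by move=> ? ? [].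
set r := t0 :: rest => H ZD [t tr tD]; move: H.
rewrite -[must_order _ _ _ _]/(if first (fun t => must_erase n Z n [::] (t, None)) r is Some t
  then must_order n k (t :: Z) [seq v <- r | v != t] else false); case E: (first _ _) => [t1|] // H.
have [t1D|t1D] := boolP (t1 \in D); last first.
  exists Z, t1; have t1r := first_mem (T := position) E; have must := first_some E.
  by split.
have [||Z' [t' [Z'D t'r t'D M]]] := IH _ _ H.
- by move=> v; rewrite inE => /predU1P[->|/ZD].
- by exists t => //; rewrite mem_filter -/r tr andbT; apply: contraNneq tD => ->.
by exists Z', t'; split=> //; move: t'r; rewrite mem_filter => /andP[].
Qed.

End FuelLists.

Lemma sub_grow (f : target -> seq target) L : {subset L <= grow f L}.
Proof.
rewrite /grow; move: (flatten _) => G; elim: G L => [|y G IH] L x xL //=; apply: IH.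
by case: ifP => // _; rewrite inE xL orbT.
Qed.

Lemma sub_iter_grow (f : target -> seq target) n L : {subset L <= iter n (grow f) L}.
Proof. by elim: n => [|n IH] x xL //=; apply/sub_grow/IH. Qed.

Section Environment.
Variables (K : fieldType) (m : nat) (tau : 'I_m -> direction) (R C : nat).
Variable s : block_matrix K m R C.
Variables (st0 : position -> status) (pm : mode -> position -> position -> bool).
Variables (row_nonzero row_identity col_nonzero col_identity : nat -> seq nat).
Variables T D : seq position.

Local Notation may_erase := (may_erase st0 pm row_nonzero row_identity col_nonzero col_identity T).
Local Notation may_use := (may_use st0 pm row_nonzero row_identity col_nonzero col_identity T).
Local Notation line_candidates := (line_candidates pm row_identity col_identity).
Local Notation effects := (effects row_nonzero col_nonzero).
Local Notation subtargets := (subtargets st0 row_nonzero col_nonzero T).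
Local Notation maybe_zero := (maybe_zero st0 T).

(* The block matrix is in the middle of an erasing phase: the blocks in D are erased. *)
Record env_ok : Prop := EnvOk {
  env_D : {subset D <= T};
  env_stat : forall v, in_range s v -> stat s v = if v \in D then Zero else st0 v;
  env_row_nonzero : forall i j, (j \in row_nonzero i) = in_range s (i, j) && is_nonzero (st0 (i, j));
  env_row_identity : forall i j, (j \in row_identity i) = in_range s (i, j) && is_identity (st0 (i, j));
  env_col_nonzero : forall i j, (i \in col_nonzero j) = in_range s (i, j) && is_nonzero (st0 (i, j));
  env_col_identity : forall i j, (i \in col_identity j) = in_range s (i, j) && is_identity (st0 (i, j));
  env_pm : forall d v w, in_range s v -> in_range s w -> pm d v w = permissible tau s d v w }.

Hypothesis ok : env_ok.

Lemma stat_nonzero v : in_range s v -> is_nonzero (stat s v) -> v \notin D /\ st0 v = stat s v.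
Proof. by move=> v_in; rewrite env_stat //; case: ifP. Qed.

Lemma mem_row_line (p : pred position) (i : nat) u :
  (u \in [seq w <- [seq (i, j) | j <- iota 0 (size (cols s))] | p w]) = [&& u.1 == i, (u.2 < size (cols s))%N & p u].
Proof.
rewrite mem_filter andbC andbA; congr andb; apply/mapP/idP => [[j]|].
  by rewrite mem_iota add0n /= => lt_j ->; rewrite /= eqxx.
by move=> /andP[/eqP <- lt_j]; exists u.2; [rewrite mem_iota|case: u {lt_j}].
Qed.

Lemma mem_col_line (p : pred position) (j : nat) u :
  (u \in [seq w <- [seq (i, j) | i <- iota 0 (size (rows s))] | p w]) = [&& u.2 == j, (u.1 < size (rows s))%N & p u].
Proof.
rewrite mem_filter andbC andbA; congr andb; apply/mapP/idP => [[i]|].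
  by rewrite mem_iota add0n /= => lt_i ->; rewrite /= eqxx.
by move=> /andP[/eqP <- lt_i]; exists u.1; [rewrite mem_iota|case: u {lt_i}].
Qed.

Lemma mem_candidates d x vE : in_range s x ->
  (vE \in candidates s d x) =
  [&& in_range s vE, ~~ same_line d x vE, same_line (if d is Row_mode then Col_mode else Row_mode) x vE
    & is_identity (stat s vE)].
Proof.
move=> /andP[x1 x2]; case: x vE x1 x2 => x1 x2 [e1 e2] /= x1_lt x2_lt.
case: d => /=; rewrite /col_side_effect /row_side_effect /in_range ?mem_row_line ?mem_col_line /= xpair_eqE.
  by have [->|] := eqVneq e2 x2; rewrite ?andbF //= x2_lt ?andbT ?eqxx (eq_sym e1) /=.
by have [->|] := eqVneq e1 x1; rewrite ?andbF //= x1_lt ?eqxx /= (eq_sym e2).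
Qed.

Lemma mem_affecting d vE u : in_range s vE ->
  (u \in affecting s d vE) =
  [&& in_range s u, same_line d u vE, u != vE & is_nonzero (stat s u)].
Proof.
move=> /andP[x1 x2]; case: vE u x1 x2 => x1 x2 [e1 e2] /= x1_lt x2_lt.
case: d => /=; rewrite /affecting /in_range ?mem_row_line ?mem_col_line /=.
  by have [->|] := eqVneq e1 x1; rewrite ?andbF //= x1_lt.
by have [->|] := eqVneq e2 x2; rewrite ?andbF //= x2_lt andbT.
Qed.

Lemma affecting_uniq d vE : uniq (affecting s d vE).
Proof.
by case: d; apply: filter_uniq; rewrite map_inj_uniq ?iota_uniq // => i j [].
Qed.

Lemma affected_in_range d x u : in_range s x -> in_range s u -> in_range s (affected d x u).
Proof. by case: d => /andP[x1 x2] /andP[u1 u2]; rewrite /in_range /= ?x1 ?x2 ?u1 ?u2. Qed.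

Lemma mem_line_candidates d x vf vE : in_range s x -> in_range s vE -> 
  ((d, vE) \in line_candidates (x, vf)) =
  [&& ~~ same_line d x vE, same_line (if d is Row_mode then Col_mode else Row_mode) x vE,
   is_identity (st0 vE), Some vE != vf & permissible tau s d vE x].
Proof.
move=> x_in e_in; rewrite -(env_pm ok) // mem_cat /=.
have RC (l : seq nat) f : ((d, vE) \in [seq (Row_mode, f i) | i <- l]) = (d == Row_mode) && (vE \in map f l).
  apply/mapP/andP => [[i il [-> ->]]|[/eqP-> /mapP[i il ->]]]; last by exists i.
  by split=> //; apply: map_f.
have CC (l : seq nat) f : ((d, vE) \in [seq (Col_mode, f i) | i <- l]) = (d == Col_mode) && (vE \in map f l).
  apply/mapP/andP => [[i il [-> ->]]|[/eqP-> /mapP[i il ->]]]; last by exists i.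
  by split=> //; apply: map_f.
rewrite RC CC {RC CC}; case: d => /=; rewrite ?orbF.
  apply/mapP/idP => [[i]|]; rewrite ?mem_filter.
    rewrite env_col_identity // => /and3P[/and3P[ne nf perm] i_in i_id] E; rewrite {vE}E /= in e_in *.
    by rewrite eq_sym ne eqxx i_id nf perm.
  case: vE e_in => e1 e2 e_in /= /and5P[ne /eqP E e_id nf perm]; subst e2; exists e1 => //.
  by rewrite mem_filter env_col_identity // e_in e_id nf eq_sym ne perm.
apply/mapP/idP => [[i]|]; rewrite ?mem_filter.
  rewrite env_row_identity // => /and3P[/and3P[ne nf perm] i_in i_id] E; rewrite {vE}E /= in e_in *.
  by rewrite eq_sym ne eqxx i_id nf perm.
case: vE e_in => e1 e2 e_in /= /and5P[ne /eqP E e_id nf perm]; subst e1; exists e2 => //.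
by rewrite mem_filter env_row_identity // e_in e_id nf eq_sym ne perm.
Qed.

Lemma line_candidates_in_range d x vf vE : in_range s x -> (d, vE) \in line_candidates (x, vf) -> in_range s vE.
Proof.
move=> x_in; rewrite mem_cat => /orP[] /mapP[i]; rewrite mem_filter => /andP[_].
  by rewrite env_col_identity // => /andP[i_in _] [_ ->].
by rewrite env_row_identity // => /andP[i_in _] [_ ->].
Qed.

Lemma candidate_mem d x vf vE : in_range s x -> vE \in candidates s d x -> Some vE != vf ->
  permissible tau s d vE x -> (d, vE) \in line_candidates (x, vf).
Proof.
move=> x_in; rewrite mem_candidates // => /and4P[e_in ne same e_id] nf perm.
rewrite mem_line_candidates // ne same nf perm andbT /= andbT.
by have [|_ ->] := stat_nonzero e_in; rewrite ?e_id //; case: (stat s vE) e_id.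
Qed.

Lemma mem_effects d x vE u : in_range s vE -> u \in affecting s d vE ->
  (u, affected d x u) \in effects x (d, vE).
Proof.
move=> e_in; rewrite mem_affecting // => /and4P[u_in same ne nz].
have [_ st_u] := stat_nonzero u_in nz.
case: u u_in same ne nz st_u => u1 u2 u_in; case: vE e_in => e1 e2 e_in; case: d => /= /eqP e ne nz st_u.
  apply/mapP; exists u2; last by rewrite -e.
  move: ne; rewrite -e xpair_eqE eqxx /= => ne.
  by rewrite mem_filter /= ne env_row_nonzero // u_in st_u.
apply/mapP; exists u1; last by rewrite -e.
move: ne; rewrite -e xpair_eqE eqxx andbT => ne.
by rewrite mem_filter /= ne env_col_nonzero // u_in st_u.
Qed.

Lemma effects_cases d x vE e : in_range s vE -> e \in effects x (d, vE) ->
  [/\ in_range s e.1, e.2 = affected d x e.1 & (e.1 \in D) || (e.1 \in affecting s d vE)].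
Proof.
move=> e_in; rewrite /effects /=; case: d => /mapP[i]; rewrite mem_filter.
  rewrite env_row_nonzero // => /and3P[ne i_in nz] -> /=; split=> //.
  rewrite mem_affecting // i_in /= eqxx env_stat //; case: ifP => //= _; rewrite nz andbT.
  by apply: contraNneq ne => /(congr1 snd) /= ->.
rewrite env_col_nonzero // => /and3P[ne i_in nz] -> /=; split=> //.
rewrite mem_affecting // i_in /= eqxx env_stat //; case: ifP => //= _; rewrite nz andbT.
by apply: contraNneq ne => /(congr1 fst) /= ->.
Qed.

Lemma zero_maybe w : in_range s w -> stat s w = Zero -> maybe_zero w.
Proof.
move=> w_in; rewrite env_stat // /maybe_zero; case: ifP => [wD _|_ -> //].
by rewrite (env_D ok) // if_same.
Qed.

Local Notation pos L := [seq y.1 | y : target <- L].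
Local Notation next_targets := (next_targets st0 pm row_nonzero row_identity col_nonzero col_identity T).
Local Notation closed := (closed st0 pm row_nonzero row_identity col_nonzero col_identity T).
Local Notation must_erase := (must_erase st0 pm row_nonzero row_identity col_nonzero col_identity T).
Local Notation must_order := (must_order st0 pm row_nonzero row_identity col_nonzero col_identity T).

Variable Z : seq position.
Hypothesis Z_D : {subset Z <= D}.

Lemma mem_subtargets d x vE u : in_range s x -> vE \in candidates s d x ->
  u \in affecting s d vE -> stat s (affected d x u) = Zero ->
  (affected d x u, Some u) \in subtargets Z x (d, vE).
Proof.
move=> x_in; rewrite mem_candidates // => /and4P[e_in _ _ e_id] u_aff st_w.
have [|eD _] := stat_nonzero e_in; first by case: (stat s vE) e_id.
have eZ : vE \notin Z by apply: contraNN eD; apply: Z_D.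
have uin := u_aff; rewrite mem_affecting // in uin; have /and4P[u_in _ _ u_nz] := uin.
have [uD _] := stat_nonzero u_in u_nz.
have uZ : u \notin Z by apply: contraNN uD; apply: Z_D.
rewrite /subtargets /= (negPf eZ); apply/mapP; exists (u, affected d x u) => //.
by rewrite mem_filter mem_effects // zero_maybe ?uZ //; apply: affected_in_range.
Qed.

Section VisitedBound.
Variable L : seq target.
Hypothesis L_closed : closed Z L.

(** Every recursive call goes to one of the [next_targets], so a closed [L] that contains the first
    target bounds the visited blocks for every order of enumeration and every outcome. *)
Lemma visited_bound :
  (forall x vf vis res vis', erasable tau s x vf vis res vis' -> in_range s x -> (x, vf) \in L ->
     {subset vis' <= vis ++ pos L}) /\
  (forall d x vf vis res vis', erasable_by tau s d x vf vis res vis' -> in_range s x -> (x, vf) \in L ->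
     {subset vis' <= vis ++ pos L}) /\
  (forall d x vf es vis res vis', try_candidates tau s d x vf es vis res vis' -> in_range s x ->
     {subset es <= candidates s d x} ->
     (forall vE, vE \in es -> Some vE != vf -> permissible tau s d vE x ->
        {subset subtargets Z x (d, vE) <= L}) ->
     {subset vis' <= vis ++ pos L}) /\
  (forall d x us vis res vis', clear_effects tau s d x us vis res vis' -> in_range s x ->
     {subset us <= in_range s} ->
     (forall u, u \in us -> stat s (affected d x u) = Zero -> (affected d x u, Some u) \in L) ->
     {subset vis' <= vis ++ pos L}).
Proof.
have sub_refl (vis : seq position) : {subset vis <= vis ++ pos L} by move=> v vv; rewrite mem_cat vv.
have trans (a b c : seq position) : {subset b <= a ++ pos L} -> {subset c <= b ++ pos L} -> {subset c <= a ++ pos L}.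
  by move=> ab bc v /bc; rewrite mem_cat => /orP[/ab //|vL]; rewrite mem_cat vL orbT.
apply: erasable_mut.
- by [].
- by move=> x vf vis vis' res vis'' _ IH1 _ IH2 x_in xL; apply: trans (IH1 x_in xL) (IH2 x_in xL).
- move=> d x vf vis es res vis' p_es _ IH x_in xL v v_in.
  have xs : x \in pos L by apply/mapP; exists (x, vf).
  have: v \in (x :: vis) ++ pos L.
    apply: IH v v_in => // [e|vE e_in nf perm y y_sub]; first by rewrite (perm_mem p_es).
    rewrite (perm_mem p_es) in e_in.
    have := allP L_closed _ xL => /allP; apply.
    by apply/flatten_mapP; exists (d, vE) => //; apply: candidate_mem.
  by rewrite mem_cat inE -orbA => /or3P[/eqP->|vv|vL]; rewrite mem_cat ?xs ?vv ?vL ?orbT.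
- by move=> d x vf vis *; apply: sub_refl.
- move=> d x vf vE es vis res vis' _ _ IH x_in sub h; apply: IH => // [e ee|e ee]; last by apply: h; rewrite inE ee orbT.
  by apply: sub; rewrite inE ee orbT.
- move=> d x vf vE es vis us ps vis' /and3P[_ nf perm] p_us _ IH x_in sub h.
  have e_cand := sub _ (mem_head vE es).
  have := e_cand; rewrite mem_candidates // => /andP[e_in _].
  apply: IH => // u; rewrite (perm_mem p_us); first by rewrite mem_affecting // => /andP[].
  move=> u_aff st_w; apply: (h vE) => //; first exact: mem_head.
  exact: mem_subtargets.
- move=> d x vf vE es vis us vis' res vis'' /and3P[_ nf perm] p_us _ IH1 _ IH2 x_in sub h.
  have e_cand := sub _ (mem_head vE es).
  have := e_cand; rewrite mem_candidates // => /andP[e_in _].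
  apply: (trans vis vis').
    apply: IH1 => // u; rewrite (perm_mem p_us); first by rewrite mem_affecting // => /andP[].
    move=> u_aff st_w; apply: (h vE) => //; first exact: mem_head.
    exact: mem_subtargets.
  apply: IH2 => // [e ee|e ee]; last by apply: h; rewrite inE ee orbT.
  by apply: sub; rewrite inE ee orbT.
- by move=> d x vis *; apply: sub_refl.
- by move=> d x u us vis *; apply: sub_refl.
- move=> d x u us vis res vis' _ _ _ IH x_in sub h; apply: IH => // v vs; last by apply: h; rewrite inE vs orbT.
  by apply: sub; rewrite inE vs orbT.
- move=> d x u us vis vis' _ st_w _ IH x_in sub h; apply: IH; last by apply: h => //; apply: mem_head.
  by apply: affected_in_range => //; apply: sub (mem_head _ _).
- move=> d x u us vis p vis' res vis'' _ st_w _ IH1 _ IH2 x_in sub h; apply: (trans vis vis').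
    apply: IH1; last by apply: h => //; apply: mem_head.
    by apply: affected_in_range => //; apply: sub (mem_head _ _).
  apply: IH2 => // v vs; last by apply: h; rewrite inE vs orbT.
  by apply: sub; rewrite inE vs orbT.
Qed.

End VisitedBound.

Lemma clear_effects_inv d x u us vis res vis' : clear_effects tau s d x (u :: us) vis res vis' ->
  let w := affected d x u in
  [\/ [/\ (w \in vis) || is_identity (stat s w), res = None & vis' = vis],
      [/\ w \notin vis, stat s w = Unprocessed \/ stat s w = Strongly_zero & clear_effects tau s d x us vis res vis'],
      [/\ w \notin vis, stat s w = Zero, res = None & erasable tau s w (Some u) vis None vis']
    | w \notin vis /\ stat s w = Zero /\ exists p vis2 res2,
       [/\ erasable tau s w (Some u) vis (Some p) vis2, clear_effects tau s d x us vis2 res2 vis'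
         & res = omap (cons p) res2]].
Proof.
move=> run; inversion run; subst.
- by constructor 1.
- by constructor 2.
- by constructor 3.
- by constructor 4; do 2!split=> //; exists p, vis'0, res0.
Qed.

(** Before a neighbor [u] is examined, only calls for its siblings have been made, and these stay
    inside the closed set [L_ u]. The block affected by [u] is outside of it, so it is still
    unvisited when its turn comes. *)
Lemma clear_must d x vE us P1 L_ vis res vis' :
  clear_effects tau s d x us vis res vis' -> in_range s x -> vE \in candidates s d x ->
  {subset us <= affecting s d vE} -> uniq us ->
  (forall u, u \in us -> [/\ closed Z (L_ u),
     forall u', u' \in affecting s d vE -> u' != u -> stat s (affected d x u') = Zero ->
       (affected d x u', Some u') \in L_ u,
     affected d x u \notin P1 ++ pos (L_ u), ~~ is_identity (stat s (affected d x u))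
   & stat s (affected d x u) = Zero -> forall vis res vis', {subset vis <= P1 ++ pos (L_ u)} ->
       erasable tau s (affected d x u) (Some u) vis res vis' -> res <> None]) ->
  (forall u, u \in us -> {subset vis <= P1 ++ pos (L_ u)}) -> res <> None.
Proof.
elim: us vis res vis' => [|u us IH] vis res vis' run x_in e_cand sub uniq_us h vis_sub.
  by inversion run.
have [clos sib w_new w_id must] := h u (mem_head _ _).
have sub' : {subset us <= affecting s d vE} by move=> v vs; apply: sub; rewrite inE vs orbT.
have h' v : v \in us -> _ := fun vs => h v (mem_behead (s := u :: us) vs).
have [nu uniq_us'] := andP uniq_us.
have vis_sub' v : v \in us -> _ := fun vs => vis_sub v (mem_behead (s := u :: us) vs).
have e_in : in_range s vE by move: e_cand; rewrite mem_candidates // => /andP[].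
have u_in : in_range s u by have := sub u (mem_head _ _); rewrite mem_affecting // => /andP[].
have [[w_blocked _ _]|[_ _ run']|[_ st_w _ run']|[_ [st_w [p [vis2 [res2 [run1 run2 ->]]]]]]] := clear_effects_inv run.
- have wP := contraNN (vis_sub u (mem_head _ _) _) w_new.
  by move: w_blocked; rewrite (negPf wP) (negPf w_id).
- exact: (IH _ _ _ run').
- by case: (must st_w _ _ _ (vis_sub u (mem_head _ _)) run').
- case: res2 run2 => // run2; exfalso; apply: (IH _ _ _ run2) => // v vs.
  have [clos_v sib_v _ _ _] := h' v vs.
  have wL : (affected d x u, Some u) \in L_ v.
    by apply: sib_v; rewrite ?sub ?mem_head //; apply: contraNneq nu => ->.
  have [vb _] := visited_bound clos_v.
  have vb' := vb _ _ _ _ _ run1 (affected_in_range d x_in u_in) wL.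
  by move=> z /vb'; rewrite !mem_cat => /orP[/(vis_sub' v vs)|->]; rewrite ?mem_cat ?orbT.
Qed.

Lemma try_candidates_inv d x vf vE es vis res vis' :
  try_candidates tau s d x vf (vE :: es) vis res vis' ->
  [\/ [|| vE \in vis, Some vE == vf | ~~ permissible tau s d vE x] /\ try_candidates tau s d x vf es vis res vis',
      res <> None
    | [&& vE \notin vis, Some vE != vf & permissible tau s d vE x] /\ exists us vis2,
      [/\ perm_eq us (affecting s d vE), clear_effects tau s d x us vis None vis2
        & try_candidates tau s d x vf es vis2 res vis']].
Proof.
move=> run; inversion run; subst.
- by constructor 1.
- by constructor 2.
- by constructor 3; split=> //; exists us, vis'0.
Qed.

(** If no earlier candidate succeeds, their failed attempts have visited only blocks of [L], which
    leaves [vE] unvisited, and [vE] is then found usable. *)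
Lemma try_must d x vf vE es P1 L vis res vis' :
  try_candidates tau s d x vf es vis res vis' -> in_range s x ->
  {subset es <= candidates s d x} -> vE \in es -> Some vE != vf -> permissible tau s d vE x ->
  closed Z L ->
  (forall vE', vE' \in es -> vE' != vE -> Some vE' != vf -> permissible tau s d vE' x ->
        {subset subtargets Z x (d, vE') <= L}) ->
  vE \notin P1 ++ pos L ->
  (forall us vis res vis', perm_eq us (affecting s d vE) -> {subset vis <= P1 ++ pos L} ->
     clear_effects tau s d x us vis res vis' -> res <> None) ->
  {subset vis <= P1 ++ pos L} -> res <> None.
Proof.
elim: es vis res vis' => [|e es IH] vis res vis' run x_in sub e_es nf perm clos sibs new must vis_sub //.
have sub' : {subset es <= candidates s d x} by move=> v vs; apply: sub; rewrite inE vs orbT.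
have sibs' v : v \in es -> _ := fun vs => sibs v (mem_behead (s := e :: es) vs).
have [[skip run']|//|[/and3P[_ nf' perm'] [us [vis2 [p_us run1 run2]]]]] := try_candidates_inv run.
  apply: (IH _ _ _ run') => //; move: e_es; rewrite inE => /predU1P[E|//].
  by subst e; move: skip; rewrite (negPf nf) perm (negPf (contraNN (vis_sub _) new)).
have ne : e != vE by apply/negP=> /eqP E; subst e; apply: must p_us vis_sub run1 _.
move: e_es; rewrite inE eq_sym (negPf ne) /= => e_es.
apply: (IH _ _ _ run2) => // z z_vis.
have e_cand := sub e (mem_head _ _).
have e_in : in_range s e by move: e_cand; rewrite mem_candidates // => /andP[].
have [_ [_ [_ vb]]] := visited_bound clos.
have: z \in vis ++ pos L.
  apply: (vb _ _ _ _ _ _ run1) z_vis => // u; rewrite (perm_mem p_us).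
    by rewrite mem_affecting // => /andP[].
  move=> u_aff st_w; apply: (sibs _ (mem_head _ _) ne nf' perm').
  exact: mem_subtargets.
by rewrite mem_cat => /orP[/vis_sub//|zL]; rewrite mem_cat zL orbT.
Qed.

(** Induction on the fuel. [P] bounds the blocks visited so far and grows by the closures of
    whatever may be tried before the certified candidate or the certified subtarget. *)
Lemma must_sound n k P x vf vis res vis' :
  must_erase n Z k P (x, vf) -> {subset vis <= P} -> in_range s x ->
  erasable tau s x vf vis res vis' -> res <> None.
Proof.
elim: k P x vf vis res vis' => // k IH P x vf vis res vis' /=.
rewrite has_lazyE => /hasP[[d vE] c_mem /=].
case: ifP => // /negbT eT; case: ifP => // clos; set L := reach _ _ _ _ _ _ _ _ _ _ in clos *.
case: ifP => // /negbT; rewrite inE mem_cat !negb_or => /and3P[ex eP eL].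
rewrite all_lazyE => /allP eff vis_sub x_in run.
have e_in := line_candidates_in_range x_in c_mem.
have := c_mem; rewrite mem_line_candidates // => /and5P[ne same e_id nf perm].
have eD : vE \notin D by apply: contraNN eT; apply: (env_D ok).
have e_cand : vE \in candidates s d x.
  by rewrite mem_candidates // ne same env_stat // (negPf eD) e_in.
have sibs d' vE' : vE' \in candidates s d' x -> (d', vE') != (d, vE) -> Some vE' != vf ->
    permissible tau s d' vE' x -> {subset subtargets Z x (d', vE') <= L}.
  move=> e'_cand ne' nf' perm' y y_sub; apply: sub_iter_grow; apply/flatten_mapP; exists (d', vE') => //.
  by rewrite mem_filter ne'; apply: candidate_mem.
have clear us vis0 res0 vis1 : perm_eq us (affecting s d vE) -> {subset vis0 <= (x :: P) ++ pos L} ->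
    clear_effects tau s d x us vis0 res0 vis1 -> res0 <> None.
  move=> p_us sub0 run0.
  pose L_ u := reach st0 pm row_nonzero row_identity col_nonzero col_identity T n Z
    [seq y <- subtargets Z x (d, vE) | y != (affected d x u, Some u)].
  apply: (clear_must (P1 := (x :: P) ++ pos L) (L_ := L_) run0 x_in e_cand).
  - by move=> u; rewrite (perm_mem p_us).
  - by rewrite (perm_uniq p_us) affecting_uniq.
  - move=> u; rewrite (perm_mem p_us) => u_aff.
    have u_in : in_range s u by move: u_aff; rewrite mem_affecting // => /andP[].
    have w_in := affected_in_range d x_in u_in.
    have u_nz : is_nonzero (stat s u) by move: u_aff; rewrite mem_affecting // => /and4P[].
    have [uD _] := stat_nonzero u_in u_nz.
    have := eff _ (mem_effects x e_in u_aff); rewrite /= (negPf (contraNN (Z_D (x := u)) uD)).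
    case: ifP => // /negbT w_id; rewrite -/(L_ u); case: ifP => // clos_u.
    case: ifP => // /negbT w_new w_must; split=> //.
    + move=> u' u'_aff ne' st_w; apply: sub_iter_grow; rewrite mem_filter mem_subtargets // andbT.
      by apply: contraNneq ne' => -[_ ->].
    + rewrite env_stat //; case: ifP => // /negbT wD; apply: contraNN w_id => -> /=.
      by apply: contraNN wD; apply: Z_D.
    + move=> st_w vis2 res2 vis3 sub2 run2; move: w_must; rewrite zero_maybe // => w_must.
      by apply: IH w_must _ w_in run2 => z /sub2.
  - by move=> u _ z /sub0; rewrite !mem_cat => ->.
have new : vE \notin (x :: P) ++ pos L by rewrite mem_cat inE !negb_or ex eP.
have vis_sub2 : {subset x :: vis <= (x :: P) ++ pos L}.
  by move=> z; rewrite !inE mem_cat => /predU1P[->|/vis_sub ->]; rewrite ?eqxx ?orbT.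
have by_must vis0 res0 vis1 : {subset x :: vis0 <= (x :: P) ++ pos L} ->
    erasable_by tau s d x vf vis0 res0 vis1 -> res0 <> None.
  move=> sub0 run0; inversion run0; subst.
  apply: (try_must (vE := vE) H0) clear sub0 => // [e||e].
  - by rewrite (perm_mem H).
  - by rewrite (perm_mem H).
  rewrite (perm_mem H) => e_cand' ne' nf' perm'; apply: sibs => //.
  by apply: contraNneq ne' => -[->].
inversion run; subst => //.
case: (d) sibs by_must => sibs by_must; first by case: (by_must _ _ _ vis_sub2 H).
(* In column mode a failed row search comes first. Its candidates count among those other than [c],
   so [L] bounds what it visits. *)
apply: (by_must _ _ _ _ H0) => z; rewrite inE mem_cat => /predU1P[->|]; first by rewrite mem_head.
inversion H; subst.
have [_ [_ [vb _]]] := visited_bound clos.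
move=> z_vis; have: z \in (x :: vis) ++ pos L.
  apply: (vb _ _ _ _ _ _ _ H2) z_vis => // [e|e]; first by rewrite (perm_mem H1).
  by rewrite (perm_mem H1) => e_cand' nf' perm'; apply: sibs.
by rewrite mem_cat => /orP[/vis_sub2|->]; rewrite ?mem_cat ?orbT.
Qed.

End Environment.

Lemma count_notin_cons (T : eqType) (l vis : seq T) x : x \in l -> x \notin vis ->
  (count (fun v => v \notin x :: vis) l < count (fun v => v \notin vis) l)%N.
Proof.
move=> x_in nx; elim: l x_in => //= y l IH.
rewrite inE => /predU1P[<-|/IH lt_l].
  rewrite mem_head nx /= add0n add1n ltnS.
  by apply: sub_count => v; apply: contraNN; rewrite inE => ->; rewrite orbT.
by rewrite -addnS leq_add // inE negb_or; case: (y \notin vis); rewrite ?andbF //; case: eqP.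
Qed.

(** * Termination of ERASABLE *)

Section Totality.
Variables (K : fieldType) (m : nat) (tau : 'I_m -> direction) (R C : nat).
Variable s : block_matrix K m R C.

Definition all_positions : seq position :=
  [seq (i, j) | i <- iota 0 (size (rows s)), j <- iota 0 (size (cols s))].

Definition unvisited (vis : seq position) : nat := count (fun v => v \notin vis) all_positions.

Lemma mem_all_positions v : (v \in all_positions) = in_range s v.
Proof.
apply/allpairsP/andP => [[[i j] /= []]|[v1 v2]]; first by rewrite !mem_iota => i1 j1 ->.
by exists v; rewrite !mem_iota v1 v2; case: v {v1 v2}.
Qed.

Lemma unvisited_mono vis vis' : {subset vis <= vis'} -> (unvisited vis' <= unvisited vis)%N.
Proof. by move=> sub; apply: sub_count => v; apply/contraNN/sub. Qed.

Lemma unvisited_cons x vis : in_range s x -> x \notin vis -> (unvisited (x :: vis) < unvisited vis)%N.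
Proof. by rewrite -mem_all_positions; apply: count_notin_cons. Qed.

(** A target is new when it is called, so the number of unvisited blocks decreases with the depth of
    recursion. *)
Lemma erasable_total x vf vis : in_range s x -> x \notin vis ->
  exists res vis', erasable tau s x vf vis res vis'.
Proof.
have [n] := ubnP (unvisited vis).
elim: n x vf vis => // n IH x vf vis; rewrite ltnS => le_n x_in nx.
have clear d us vis0 : {subset us <= in_range s} -> (unvisited vis0 < n)%N ->
    exists res vis', clear_effects tau s d x us vis0 res vis'.
  elim: us vis0 => [|u us IHu] vis0 sub lt_n; first by exists (Some [::]), vis0; apply: Clear_nil.
  have sub' : {subset us <= in_range s} by move=> v vs; apply: sub; rewrite inE vs orbT.
  have w_in := affected_in_range d x_in (sub u (mem_head _ _)).
  have [w_bl|] := boolP ((affected d x u \in vis0) || is_identity (stat s (affected d x u))).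
    by exists None, vis0; apply: Clear_blocked.
  rewrite negb_or => /andP[nw n_id]; case st_w: (stat s (affected d x u)) (n_id) => // _.
  - by have [res [vis' run]] := IHu vis0 sub' lt_n; exists res, vis'; apply: Clear_harmless; auto.
  - by have [res [vis' run]] := IHu vis0 sub' lt_n; exists res, vis'; apply: Clear_harmless; auto.
  have [[p|] [vis' run]] := IH _ (Some u) vis0 lt_n w_in nw; last first.
    by exists None, vis'; apply: Clear_null.
  have [mono _] := visited_mono tau s.
  have [|res [vis2 run2]] := IHu vis' sub'.
    apply: leq_ltn_trans lt_n; apply: unvisited_mono => v v0; apply: (mono _ _ _ _ _ run).
    by rewrite inE v0 orbT.
  by exists (omap (cons p) res), vis2; apply: Clear_subtree run run2.
have try_all d es vis0 : {subset es <= candidates s d x} -> (unvisited vis0 < n)%N ->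
    exists res vis', try_candidates tau s d x vf es vis0 res vis'.
  elim: es vis0 => [|vE es IHe] vis0 sub lt_n; first by exists None, vis0; apply: Try_none.
  have sub' : {subset es <= candidates s d x} by move=> v vs; apply: sub; rewrite inE vs orbT.
  have [skip|] := boolP ([|| vE \in vis0, Some vE == vf | ~~ permissible tau s d vE x]).
    by have [res [vis' run]] := IHe vis0 sub' lt_n; exists res, vis'; apply: Try_skip.
  rewrite !negb_or negbK => use.
  have e_in : in_range s vE by have := sub _ (mem_head _ _); rewrite mem_candidates // => /andP[].
  have [|[ps|] [vis' run]] := clear d (affecting s d vE) vis0 _ lt_n.
  - by move=> u; rewrite mem_affecting // => /andP[].
  - by exists (Some (Process d x vE ps)), vis'; apply: Try_usable run.
  have [_ [_ [_ mono]]] := visited_mono tau s.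
  have [|res [vis2 run2]] := IHe vis' sub'.
    by apply: leq_ltn_trans lt_n; apply: unvisited_mono; apply: mono run.
  by exists res, vis2; apply: Try_unusable run run2.
have by_mode d vis0 : (unvisited (x :: vis0) < n)%N ->
    exists res vis', erasable_by tau s d x vf vis0 res vis'.
  move=> lt_n; have [|res [vis' run]] := try_all d (candidates s d x) (x :: vis0) _ lt_n; first by [].
  by exists res, vis'; apply: Erasable_by run.
have lt_n : (unvisited (x :: vis) < n)%N := leq_trans (unvisited_cons x_in nx) le_n.
have [[p|] [vis' run]] := by_mode Row_mode vis lt_n; first by exists (Some p), vis'; apply: Erasable_row.
have [_ [mono _]] := visited_mono tau s.
have [|res [vis2 run2]] := by_mode Col_mode vis'.
  apply: leq_ltn_trans lt_n; apply: unvisited_mono => v v_in; rewrite inE orbC.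
  by rewrite (mono _ _ _ _ _ _ run v v_in).
by exists res, vis2; apply: Erasable_col run run2.
Qed.

End Totality.

(** * Traversal of process trees *)

Scheme valid_ind' := Minimality for valid Sort Prop
with valid_all_ind' := Minimality for valid_all Sort Prop.
Combined Scheme valid_mut from valid_ind', valid_all_ind'.

Section Traversal.
Variables (K : fieldType) (m : nat) (tau : 'I_m -> direction) (R C : nat).
Variable s : block_matrix K m R C.
Variables (st0 : position -> status) (pm : mode -> position -> position -> bool).
Variables (row_nonzero row_identity col_nonzero col_identity : nat -> seq nat).
Variables T D : seq position.
Hypothesis ok : env_ok tau s st0 pm row_nonzero row_identity col_nonzero col_identity T D.

Local Notation may_erase := (may_erase st0 pm row_nonzero row_identity col_nonzero col_identity T).
Local Notation may_use := (may_use st0 pm row_nonzero row_identity col_nonzero col_identity T).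
Local Notation line_candidates := (line_candidates pm row_identity col_identity).
Local Notation effects := (effects row_nonzero col_nonzero).
Local Notation subtargets := (subtargets st0 row_nonzero col_nonzero T).
Local Notation maybe_zero := (maybe_zero st0 T).
Local Notation pos L := [seq y.1 | y : target <- L].

Variable t : position.

Lemma valid_allP d x us ps : valid_all tau s t d x us ps -> forall u, u \in us ->
  affected d x u != t /\
  (stat s (affected d x u) = Unprocessed \/ stat s (affected d x u) = Strongly_zero \/
   stat s (affected d x u) = Zero /\ exists p, valid tau s t (affected d x u, Some u) p).
Proof.
elim=> {d x us ps} [//|d x u us ps wt st_w _ IH|d x u us p ps wt st_w v _ IH] u'; rewrite inE => /predU1P[->|/IH//].
  by split=> //; case: st_w; auto.
by split=> //; right; right; split=> //; exists p.
Qed.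

(** A valid tree satisfies [may_erase] with any fuel: blocks outside [T] keep their initial
    statuses, and the effects of blocks in [T] are disregarded by the test. *)
Lemma valid_may :
  (forall x p, valid tau s t x p -> in_range s x.1 -> forall n, may_erase n x) /\
  (forall d x us ps, valid_all tau s t d x us ps -> in_range s x -> forall vE, vE \in candidates s d x ->
     {subset us <= affecting s d vE} -> forall n u, u \in us ->
     if is_identity (st0 (affected d x u)) then affected d x u \in T else
     if is_zero (st0 (affected d x u)) then may_erase n (affected d x u, Some u) else true).
Proof.
apply: valid_mut.
- move=> d x vf vE us ps e_cand perm nf et p_us _ IH /= x_in [//|n]; rewrite may_eraseS; apply/hasP; exists (d, vE); first exact: (candidate_mem ok).
  have e_in : in_range s vE by move: e_cand; rewrite mem_candidates // => /andP[].
  rewrite /may_use all_lazyE; apply/allP => e /(effects_cases ok e_in)[u_in -> uD].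
  case: ifP => // /negbT uT; move: uD; rewrite (negPf (contraNN (env_D ok (x := e.1)) uT)) /= => u_aff.
  apply: (IH x_in vE e_cand) => [u|]; by rewrite (perm_mem p_us).
- by [].
- move=> d x u us ps wt st_w _ IH x_in vE e_cand sub n u'; rewrite inE => /predU1P[->|u'_us]; last first.
    by apply: (IH x_in vE e_cand) => // v vs; apply: sub; rewrite inE vs orbT.
  have e_in : in_range s vE by move: e_cand; rewrite mem_candidates // => /andP[].
  have u_in : in_range s u by have := sub u (mem_head _ _); rewrite mem_affecting // => /andP[].
  have := env_stat ok (affected_in_range d x_in u_in); case: ifP => [_|_ <-]; first by case: st_w => ->.
  by case: st_w => ->.
- move=> d x u us p ps wt st_w _ IH1 _ IH2 x_in vE e_cand sub n u'; rewrite inE => /predU1P[->|u'_us]; last first.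
    by apply: (IH2 x_in vE e_cand) => // v vs; apply: sub; rewrite inE vs orbT.
  have e_in : in_range s vE by move: e_cand; rewrite mem_candidates // => /andP[].
  have u_in : in_range s u by have := sub u (mem_head _ _); rewrite mem_affecting // => /andP[].
  have w_in := affected_in_range d x_in u_in.
  rewrite IH1 // if_same; have := env_stat ok w_in; rewrite st_w.
  by case: ifP => [/(env_D ok) -> _|_ <-]; rewrite ?if_same.
Qed.

Local Notation tree_candidates := (tree_candidates st0 pm row_nonzero row_identity col_nonzero col_identity T).
Local Notation tree_closed := (tree_closed st0 pm row_nonzero row_identity col_nonzero col_identity T).
Local Notation tree_lines_clean := (tree_lines_clean st0 pm row_nonzero row_identity col_nonzero col_identity T).

Variables (n : nat) (L : seq target).
Hypotheses (L_closed : tree_closed n t L) (L_clean : tree_lines_clean n t L).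
Hypotheses (t_in : in_range s t) (t_nz : is_nonzero (stat s t)).
Hypothesis s_strongly_zero : forall v, in_range s v -> stat s v = Strongly_zero -> strongly_zero tau s v.
Hypotheses (sR : total_size (rows s) = R) (sC : total_size (cols s) = C).

(* The blocks in W are side effects that are still to be erased; until then they may fail to
   agree with their status. *)
Record consistent (A : 'M[K]_(R, C)) (W : seq position) : Prop := Consistent {
  cons_masked : masked tau s A;
  cons_iso : isomorphic (block_arrow tau s) (block_arrow tau (set_mat s A));
  cons_agrees : forall v, in_range s v -> v \notin W -> v != t -> agrees s A v (stat s v);
  cons_W : forall v, v \in W -> [/\ v != t, v \in pos L & stat s v = Zero] }.

Definition waiting d x us : seq position :=
  [seq affected d x u | u <- us & is_zero (stat s (affected d x u))].

Section Root.
Variables (d : mode) (x : position) (vf : option position) (vE : position) (us : seq position) (ps : seq process_tree).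
Hypotheses (e_cand : vE \in candidates s d x) (perm : permissible tau s d vE x).
Hypotheses (nf : Some vE != vf) (et : vE != t) (p_us : perm_eq us (affecting s d vE)).
Hypotheses (all_us : valid_all tau s t d x us ps) (x_in : in_range s x) (xL : (x, vf) \in L).

Let e_in : in_range s vE. Proof. by move: e_cand; rewrite mem_candidates // => /andP[]. Qed.
Let e_id : stat s vE = Identity.
Proof. by move: e_cand; rewrite mem_candidates // => /and4P[_ _ _]; case: (stat s vE). Qed.
Let e_line : ~~ same_line d x vE /\ same_line (if d is Row_mode then Col_mode else Row_mode) x vE.
Proof. by move: e_cand; rewrite mem_candidates // => /and4P[_ -> ->]. Qed.

Lemma root_candidate : (d, vE) \in tree_candidates n t (x, vf).
Proof.
rewrite mem_filter et (candidate_mem ok x_in e_cand nf perm) andbT /=.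
rewrite /may_use all_lazyE; apply/allP => e /(effects_cases ok e_in)[u_in -> uD].
case: ifP => // /negbT uT; move: uD; rewrite (negPf (contraNN (env_D ok (x := e.1)) uT)) /= => u_aff.
have [_ h] := valid_may; apply: (h _ _ _ _ all_us x_in vE e_cand) => [u|]; by rewrite (perm_mem p_us).
Qed.

Lemma subtree_in u : u \in us -> stat s (affected d x u) = Zero -> (affected d x u, Some u) \in L.
Proof.
move=> u_us st_w; have [wt w_cases] := valid_allP all_us u_us.
have u_aff : u \in affecting s d vE by rewrite -(perm_mem p_us).
have u_in : in_range s u by move: u_aff; rewrite mem_affecting // => /andP[].
have w_in := affected_in_range d x_in u_in.
have [p v_p] : exists p, valid tau s t (affected d x u, Some u) p.
  by case: w_cases => [|[|[_ //]]]; rewrite st_w.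
have /andP[_ /allP/(_ _ xL)/allP H] := L_closed; apply: H.
have [may _] := valid_may; rewrite mem_filter /= wt (may _ _ v_p) // andbT /=.
apply/flatten_mapP; exists (d, vE); first exact: root_candidate.
have sub0 : {subset [::] <= D} by [].
exact: (mem_subtargets ok sub0).
Qed.

Lemma waiting_ok v : v \in waiting d x us -> [/\ v != t, v \in pos L & stat s v = Zero].
Proof.
move=> /mapP[u]; rewrite mem_filter => /andP[st_w u_us] ->.
have st_w' : stat s (affected d x u) = Zero by case: (stat s _) st_w.
have [wt _] := valid_allP all_us u_us; split=> //.
by apply/mapP; exists (affected d x u, Some u) => //; apply: subtree_in.
Qed.

Lemma root_clean v : v \in pos L -> v != t -> ~~ same_line d v vE.
Proof.
move=> /mapP[y yL ->] yt; have /allP/(_ _ xL)/allP/(_ _ root_candidate)/allP/(_ _ yL) := L_clean.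
by rewrite (negPf yt).
Qed.

Lemma add_effect A A' : masked tau s A -> add_multiples tau s d vE x A A' ->
  [/\ masked tau s A', isomorphic (block_arrow tau (set_mat s A)) (block_arrow tau (set_mat s A'))
    & forall v, ~~ same_line d v x \/ blk s A (affected d vE v) = 0%R -> blk s A' v = blk s A v].
Proof.
case: (d) perm e_line => perm' [/= ne eq] mA add.
  by apply: add_rows_effect add perm' _; rewrite // eq_sym.
by apply: add_cols_effect add perm' _; rewrite // eq_sym.
Qed.

Lemma add_exists A : identity_block s A vE ->
  exists2 A', add_multiples tau s d vE x A A' & zero_block s A' x.
Proof.
case: (d) e_line => -[/= ne /eqP eq] id_E; first exact: add_rows_exists.
exact: add_cols_exists.
Qed.

Section Operation.
Variables (A : 'M[K]_(R, C)) (W : seq position).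
Hypotheses (A_ok : consistent A (x :: W) \/ x = t /\ consistent A W).

Let A_masked : masked tau s A. Proof. by case: A_ok => [[]|[_ []]]. Qed.

Let A_W v : v \in W -> [/\ v != t, v \in pos L & stat s v = Zero].
Proof. by case: A_ok => [H vW|[_ H]]; [apply: (cons_W H); rewrite inE vW orbT|exact: cons_W H v]. Qed.

Let A_agrees v : in_range s v -> v \notin W -> v != t -> v != x -> agrees s A v (stat s v).
Proof.
case: A_ok => [H v_in vW vt vx|[_ H] v_in vW vt _]; last exact: cons_agrees H v v_in vW vt.
by apply: (cons_agrees H) => //; rewrite inE negb_or vx.
Qed.

Lemma root_identity : identity_block s A vE.
Proof.
have := A_agrees e_in _ et; rewrite e_id; apply.
  by apply/negP=> /A_W[_ _]; rewrite e_id.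
by apply: contraNneq e_line.1 => ->; case: (d) => /=.
Qed.

(** A block of status 0 can differ from zero only while it is pending, and clean trees have no
    pending block in the line of [vE]. *)
Lemma line_zero u : in_range s u -> same_line d u vE -> u != vE -> u \notin affecting s d vE -> blk s A u = 0%R.
Proof.
move=> u_in same ne; rewrite mem_affecting // u_in same ne /= => u_z.
have ut : u != t by apply: contraNneq u_z => ->.
have uW : u \notin W.
  by apply/negP => /A_W[_ uL _]; move: same; apply/negP; apply: root_clean.
have ux : u != x by apply: contraTneq same => ->; exact: e_line.1.
have := A_agrees u_in uW ut ux; case st_u: (stat s u) u_z => //= _; last by move/zero_blockP; apply.
by move=> _; exact: (masked_strongly_zero sR sC A_masked (s_strongly_zero u_in st_u)).
Qed.

(** The target [x] leaves the pending set and the affected blocks of status 0 enter it. The root [t]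
    never belongs to this set, as its status is still nonzero; it is tracked separately. *)
Lemma operation_effect A' : add_multiples tau s d vE x A A' -> zero_block s A' x ->
  (x != t -> zero_block s A t) -> consistent A' (waiting d x us ++ W) /\ zero_block s A' t.
Proof.
move=> add zx zt; have [mA' isoA' eqA'] := add_effect A_masked add.
(* A block changes only if it is affected by a nonzero block in the line of vE. *)
have same v : in_range s v -> v != x -> (forall u, u \in us -> v != affected d x u) -> blk s A' v = blk s A v.
  move=> v_in vx v_aff; apply: eqA'.
  have /orP[same|] := orbN (same_line d v x); last by left.
  right; apply: line_zero.
  - exact: affected_in_range.
  - by case: (d) => /=.
  - apply: contraNneq vx; case: e_line; case: (d) same => /= /eqP sv _ /eqP ex; case: v vE sv ex {v_in v_aff}.
      by move=> v1 v2 [e1 e2] /= -> <- [->]; case: (x).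
    by move=> v1 v2 [e1 e2] /= -> <- [->]; case: (x).
  apply/negP; rewrite -(perm_mem p_us) => /v_aff; case: (d) same => /= /eqP <-; case: (v) => v1 v2 /=; by rewrite eqxx.
have tt : zero_block s A' t.
  have [<-//|xt] := eqVneq x t.
  apply: (zero_block_same sR sC _ (zt xt)); apply: esym; apply: same => //; first by rewrite eq_sym.
  by move=> u /(valid_allP all_us)[wt _]; rewrite eq_sym.
split=> //; split=> //.
- apply: isomorphic_trans isoA'; case: A_ok => [[]|[_ []]]; by [].
- move=> v v_in; rewrite mem_cat negb_or => /andP[v_w vW] vt.
  have [vx_E|vx] := eqVneq v x; first rewrite vx_E.
    case: A_ok => [H|[E _]]; last by move: vt; rewrite vx_E E eqxx.
    by have [_ _ ->] := cons_W H (mem_head x W).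
  have [/mapP[u u_us v_u]|nw] := boolP (v \in [seq affected d x u | u <- us]).
    have [_ w_st] := valid_allP all_us u_us; move: w_st; rewrite -v_u => -[|[|[st_w _]]].
    - by move=> ->.
    - by move=> ->.
    by case/negP: v_w; rewrite v_u; apply: map_f; rewrite mem_filter -v_u st_w.
  have E : blk s A v = blk s A' v.
    by apply: esym; apply: same => // u u_us; apply: contraNneq nw => ->; apply: map_f.
  have := A_agrees v_in vW vt vx.
  by case: (stat s v) => //=; [exact: (identity_block_same sR sC E)|exact: (zero_block_same sR sC E)].
- by move=> v; rewrite mem_cat => /orP[/waiting_ok|/A_W].
Qed.

End Operation.
End Root.

Lemma process_inv d x vE ps A A'' : process tau s (Process d x vE ps) A A'' ->
  exists A', [/\ add_multiples tau s d vE x A A', zero_block s A' x & process_all tau s ps A' A''].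
Proof. by move=> run; inversion run; subst; exists A'. Qed.

Lemma process_all_inv p ps A A'' : process_all tau s (p :: ps) A A'' ->
  exists A', process tau s p A A' /\ process_all tau s ps A' A''.
Proof. by move=> run; inversion run; subst; exists A'. Qed.

(** The pending blocks behave as a stack: processing a subtree removes its root and leaves the rest
    [W] as it was. Existence of a run and correctness of every run are proved together, because the
    next operation exists only in a consistent state. *)
Lemma process_effect :
  (forall x p, valid tau s t x p -> in_range s x.1 -> x \in L -> forall A W,
     consistent A (x.1 :: W) \/ x.1 = t /\ consistent A W -> (x.1 != t -> zero_block s A t) ->
     (exists A', process tau s p A A') /\
     forall A', process tau s p A A' -> consistent A' W /\ zero_block s A' t) /\
  (forall d x us ps, valid_all tau s t d x us ps -> in_range s x ->
     (forall u, u \in us -> in_range s u) ->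
     (forall u, u \in us -> stat s (affected d x u) = Zero -> (affected d x u, Some u) \in L) ->
     forall A W, consistent A (waiting d x us ++ W) -> zero_block s A t ->
     (exists A', process_all tau s ps A A') /\
     forall A', process_all tau s ps A A' -> consistent A' W /\ zero_block s A' t).
Proof.
apply: valid_mut.
- move=> d x vf vE us ps e_cand perm nf et p_us all_us IH /= x_in xL A W A_ok zt.
  have op A' := operation_effect e_cand perm nf et p_us all_us x_in xL A_ok (A' := A').
  have e_in : in_range s vE by move: e_cand; rewrite mem_candidates // => /andP[].
  have us_in u : u \in us -> in_range s u.
    by rewrite (perm_mem p_us) mem_affecting // => /andP[].
  have us_L := subtree_in e_cand perm nf et p_us all_us x_in xL.
  have id_E := root_identity e_cand et x_in A_ok.
  split.
    have [A' add zx] := add_exists e_cand x_in id_E.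
    have [A'_ok zt'] := op A' add zx zt.
    have [[A'' run] _] := IH x_in us_in us_L _ _ A'_ok zt'.
    by exists A''; apply: Process_root run.
  move=> A'' /process_inv[A' [add zx run]].
  have [A'_ok zt'] := op _ add zx zt.
  by have [_] := IH x_in us_in us_L _ _ A'_ok zt'; apply.
- move=> d x x_in _ _ A W A_ok zt; split; first by exists A; apply: Process_nil.
  by move=> A' run; inversion run; subst.
- move=> d x u us ps wt st_w _ IH x_in us_in us_L A W A_ok zt.
  apply: IH => // [v vs|v vs|]; [by apply: us_in; rewrite inE vs orbT|by apply: us_L; rewrite inE vs orbT|].
  move: A_ok; rewrite /waiting /=.
  by case: st_w => ->.
- move=> d x u us p ps wt st_w _ IH1 _ IH2 x_in us_in us_L A W A_ok zt.
  have w_in := affected_in_range d x_in (us_in u (mem_head _ _)).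
  have wL := us_L u (mem_head _ _) st_w.
  have us_in' v : v \in us -> _ := fun vs => us_in v (mem_behead (s := u :: us) vs).
  have us_L' v : v \in us -> _ := fun vs => us_L v (mem_behead (s := u :: us) vs).
  have A_ok' : consistent A (affected d x u :: waiting d x us ++ W).
    by move: A_ok; rewrite /waiting /= st_w.
  have [ex1 all1] := IH1 w_in wL A _ (or_introl A_ok') (fun _ => zt).
  split=> [|A'' /process_all_inv[A' [run1 run2]]].
    have [A' run1] := ex1; have [A'_ok zt'] := all1 _ run1.
    have [[A'' run2] _] := IH2 x_in us_in' us_L' _ _ A'_ok zt'.
    by exists A''; apply: Process_cons run1 run2.
  have [A'_ok zt'] := all1 _ run1.
  by have [_] := IH2 x_in us_in' us_L' _ _ A'_ok zt'; apply.
Qed.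

End Traversal.

(** * The set of blocks erased in one phase *)

Section ErasingPhase.
Variables (K : fieldType) (m : nat) (tau : 'I_m -> direction) (R C : nat).
Variable s : block_matrix K m R C.
Variables (st0 : position -> status) (pm : mode -> position -> position -> bool).
Variables (row_nonzero row_identity col_nonzero col_identity : nat -> seq nat).
Variables T D nonzeros : seq position.
Variable n : nat.
Hypothesis ok : env_ok tau s st0 pm row_nonzero row_identity col_nonzero col_identity T D.
Hypothesis mem_nonzeros : forall v, (v \in nonzeros) = in_range s v && is_nonzero (st0 v).
Hypothesis T_ok : erasure_ok st0 pm row_nonzero row_identity col_nonzero col_identity T n nonzeros.
Hypothesis s_strongly_zero : forall v, in_range s v -> stat s v = Strongly_zero -> strongly_zero tau s v.
Hypotheses (sR : total_size (rows s) = R) (sC : total_size (cols s) = C).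
Hypothesis s_masked : masked tau s (mat s).
Hypothesis s_agrees : forall v, in_range s v -> agrees s (mat s) v (stat s v).

Lemma erased_in v : v \in T -> in_range s v && is_nonzero (st0 v).
Proof. by have /and4P[_ /allP h _ _] := T_ok => /h; rewrite -mem_nonzeros. Qed.

Lemma run_in_T t p vis : in_range s t -> is_nonzero (stat s t) ->
  erasable tau s t None [::] (Some p) vis -> t \in T.
Proof.
move=> t_in t_nz run; have /and4P[/allP h _ _ _] := T_ok.
have [_ st_t] := stat_nonzero ok t_in t_nz.
have := h t; rewrite mem_nonzeros t_in st_t t_nz => /(_ isT); case: ifP => // _ /negP[].
have [val _] := run_valid tau s t; have [may _] := valid_may ok t.
by apply: (may (t, None) p) => //; apply: (val _ _ _ _ _ run) => //; apply: mem_head.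
Qed.

Lemma run_effect t p vis : in_range s t -> is_nonzero (stat s t) ->
  erasable tau s t None [::] (Some p) vis ->
  (exists A, process tau s p (mat s) A) /\
  forall A, process tau s p (mat s) A ->
  [/\ masked tau s A, isomorphic (block_arrow tau s) (block_arrow tau (set_mat s A)),
      forall v, in_range s v -> v != t -> agrees s A v (stat s v) & zero_block s A t].
Proof.
move=> t_in t_nz run; have tT := run_in_T t_in t_nz run.
have /and4P[_ _ /allP/(_ _ tT) tree _] := T_ok; move: tree; rewrite /tree_ok.
set L := iter _ _ _; case: ifP => // L_closed L_clean.
have [val _] := run_valid tau s t.
have t_val : valid tau s t (t, None) p by apply: (val _ _ _ _ _ run) => //; apply: mem_head.
have [eff _] := process_effect ok L_closed L_clean t_in t_nz s_strongly_zero sR sC.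
have tL : (t, None) \in L by have /andP[] := L_closed.
have start : consistent tau s t L (mat s) [::].
  split=> // [|v v_in _ _]; last exact: s_agrees.
  by case: s => *; apply: isomorphic_refl.
have [|ex all_A] := eff _ _ t_val t_in tL (mat s) [::] (or_intror (conj erefl start)).
  by rewrite eqxx.
by split=> // A /all_A[[? ? ag _] z]; split=> // v v_in vt; apply: ag.
Qed.

(** Every search for this [t] succeeds, so the phase cannot be left before [T] is exhausted. *)
Lemma next_erasable : (exists2 v, v \in T & v \notin D) -> exists t,
  [/\ in_range s t, is_nonzero (stat s t)
    & forall res vis, erasable tau s t None [::] res vis -> res <> None].
Proof.
have /and4P[_ _ _ ord] := T_ok => ex.
have sub0 : {subset [::] <= D} by [].
have [Z [t [ZD tT tD must]]] := must_order_next ord sub0 ex.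
have /andP[t_in t_nz] := erased_in tT.
exists t; split=> // [|res vis run]; first by rewrite (env_stat ok) // (negPf tD).
by apply: (must_sound ok ZD must _ _ run).
Qed.

Lemma none_erasable : {subset T <= D} -> forall t, in_range s t -> is_nonzero (stat s t) ->
  exists vis, erasable tau s t None [::] None vis.
Proof.
move=> TD t t_in t_nz; have [[p|] [vis run]] := erasable_total tau None t_in (vis := [::]) isT.
  have [tD _] := stat_nonzero ok t_in t_nz.
  by move: tD; rewrite (TD _ (run_in_T t_in t_nz run)).
by exists vis.
Qed.

End ErasingPhase.

(** * Statuses as finite data *)

(** Labels and statuses without sizes and entries, hence independent of the field and of the module;
    a round of the main loop acts on them as a function. *)
Record board := Board {
  board_rows : seq (nat * nat); board_cols : seq (nat * nat); board_stat : seq (seq status) }.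

Definition board_status (b : board) (v : position) : status :=
  nth Strongly_zero (nth [::] (board_stat b) v.1) v.2.

Fixpoint positions_from (p : pred status) (k : nat) (row : seq status) : seq nat :=
  if row is x :: row' then
    if p x then k :: positions_from p k.+1 row' else positions_from p k.+1 row'
  else [::].

Lemma mem_positions_from p k row i :
  (i \in positions_from p k row) = (k <= i < k + size row)%N && p (nth Strongly_zero row (i - k)).
Proof.
elim: row k => [|x row IH] k /=; first by rewrite in_nil; apply/esym/negbTE; lia.
have -> : (i \in (if p x then k :: positions_from p k.+1 row else positions_from p k.+1 row)) =
  (i == k) && p x || (i \in positions_from p k.+1 row).
  by case: ifP; rewrite ?inE ?andbT ?andbF.
rewrite IH; have [->|ne] := eqVneq i k; first by rewrite subnn /= ltnn /= orbF leqnn addnS ltnS leq_addr.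
have [lt_k|le_k] := ltnP k i; last by rewrite /= leqNgt ltn_neqAle ne le_k.
by rewrite /= (ltnW lt_k) addnS addSn -(subnSK lt_k).
Qed.

Definition transposed (n : nat) (t : seq (seq status)) : seq (seq status) :=
  foldr (fun row acc => [seq x.1 :: x.2 | x <- zip row acc]) (nseq n [::]) t.

Lemma size_transposed n t : all (fun row => size row == n) t -> size (transposed n t) = n.
Proof.
elim: t => [|row t IH] /=; first by rewrite size_nseq.
by case/andP=> /eqP row_n /IH t_n; rewrite size_map size_zip t_n row_n minnn.
Qed.

Lemma size_nth_transposed n t j : all (fun row => size row == n) t -> (j < n)%N ->
  size (nth [::] (transposed n t) j) = size t.
Proof.
move=> t_n lt_j; elim: t t_n => [|row t IH] /=; first by rewrite nth_nseq lt_j.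
case/andP=> /eqP row_n t_n; have sz := size_transposed t_n.
rewrite (nth_map (Strongly_zero, [::])) ?size_zip ?sz ?row_n ?minnn //.
by rewrite nth_zip ?sz ?row_n //= IH.
Qed.

Lemma nth_transposed n t i j : all (fun row => size row == n) t -> (j < n)%N -> (i < size t)%N ->
  nth Strongly_zero (nth [::] (transposed n t) j) i = nth Strongly_zero (nth [::] t i) j.
Proof.
move=> t_n lt_j; elim: t i t_n => [//|row t IH] i /=.
case/andP=> /eqP row_n t_n; have sz := size_transposed t_n.
rewrite (nth_map (Strongly_zero, [::])) ?size_zip ?sz ?row_n ?minnn //.
by rewrite nth_zip ?sz ?row_n //=; case: i => [|i] //= lt_i; apply: IH.
Qed.

(** A partial application, so that the table is computed once and then only looked up. *)
Definition lines (p : pred status) (t : seq (seq status)) : nat -> seq nat :=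
  nth [::] [seq positions_from p 0 row | row <- t].

Lemma mem_lines p t i j : (j \in lines p t i) =
  [&& (i < size t)%N, (j < size (nth [::] t i))%N & p (nth Strongly_zero (nth [::] t i) j)].
Proof.
rewrite /lines; have [lt_i|le_i] := ltnP i (size t); last by rewrite nth_default ?size_map.
by rewrite (nth_map [::]) // mem_positions_from /= add0n subn0.
Qed.

Definition is_unprocessed (x : status) : bool := if x is Unprocessed then true else false.

Definition look (h : seq (nat * nat)) (i : nat) : option nat :=
  if [seq x.2 | x <- h & x.1 == i] is d :: _ then Some d else None.

Lemma look_mem h i d : look h i = Some d -> (i, d) \in h.
Proof.
rewrite /look; case E: [seq x.2 | x <- h & x.1 == i] => [//|e l] [<-].
have: e \in [seq x.2 | x <- h & x.1 == i] by rewrite E mem_head.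
case/mapP=> -[i' e'] /=; rewrite mem_filter /= => /andP[/eqP -> ih] ->.
exact: ih.
Qed.

Section Depth.
Variables (row_identity col_identity : nat -> seq nat).

Definition next_depth (next : nat -> seq nat) (h h' : seq (nat * nat)) : seq (nat * nat) :=
  foldl (fun h' x => if look h' x.1 then h' else x :: h') h'
    (flatten [seq [seq (j, x.2.+1) | j <- next x.1] | x <- h]).

(* Breadth first search along identity blocks from the row and the column of the pivot. *)
Definition depths (n : nat) (v : position) : seq (nat * nat) * seq (nat * nat) :=
  iter n (fun h => let hc := next_depth row_identity h.1 h.2 in (next_depth col_identity hc h.1, hc))
    ([:: (v.1, 0)], [:: (v.2, 0)]).

(** The certificate for [forest]: apart from its one parent, a line meets through identity blocks
    only lines one step farther from the pivot. *)
Definition depth_ok (next : nat -> seq nat) (root : nat) (h h' : seq (nat * nat)) : bool :=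
  (look h root == Some 0) &&
  all (fun x => let ds := [seq look h' j | j <- next x.1] in
     if x.2 is d.+1 then all (fun o => (o == Some d) || (o == Some d.+2)) ds && (count_mem (Some d) ds == 1)
     else (x.1 == root) && all (pred1 (Some 1)) ds) h.

End Depth.

(* h and h' are the depths of the lines in the two directions; as every line of positive depth
   has a unique parent, the fixing calls of a round never return to a line. *)
Record forest (next : nat -> seq nat) (root : nat) (h h' : nat -> option nat) : Prop := Forest {
  forest_root : h root = Some 0;
  forest_root_eq : forall i, h i = Some 0 -> i = root;
  forest_next : forall i j d, h i = Some d -> j \in next i ->
    h' j = Some d.+1 \/ (exists2 e, d = e.+1 & h' j = Some e);
  forest_parent : forall i d, h i = Some d.+1 -> exists2 j, j \in next i & h' j = Some d;
  forest_parent_eq : forall i j j' d, h i = Some d.+1 -> j \in next i -> j' \in next i ->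
    h' j = Some d -> h' j' = Some d -> j = j' }.

Lemma depth_forest next root h h' : depth_ok next root h h' -> forest next root (look h) (look h').
Proof.
case/andP=> /eqP root0 /allP ok.
have parent i d : look h i = Some d.+1 -> exists j0, [seq j <- next i | look h' j == Some d] = [:: j0].
  move=> /look_mem/ok /= /andP[_]; rewrite count_map -size_filter.
  by case: (filter _ _) => [|j0 [|//]] //= _; exists j0.
split=> //.
- by move=> i /look_mem/ok /= /andP[/eqP].
- move=> i j [|d] /look_mem/ok /= /andP[].
    by move=> _ /allP h1 jn; left; apply/eqP/h1/map_f.
  by move=> /allP h1 _ jn; case/orP: (h1 _ (map_f _ jn)) => /eqP E; [right; exists d|left].
- move=> i d /parent[j0 E]; exists j0; have: j0 \in [seq j <- next i | look h' j == Some d] by rewrite E mem_head.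
    by rewrite mem_filter => /andP[].
  by rewrite mem_filter => /andP[/eqP].
move=> i j j' d /parent[j0 E] jn jn' hj hj'.
have mem k : k \in next i -> look h' k = Some d -> k = j0.
  move=> kn hk; have: k \in [seq j <- next i | look h' j == Some d] by rewrite mem_filter hk eqxx.
  by rewrite E inE => /eqP.
by rewrite (mem j) // (mem j').
Qed.

Definition piece_status (is_pivot x y : bool) (z : status) : status :=
  if is_pivot then (if x || y then Zero else Identity)
  else if is_identity z then (if x == y then Identity else Zero) else z.

Definition dup (T : Type) (mask : seq bool) (s : seq T) : seq T :=
  flatten [seq if x.1 then [:: x.2; x.2] else [:: x.2] | x <- zip mask s].

Lemma dupE T (d : T) (S : pred nat) s :
  dup [seq S i | i <- iota 0 (size s)] s = [seq nth d s x.1 | x <- pieces S (size s)].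
Proof.
rewrite /dup /pieces map_flatten -map_comp -[X in zip _ X](mkseq_nth d) /mkseq zip_map -map_comp.
by congr flatten; apply: eq_map => i /=; case: (S i).
Qed.

Definition split_board (rmask cmask : seq bool) (v : position) (b : board) : board :=
  let pr := pieces (nth false rmask) (size rmask) in
  let pc := pieces (nth false cmask) (size cmask) in
  Board (dup rmask (board_rows b)) (dup cmask (board_cols b))
    [seq (let is_row := x.1.1 == v.1 in
       [seq piece_status (if is_row then y.1.1 == v.2 else false) x.1.2 y.1.2 y.2 | y <- zip pc (dup cmask x.2)])
    | x <- zip pr (dup rmask (board_stat b))].

Definition erase_board (T : seq position) (b : board) : board :=
  Board (board_rows b) (board_cols b)
    [seq [seq if is_nonzero y.2 then (if (x.1, y.1) \in T then Zero else y.2) else y.2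
         | y <- zip (iota 0 (size x.2)) x.2]
    | x <- zip (iota 0 (size (board_stat b))) (board_stat b)].

(** Approximates a greatest fixed point from above, as [may_erase] itself takes the set of erased
    blocks as an argument. *)
Fixpoint shrink (may : seq position -> position -> bool) (n : nat) (T : seq position) : seq position :=
  if n is n.+1 then
    let T' := [seq x <- T | may T x] in
    if size T' == size T then T else shrink may n T'
  else T.

Section Check.
Variable tc : seq bool.

Definition board_permissible (b : board) (d : mode) (vE vt : position) : bool :=
  if d is Row_mode then code_ge tc (nth (0, 0) (board_rows b) vE.1) (nth (0, 0) (board_rows b) vt.1)
  else code_ge tc (nth (0, 0) (board_cols b) vt.2) (nth (0, 0) (board_cols b) vE.2).

(* One round of the main loop. The bounds on the iterations were found by experiment; they need
   no justification since [depth_ok] and [erasure_ok] check the results. *)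
Definition phase (b : board) (ct : seq (seq status)) (v : position) : option board :=
  let t := board_stat b in
  let ri := lines is_identity t in
  let ci := lines is_identity ct in
  let h := depths ri ci 10 v in
  if depth_ok ri v.1 h.1 h.2 && depth_ok ci v.2 h.2 h.1 then
    let rmask := [seq isSome (look h.1 i) | i <- iota 0 (size (board_rows b))] in
    let cmask := [seq isSome (look h.2 j) | j <- iota 0 (size (board_cols b))] in
    let b' := split_board rmask cmask v b in
    let t' := board_stat b' in
    let ct' := transposed (size (board_cols b')) t' in
    let rn := lines is_nonzero t' in
    let ri' := lines is_identity t' in
    let cn := lines is_nonzero ct' in
    let ci' := lines is_identity ct' in
    let nz := flatten [seq [seq (i, j) | j <- rn i] | i <- iota 0 (size t')] in
    let T := shrink (fun T x => may_erase (board_status b') (board_permissible b') rn ri' cn ci' T 3 (x, None)) 8 nz in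
    if erasure_ok (board_status b') (board_permissible b') rn ri' cn ci' T 4 nz then
    Some (erase_board T b') else None
  else None.

Definition first_board : board :=
  let order := order_codes tc in
  Board (rev order) order
    [seq [seq if code_ge tc c r then Unprocessed else Strongly_zero | c <- order] | r <- rev order].

(** Listed column by column and downwards in each column, so the pivot is the last entry, which
    [last_candidate] verifies. *)
Definition pivot_candidates (ct : seq (seq status)) : seq position :=
  flatten [seq [seq (i, j) | i <- lines is_unprocessed ct j] | j <- iota 0 (size ct)].

Definition last_candidate (u : position) (us : seq position) : bool :=
  all (fun w => (w.2 < u.2)%N || (w.2 == u.2) && (w.1 <= u.1)%N) us.

Fixpoint check (n : nat) (b : board) : bool :=
  let ct := transposed (size (board_cols b)) (board_stat b) in
  if pivot_candidates ct is u :: us then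
    let v := last u us in
    if n is n.+1 then
      if last_candidate v (u :: us) then if phase b ct v is Some b' then check n b' else false else false
    else false
  else true.

End Check.

Section Boards.
Variables (K : fieldType) (m : nat) (tau : 'I_m -> direction) (R C : nat).
Implicit Types (s : block_matrix K m R C) (b : board).

Local Notation codes_of t := [seq code x.1 | x : part m <- t].

(* The blocks of [D] have been erased since [b] was reached. *)
Record matches (D : seq position) s b : Prop := Matches {
  match_rows : board_rows b = codes_of (rows s);
  match_cols : board_cols b = codes_of (cols s);
  match_height : size (board_stat b) = size (rows s);
  match_width : all (fun row => size row == size (cols s)) (board_stat b);
  match_stat : forall v, in_range s v -> stat s v = if v \in D then Zero else board_status b v }.

Section Environment.
Variables (D : seq position) (s : block_matrix K m R C) (b : board).
Hypothesis sb : matches D s b.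
Let t := board_stat b.
Let ct := transposed (size (board_cols b)) t.

Lemma match_row_lines p i j : (j \in lines p t i) = in_range s (i, j) && p (board_status b (i, j)).
Proof.
rewrite mem_lines /in_range /board_status /= (match_height sb) -andbA.
case lt_i: (i < _)%N => //=; have /(all_nthP [::])/(_ i) := match_width sb.
by rewrite (match_height sb) lt_i => /(_ isT)/eqP ->.
Qed.

Lemma match_col_lines p i j : (i \in lines p ct j) = in_range s (i, j) && p (board_status b (i, j)).
Proof.
have sz : size (board_cols b) = size (cols s) by rewrite (match_cols sb) size_map.
have width : all (fun row => size row == size (board_cols b)) t by rewrite sz; apply: match_width sb.
have ht : size t = size (rows s) := match_height sb.
rewrite mem_lines /in_range /board_status /= size_transposed // sz.
case lt_j: (j < _)%N => //=; last by rewrite andbF.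
rewrite (size_nth_transposed width) ?sz // ht andbT.
by case lt_i: (i < _)%N => //=; rewrite (nth_transposed width) ?sz // ht.
Qed.

Lemma match_permissible d v w : in_range s v -> in_range s w ->
  board_permissible (tcode tau) b d v w = permissible tau s d v w.
Proof.
have lab (u : seq (part m)) i : (i < size u)%N -> nth (0, 0)%N (codes_of u) i = code (part_label u i).
  by move=> lt_i; rewrite (nth_map (part0 m)).
move=> /andP[v1 v2] /andP[w1 w2].
by case: d => /=; rewrite ?(match_rows sb) ?(match_cols sb) code_geE !lab.
Qed.

Lemma match_env T : {subset D <= T} ->
  env_ok tau s (board_status b) (board_permissible (tcode tau) b)
    (lines is_nonzero t) (lines is_identity t) (lines is_nonzero ct) (lines is_identity ct) T D.
Proof.
move=> DT; split=> //; try by move=> i j; first [exact: match_row_lines|exact: match_col_lines].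
  exact: match_stat sb.
exact: match_permissible.
Qed.

Lemma match_nonzeros v :
  (v \in flatten [seq [seq (i, j) | j <- lines is_nonzero t i] | i <- iota 0 (size t)]) =
  in_range s v && is_nonzero (board_status b v).
Proof.
case: v => i j; rewrite -match_row_lines; apply/flatten_mapP/idP => [[i' _ /mapP[j' h [-> ->]]]//|h].
by exists i; [move: h; rewrite mem_lines mem_iota => /andP[]|apply: map_f].
Qed.

Lemma match_candidates v : (v \in pivot_candidates ct) = in_range s v && is_unprocessed (board_status b v).
Proof.
case: v => i j; rewrite -match_col_lines.
apply/flatten_mapP/idP => [[j' _ /mapP[i' h [-> ->]]]//|h].
by exists j; [move: h; rewrite mem_lines mem_iota => /andP[]|apply: (map_f (fun i => (i, j)))].
Qed.

End Environment.

Lemma erase_matches T s b : (forall v, v \in T -> is_nonzero (board_status b v)) ->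
  matches T s b -> matches [::] s (erase_board T b).
Proof.
move=> T_nz [row_b col_b height width st].
have width_nth i : (i < size (rows s))%N -> size (nth [::] (board_stat b) i) = size (cols s).
  by move=> lt_i; have /(all_nthP [::])/(_ i) := width; rewrite height lt_i => /(_ isT)/eqP.
have nth_row i : (i < size (rows s))%N -> nth [::] (board_stat (erase_board T b)) i =
    [seq if is_nonzero y.2 then (if (i, y.1) \in T then Zero else y.2) else y.2
         | y <- zip (iota 0 (size (nth [::] (board_stat b) i))) (nth [::] (board_stat b) i)].
  move=> lt_i; rewrite /erase_board /= (nth_map (0, [::])%N) ?size_zip ?size_iota ?minnn ?height //.
  by rewrite nth_zip ?size_iota ?height // nth_iota ?height.
have sz : size (board_stat (erase_board T b)) = size (rows s).
  by rewrite size_map size_zip size_iota minnn.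
split=> //.
  apply/(all_nthP [::]) => i; rewrite sz => lt_i.
  by rewrite nth_row // size_map size_zip size_iota minnn width_nth.
move=> v v_in; rewrite in_nil st //; have /andP[v1 v2] := v_in.
rewrite /board_status nth_row // (nth_map (0, Strongly_zero)%N) ?size_zip ?size_iota ?minnn ?width_nth //.
rewrite nth_zip ?size_iota ?width_nth // nth_iota ?width_nth //= add0n -surjective_pairing.
rewrite -/(board_status b v); case: ifP => [vT|]; first by rewrite T_nz.
by rewrite if_same.
Qed.

Lemma eq_pieces (S S' : pred nat) n : (forall i, (i < n)%N -> S i = S' i) -> pieces S n = pieces S' n.
Proof. by move=> SS'; congr flatten; apply/eq_in_map => i; rewrite mem_iota => /SS' ->. Qed.

Lemma split_matches s b v r (rmask cmask : seq bool) : matches [::] s b ->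
  rmask = [seq `[< split_row s v i >] | i <- iota 0 (size (rows s))] ->
  cmask = [seq `[< split_col s v j >] | j <- iota 0 (size (cols s))] ->
  matches [::] (split_at s v r) (split_board rmask cmask v b).
Proof.
move=> [row_b col_b height width st] rE cE.
have width_nth i : (i < size (rows s))%N -> size (nth [::] (board_stat b) i) = size (cols s).
  by move=> lt_i; have /(all_nthP [::])/(_ i) := width; rewrite height lt_i => /(_ isT)/eqP.
have size_r : size rmask = size (rows s) by rewrite rE size_map size_iota.
have size_c : size cmask = size (cols s) by rewrite cE size_map size_iota.
set SR := fun i => `[< split_row s v i >] in rE; set SC := fun j => `[< split_col s v j >] in cE.
have prE : pieces (nth false rmask) (size rmask) = pieces SR (size (rows s)).
  by rewrite size_r; apply: eq_pieces => i lt_i; rewrite rE (nth_map 0%N) ?size_iota // nth_iota.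
have pcE : pieces (nth false cmask) (size cmask) = pieces SC (size (cols s)).
  by rewrite size_c; apply: eq_pieces => i lt_i; rewrite cE (nth_map 0%N) ?size_iota // nth_iota.
have dupr T (d : T) u : size u = size (rows s) -> dup rmask u = [seq nth d u x.1 | x <- pieces SR (size (rows s))].
  by move=> sz; rewrite -sz -(dupE d) sz rE.
have dupc T (d : T) u : size u = size (cols s) -> dup cmask u = [seq nth d u x.1 | x <- pieces SC (size (cols s))].
  by move=> sz; rewrite -sz -(dupE d) sz cE.
have lab S (u : seq (part m)) : [seq nth (0, 0)%N (codes_of u) x.1 | x <- pieces S (size u)] =
    codes_of (split_parts S r u).
  rewrite /split_parts -map_comp; apply/eq_in_map => x.
  rewrite -[pieces _ _]/(pieces_from _ 0 _) mem_pieces_from add0n => /andP[lt_x _] /=.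
  by rewrite (nth_map (part0 m)).
set d := (0, false)%N; set pr := pieces SR (size (rows s)) in prE dupr *; set pc := pieces SC (size (cols s)) in pcE dupc *.
have row_size i : (i < size pr)%N -> ((nth d pr i).1 < size (rows s))%N.
  by move=> lt_i; have [] := mem_piece lt_i.
have col_size i : (i < size pc)%N -> ((nth d pc i).1 < size (cols s))%N.
  by move=> lt_i; have [] := mem_piece lt_i.
have size_dupr T (u : seq T) (x0 : T) : size u = size (rows s) -> size (dup rmask u) = size pr.
  by move=> sz; rewrite (dupr _ x0) // size_map.
have size_dupc T (u : seq T) (x0 : T) : size u = size (cols s) -> size (dup cmask u) = size pc.
  by move=> sz; rewrite (dupc _ x0) // size_map.
have nth_row i : (i < size pr)%N -> nth [::] (board_stat (split_board rmask cmask v b)) i =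
   [seq piece_status (if (nth d pr i).1 == v.1 then y.1.1 == v.2 else false) (nth d pr i).2 y.1.2 y.2
     | y <- zip pc (dup cmask (nth [::] (board_stat b) (nth d pr i).1))].
  move=> lt_i; rewrite /split_board /= prE pcE (nth_map (d, [::])) ?size_zip ?(size_dupr _ _ [::]) ?minnn //.
by rewrite nth_zip ?(size_dupr _ _ [::]) //= (dupr (seq status) [::]) // (nth_map d).
have sz : size (board_stat (split_board rmask cmask v b)) = size (rows (split_at s v r)).
  by rewrite /split_board /= prE size_map size_zip (size_dupr _ _ [::]) // minnn size_map.
split=> //.
- by rewrite /= (dupr _ (0, 0)%N) ?row_b ?size_map // lab.
- by rewrite /= (dupc _ (0, 0)%N) ?col_b ?size_map // lab.
- apply/(all_nthP [::]) => i; rewrite sz [size _]size_map => lt_i.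
  by rewrite nth_row // size_map size_zip (size_dupc _ _ Strongly_zero) ?width_nth ?row_size // minnn [size (cols _)]size_map.
move=> w w_in; have [w1 w2] := split_in_range w_in.
rewrite in_nil split_statE /= /board_status nth_row // (nth_map (d, Strongly_zero)) ?size_zip ?(size_dupc _ _ Strongly_zero) ?width_nth ?row_size ?minnn //.
rewrite nth_zip ?(size_dupc _ _ Strongly_zero) ?width_nth ?row_size //= (dupc status Strongly_zero) ?width_nth ?row_size // (nth_map d) //.
rewrite -/SR -/SC -/pr -/pc; set x := nth d pr w.1; set y := nth d pc w.2.
have -> : stat s (x.1, y.1) = board_status b (x.1, y.1).
  by rewrite st // /in_range row_size // col_size.
rewrite /piece_status /board_status -[_ == v]/(_ && _) /=.
by case: eqP.
Qed.

Lemma first_matches (ell : ivl m -> int) (M : repCL K tau) s :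
  AR_grading K tau ell -> (m <= 3)%N -> block_matrix_problem ell M s ->
  matches [::] s (first_board (tcode tau)).
Proof.
move=> ell_grading m3 [[mV [mW [colsE rowsE]]] _ _ _ stE].
have ord := order_codesE ell_grading m3.
have row_b : board_rows (first_board (tcode tau)) = codes_of (rows s).
  by rewrite rowsE -map_comp /= -ord map_rev.
have col_b : board_cols (first_board (tcode tau)) = codes_of (cols s).
  by rewrite colsE -map_comp /= -ord.
have szc : size (order_codes (tcode tau)) = size (cols s) by have := congr1 size col_b; rewrite size_map.
have szr : size (rev (order_codes (tcode tau))) = size (rows s) by have := congr1 size row_b; rewrite size_map.
have lab (u : seq (part m)) i : (i < size u)%N -> nth (0, 0)%N (codes_of u) i = code (part_label u i).
  by move=> lt_i; rewrite (nth_map (part0 m)).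
split=> //; first by rewrite size_map.
  by rewrite all_map; apply/allP => x _ /=; rewrite size_map szc.
move=> v v_in; rewrite in_nil stE // /strongly_zero code_geE; have /andP[v1 v2] := v_in.
rewrite /board_status /= (nth_map (0, 0)%N) ?szr // (nth_map (0, 0)%N) ?szc //.
rewrite -[rev _]/(board_rows (first_board (tcode tau))) row_b lab //.
rewrite -[order_codes _]/(board_cols (first_board (tcode tau))) col_b lab //.
by case: code_ge.
Qed.

End Boards.

Local Open Scope ring_scope.

(** * Runs of the reduction *)

Definition call_code (c : fix_call) : bool * position :=
  match c with Col_fix u => (true, u) | Row_fix u => (false, u) end.

Lemma call_codeK : cancel call_code (fun x => if x.1 then Col_fix x.2 else Row_fix x.2).
Proof. by case. Qed.
HB.instance Definition _ := Equality.copy fix_call (can_type call_codeK).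

Section Safety.
Variables (K : fieldType) (m : nat) (tau : 'I_m -> direction) (R C : nat).
Variable good : block_matrix K m R C -> Prop.

(** Being inductive, [safe] excludes infinite runs; its two constructors add that a run cannot get
    stuck and that a finished configuration is good. *)
Inductive safe (c : config K m R C) : Prop :=
| Safe_finished : finished c -> good c.2 -> (forall c', step tau c c' -> safe c') -> safe c
| Safe_step : ~ finished c -> (exists c', step tau c c') ->
    (forall c', step tau c c' -> safe c') -> safe c.

Lemma safe_terminates c : safe c -> terminates tau c /\
  forall c', reachable tau c c' -> finished c' -> good c'.2.
Proof.
have reach c1 c2 : reachable tau c1 c2 -> safe c1 -> safe c2.
  by elim=> [x y xy [_ _ h|_ _ h]|x|x y z _ IH1 _ IH2]; [exact: h|exact: h|by []|move/IH1/IH2].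
move=> c_safe; split=> [|c' /reach /(_ c_safe)[]//]; split=> [|c' /reach /(_ c_safe)[|]]; try by [left|right].
by elim: c_safe => {}c _ _ _ IH; constructor.
Qed.

Implicit Types s : block_matrix K m R C.

Lemma step_main_inv s c : step tau (Main_loop, s) c -> exists v P Q r fr fc,
  [/\ pivot s v, inner (rows s) v.1 P /\ inner (cols s) v.2 Q, echelon_block s (P *m mat s *m Q) v r,
     perm_eq fr (row_side_effect s v) /\ perm_eq fc (col_side_effect s v)
   & c = (Fixing ([seq Col_fix u | u <- fr] ++ [seq Row_fix u | u <- fc]) v r, set_mat s (P *m mat s *m Q))].
Proof. by move=> st; inversion st; subst; exists v, P, Q, r, fr, fc. Qed.

Lemma step_col_fix_inv s u calls v r c : step tau (Fixing (Col_fix u :: calls) v r, s) c -> exists Q us,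
  [/\ inner (cols s) u.2 Q, identity_block s (mat s *m Q) u, perm_eq us (col_side_effect s u)
   & c = (Fixing ([seq Row_fix w | w <- us] ++ calls) v r, set_mat s (mat s *m Q))].
Proof. by move=> st; inversion st; subst; exists Q, us. Qed.

Lemma step_row_fix_inv s u calls v r c : step tau (Fixing (Row_fix u :: calls) v r, s) c -> exists P us,
  [/\ inner (rows s) u.1 P, identity_block s (P *m mat s) u, perm_eq us (row_side_effect s u)
   & c = (Fixing ([seq Col_fix w | w <- us] ++ calls) v r, set_mat s (P *m mat s))].
Proof. by move=> st; inversion st; subst; exists P, us. Qed.

Lemma step_split_inv s v r c : step tau (Fixing [::] v r, s) c -> c = (Erasing, split_at s v r).
Proof. by move=> st; inversion st. Qed.

Lemma step_erase_inv s c : step tau (Erasing, s) c ->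
  (exists vt p vis A, [/\ in_range s vt, is_nonzero (stat s vt), erasable tau s vt None [::] (Some p) vis,
     process tau s p (mat s) A & c = (Erasing, set_zero (set_mat s A) vt)]) \/
  (forall vt, in_range s vt -> is_nonzero (stat s vt) -> exists vis, erasable tau s vt None [::] None vis) /\
  c = (Main_loop, s).
Proof. by move=> st; inversion st; subst; [left; exists vt, p, vis, A|right]. Qed.

Section Fix.
Variables (s : block_matrix K m R C) (v : position) (r H : nat).
Hypotheses (sR : total_size (rows s) = R) (sC : total_size (cols s) = C).
Variables (row_identity col_identity : nat -> seq nat) (hr hc : nat -> option nat).
Hypothesis mem_row_identity : forall i j,
  (j \in row_identity i) = in_range s (i, j) && is_identity (stat s (i, j)).
Hypothesis mem_col_identity : forall i j,
  (i \in col_identity j) = in_range s (i, j) && is_identity (stat s (i, j)).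
Hypotheses (row_forest : forest row_identity v.1 hr hc) (col_forest : forest col_identity v.2 hc hr).
Hypotheses (hr_le : forall i d, hr i = Some d -> (d <= H)%N) (hc_le : forall j d, hc j = Some d -> (d <= H)%N).

Definition call_block (c : fix_call) : position := (call_code c).2.

Definition call_depth (c : fix_call) : nat :=
  match c with Col_fix u => odflt 0 (hr u.1) | Row_fix u => odflt 0 (hc u.2) end%N.

(** The line on which the call operates is one step farther from the pivot than the line through
    which its block was reached. *)
Definition call_ok (c : fix_call) : Prop :=
  let u := call_block c in
  [/\ in_range s u, stat s u = Identity & exists d,
    match c with
    | Col_fix u => hr u.1 = Some d /\ hc u.2 = Some d.+1
    | Row_fix u => hc u.2 = Some d /\ hr u.1 = Some d.+1
    end].

(** During the fixing calls an identity block may be merely invertible, but then a call that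
    restores it is on the stack. *)
Record fix_ok (calls : seq fix_call) (A : 'M[K]_(R, C)) : Prop := FixOk {
  fix_masked : masked tau s A;
  fix_iso : isomorphic (block_arrow tau s) (block_arrow tau (set_mat s A));
  fix_echelon : echelon_block s A v r;
  fix_zero : forall u, in_range s u -> stat s u = Zero -> zero_block s A u;
  fix_identity : forall u, in_range s u -> stat s u = Identity ->
    identity_block s A u \/ inv_block s A u /\ u \in [seq call_block c | c <- calls];
  fix_calls : forall c, c \in calls -> call_ok c }.

Lemma row_neighbor u w : w \in row_side_effect s u ->
  [/\ in_range s w, stat s w = Identity, w.1 = u.1 & w.2 != u.2] \/ ~~ in_range s u.
Proof.
rewrite mem_row_line; case/and4P => /eqP e1 w2 ne w_id; have [u_in|] := boolP (in_range s u); last by right.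
left; split=> //; first by rewrite /in_range e1 w2 andbT; case/andP: u_in.
  by case: (stat s w) w_id.
by apply: contraNneq ne => e2; case: u w e1 e2 {w2 w_id u_in} => u1 u2 [w1 w2] /= -> ->.
Qed.

Lemma row_neighborP u w : in_range s w -> stat s w = Identity -> w.1 = u.1 -> w <> u ->
  w \in row_side_effect s u.
Proof. by move=> /andP[_ w2] w_id e1 /eqP ne; rewrite mem_row_line e1 eqxx w2 ne w_id. Qed.

Lemma col_neighbor u w : w \in col_side_effect s u ->
  [/\ in_range s w, stat s w = Identity, w.2 = u.2 & w.1 != u.1] \/ ~~ in_range s u.
Proof.
rewrite mem_col_line; case/and4P => /eqP e1 w2 ne w_id; have [u_in|] := boolP (in_range s u); last by right.
left; split=> //; first by rewrite /in_range e1 w2; case/andP: u_in.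
  by case: (stat s w) w_id.
by apply: contraNneq ne => e2; case: u w e1 e2 {w2 w_id u_in} => u1 u2 [w1 w2] /= -> ->.
Qed.

Lemma col_neighborP u w : in_range s w -> stat s w = Identity -> w.2 = u.2 -> w <> u ->
  w \in col_side_effect s u.
Proof. by move=> /andP[w1 _] w_id e1 /eqP ne; rewrite mem_col_line e1 eqxx w1 ne w_id. Qed.

Lemma row_ident w : in_range s w -> stat s w = Identity -> w.2 \in row_identity w.1.
Proof. by move=> w_in w_id; rewrite mem_row_identity -surjective_pairing w_in w_id. Qed.

Lemma col_ident w : in_range s w -> stat s w = Identity -> w.1 \in col_identity w.2.
Proof. by move=> w_in w_id; rewrite mem_col_identity -surjective_pairing w_in w_id. Qed.

Lemma call_block_cat (f : position -> fix_call) us calls : (forall u, call_block (f u) = u) ->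
  [seq call_block c | c <- [seq f w | w <- us] ++ calls] = us ++ [seq call_block c | c <- calls].
Proof. by move=> fK; rewrite map_cat -map_comp (eq_map (g := id)) ?map_id. Qed.

(** The column of [u] has positive depth, so it is not that of the pivot. Its other identity blocks
    are spoilt and receive the new calls. The row of [u] is the only parent of this column, so the
    rows of these blocks lie deeper. *)
Lemma fix_col u calls A Q us : fix_ok (Col_fix u :: calls) A -> inner (cols s) u.2 Q ->
  identity_block s (A *m Q) u -> perm_eq us (col_side_effect s u) ->
  fix_ok ([seq Row_fix w | w <- us] ++ calls) (A *m Q).
Proof.
move=> [mA isoA ech zero ident ok] inner_Q id_u p_us.
have [u_in u_id [d [hr_u hc_u]]] := ok _ (mem_head _ _).
have uv : v.2 != u.2 by apply/eqP=> E; move: hc_u; rewrite -E (forest_root col_forest).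
have same w : w.2 != u.2 -> blk s (A *m Q) w = blk s A w by apply: (blk_col_op sC).
split.
- exact: masked_col_op inner_Q mA.
- exact: isomorphic_trans isoA (iso_col_op sC inner_Q mA).
- by move/(echelon_blockP sR sC): ech => [le_r E]; apply/(echelon_blockP sR sC); rewrite same.
- by move=> w w_in w_z; apply: (zero_col_op sR sC inner_Q); apply: zero.
- move=> w w_in w_id; rewrite call_block_cat // mem_cat.
  have [->|/eqP wu] := eqVneq w u; first by left.
  have [e2|ne2] := eqVneq w.2 u.2.
    right; split; last by rewrite (perm_mem p_us) col_neighborP.
    apply: (inv_col_op sC inner_Q).
    by case: (ident w w_in w_id) => [/(identity_inv sR sC)|[]].
  case: (ident w w_in w_id) => [id_w|[inv_w w_calls]].
    by left; apply: (identity_block_same sR sC _ id_w); rewrite same.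
  right; split; first by apply: (inv_col_op sC inner_Q).
  by move: w_calls; rewrite inE => /predU1P[//|->]; rewrite orbT.
move=> c; rewrite mem_cat => /orP[/mapP[w]|cc]; last by apply: ok; rewrite inE cc orbT.
rewrite (perm_mem p_us) => /col_neighbor[|/negP//] [w_in w_id e2 ne1] ->.
split=> //; exists d.+1; rewrite /= e2; split=> //.
have w_next : w.1 \in col_identity u.2 by rewrite -e2 col_ident.
case: (forest_next col_forest hc_u w_next) => [//|[e [<-] hr_w]].
by case/eqP: ne1; apply: (forest_parent_eq col_forest hc_u w_next _ hr_w hr_u); apply: col_ident.
Qed.

Lemma fix_row u calls A P us : fix_ok (Row_fix u :: calls) A -> inner (rows s) u.1 P ->
  identity_block s (P *m A) u -> perm_eq us (row_side_effect s u) ->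
  fix_ok ([seq Col_fix w | w <- us] ++ calls) (P *m A).
Proof.
move=> [mA isoA ech zero ident ok] inner_P id_u p_us.
have [u_in u_id [d [hc_u hr_u]]] := ok _ (mem_head _ _).
have uv : v.1 != u.1 by apply/eqP=> E; move: hr_u; rewrite -E (forest_root row_forest).
have same w : w.1 != u.1 -> blk s (P *m A) w = blk s A w by apply: (blk_row_op sR).
split.
- exact: masked_row_op inner_P mA.
- exact: isomorphic_trans isoA (iso_row_op sR inner_P mA).
- by move/(echelon_blockP sR sC): ech => [le_r E]; apply/(echelon_blockP sR sC); rewrite same.
- by move=> w w_in w_z; apply: (zero_row_op sR sC inner_P); apply: zero.
- move=> w w_in w_id; rewrite call_block_cat // mem_cat.
  have [->|/eqP wu] := eqVneq w u; first by left.
  have [e2|ne2] := eqVneq w.1 u.1.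
    right; split; last by rewrite (perm_mem p_us) row_neighborP.
    apply: (inv_row_op sR inner_P).
    by case: (ident w w_in w_id) => [/(identity_inv sR sC)|[]].
  case: (ident w w_in w_id) => [id_w|[inv_w w_calls]].
    by left; apply: (identity_block_same sR sC _ id_w); rewrite same.
  right; split; first by apply: (inv_row_op sR inner_P).
  by move: w_calls; rewrite inE => /predU1P[//|->]; rewrite orbT.
move=> c; rewrite mem_cat => /orP[/mapP[w]|cc]; last by apply: ok; rewrite inE cc orbT.
rewrite (perm_mem p_us) => /row_neighbor[|/negP//] [w_in w_id e2 ne1] ->.
split=> //; exists d.+1; rewrite /= e2; split=> //.
have w_next : w.2 \in row_identity u.1 by rewrite -e2 row_ident.
case: (forest_next row_forest hr_u w_next) => [//|[e [<-] hc_w]].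
by case/eqP: ne1; apply: (forest_parent_eq row_forest hr_u w_next _ hc_w hc_u); apply: row_ident.
Qed.

Lemma fix_start P Q fr fc : masked tau s (mat s) -> in_range s v -> stat s v = Unprocessed ->
  (forall u, in_range s u -> agrees s (mat s) u (stat s u)) ->
  inner (rows s) v.1 P -> inner (cols s) v.2 Q -> echelon_block s (P *m mat s *m Q) v r ->
  perm_eq fr (row_side_effect s v) -> perm_eq fc (col_side_effect s v) ->
  fix_ok ([seq Col_fix u | u <- fr] ++ [seq Row_fix u | u <- fc]) (P *m mat s *m Q).
Proof.
move=> mA v_in v_st ag inner_P inner_Q ech p_fr p_fc.
have mPA := masked_row_op inner_P mA.
have nv w : stat s w = Identity -> w <> v by move=> w_id E; rewrite E v_st in w_id.
have callsE : [seq call_block c | c <- [seq Col_fix u | u <- fr] ++ [seq Row_fix u | u <- fc]] = fr ++ fc.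
  by rewrite call_block_cat // -map_comp (eq_map (g := id)) ?map_id.
split=> //.
- exact: masked_col_op inner_Q mPA.
- apply: isomorphic_trans (iso_col_op sC inner_Q mPA).
  have iso_s : isomorphic (block_arrow tau s) (block_arrow tau (set_mat s (mat s))) by exact: isomorphic_refl.
  exact: isomorphic_trans iso_s (iso_row_op sR inner_P mA).
- move=> w w_in w_z; apply: (zero_col_op sR sC inner_Q); apply: (zero_row_op sR sC inner_P).
  by have := ag w w_in; rewrite w_z.
- move=> w w_in w_id; rewrite callsE mem_cat (perm_mem p_fr) (perm_mem p_fc).
  have id_w : identity_block s (mat s) w by have := ag w w_in; rewrite w_id.
  have inv_w : inv_block s (P *m mat s *m Q) w.
    by apply: (inv_col_op sC inner_Q); apply: (inv_row_op sR inner_P); apply: identity_inv.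
  have [e1|ne1] := eqVneq w.1 v.1; first by right; rewrite row_neighborP //; apply: nv.
  have [e2|ne2] := eqVneq w.2 v.2; first by right; rewrite col_neighborP ?orbT //; apply: nv.
  by left; apply: (identity_block_same sR sC _ id_w); rewrite (blk_col_op sC _ inner_Q) // (blk_row_op sR _ inner_P).
move=> c; rewrite mem_cat => /orP[] /mapP[w].
  rewrite (perm_mem p_fr) => /row_neighbor[|/negP//] [w_in w_id e1 _] ->.
  split=> //; exists 0%N; rewrite /= e1 (forest_root row_forest); split=> //.
  have := forest_next row_forest (forest_root row_forest) (j := w.2).
  by rewrite -e1 row_ident // => /(_ isT)[|[]].
rewrite (perm_mem p_fc) => /col_neighbor[|/negP//] [w_in w_id e2 _] ->.
split=> //; exists 0%N; rewrite /= e2 (forest_root col_forest); split=> //.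
have := forest_next col_forest (forest_root col_forest) (j := w.1).
by rewrite -e2 col_ident // => /(_ isT)[|[]].
Qed.

Lemma call_depth_le c : (call_depth c <= H)%N.
Proof.
case: c => u /=; first by case E: (hr u.1) => //=; apply: hr_le E.
by case E: (hc u.2) => //=; apply: hc_le E.
Qed.

(** A call is replaced by calls one step deeper and depths are bounded by [H]; hence an induction on
    the remaining depth [k] and, inside it, on the list of calls. [rest] is the part of the stack
    below them. *)
Lemma fix_safe k calls rest A : (forall c, c \in calls -> (H < call_depth c + k)%N) ->
  (forall A', fix_ok rest A' -> safe (Fixing rest v r, set_mat s A')) ->
  fix_ok (calls ++ rest) A -> safe (Fixing (calls ++ rest) v r, set_mat s A).
Proof.
elim: k calls rest A => [|k IHk] calls rest A.
  case: calls => [_ h /h //|c calls /(_ c (mem_head _ _))].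
  by rewrite addn0 ltnNge call_depth_le.
elim: calls A => [|c calls IHc] A deep next A_ok; first exact: next A_ok.
have deep' c' : c' \in calls -> (H < call_depth c' + k.+1)%N by move=> cc; apply: deep; rewrite inE cc orbT.
have [c_in c_id [d c_d]] := fix_calls A_ok (mem_head _ _).
have inv_c : inv_block s A (call_block c).
  by case: (fix_identity A_ok c_in c_id) => [/(identity_inv sR sC)|[]].
have c_deep := deep c (mem_head _ _).
have cont calls1 A' : (forall c', c' \in calls1 -> call_depth c' = (call_depth c).+1) ->
    fix_ok (calls1 ++ calls ++ rest) A' -> safe (Fixing (calls1 ++ calls ++ rest) v r, set_mat s A').
  move=> deep1; apply: IHk => [c' /deep1 ->|A'' A''_ok]; first by rewrite addSnnS.
  exact: IHc A''_ok.
case: c A_ok c_in c_id c_d inv_c c_deep cont {deep} => u A_ok u_in u_id [hr_u hc_u] inv_u u_deep cont.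
- apply: Safe_step => [[]//||c' st].
    have [Q inner_Q id_u] := col_fix_exists sR sC inv_u.
    by eexists; apply: (@Step_col_fix K m tau R C (set_mat s A) u (calls ++ rest) v r Q _ inner_Q id_u (perm_refl _)).
  have [Q [us [inner_Q id_u p_us ->]]] := step_col_fix_inv st.
  apply: cont; last exact: fix_col A_ok inner_Q id_u p_us.
  move=> c2 /mapP[w]; rewrite (perm_mem p_us) => /col_neighbor[|/negP//] [_ _ /= e2 _] ->.
  by rewrite /= e2 hc_u hr_u.
apply: Safe_step => [[]//||c' st].
  have [P inner_P id_u] := row_fix_exists sR sC inv_u.
  by eexists; apply: (@Step_row_fix K m tau R C (set_mat s A) u (calls ++ rest) v r P _ inner_P id_u (perm_refl _)).
have [P [us [inner_P id_u p_us ->]]] := step_row_fix_inv st.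
apply: cont; last exact: fix_row A_ok inner_P id_u p_us.
move=> c2 /mapP[w]; rewrite (perm_mem p_us) => /row_neighbor[|/negP//] [_ _ /= e2 _] ->.
by rewrite /= e2 hc_u hr_u.
Qed.

End Fix.
End Safety.

Lemma look_le h i d : look h i = Some d -> (d <= sumn [seq x.2 | x <- h])%N.
Proof.
move/look_mem; elim: h => //= x h IH; rewrite inE => /predU1P[<-|/IH le_d]; first exact: leq_addr.
exact: leq_trans le_d (leq_addl _ _).
Qed.

(** * Simulation of the runs on boards *)

Section Simulation.
Variables (K : fieldType) (m : nat) (tau : 'I_m -> direction) (R C : nat).
Variable s0 : block_matrix K m R C.
Implicit Types s : block_matrix K m R C.
Local Notation tc := (tcode tau).

Record state_ok s : Prop := StateOk {
  state_R : total_size (rows s) = R;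
  state_C : total_size (cols s) = C;
  state_masked : masked tau s (mat s);
  state_iso : isomorphic (block_arrow tau s0) (block_arrow tau s);
  state_strongly_zero : forall v, in_range s v -> stat s v = Strongly_zero -> strongly_zero tau s v;
  state_agrees : forall v, in_range s v -> agrees s (mat s) v (stat s v) }.

Definition solved s : Prop := reduced tau s /\ isomorphic (block_arrow tau s0) (block_arrow tau s).

Lemma state_solved s : state_ok s -> (forall v, ~ unprocessed s v) -> solved s.
Proof.
move=> [sR sC mA iso_s sz ag] fin; split=> // v v_in; have := ag v v_in; have := sz v v_in.
case st_v: (stat s v) => //=; last by case: (fin v).
move=> /(_ erefl) v_sz _; split=> //; apply/(zero_blockP sR sC).
exact: (masked_strongly_zero sR sC mA v_sz).
Qed.

Section Erase.
Variables (b : board) (T : seq position).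
Let t := board_stat b.
Let ct := transposed (size (board_cols b)) t.
Hypothesis T_ok : erasure_ok (board_status b) (board_permissible tc b)
  (lines is_nonzero t) (lines is_identity t) (lines is_nonzero ct) (lines is_identity ct) T 4
  (flatten [seq [seq (i, j) | j <- lines is_nonzero t i] | i <- iota 0 (size t)]).

(** Each erasure moves a block of [T] into [D], which bounds the number of steps, and the phase can
    end only with [D] equal to [T] as a set. So the board after the phase is known, although the
    order of the erasures is not. *)
Lemma erase_safe s D : matches D s b -> {subset D <= T} -> state_ok s ->
  (forall s', state_ok s' -> matches T s' b -> safe tau solved (Main_loop, s')) ->
  safe tau solved (Erasing, s).
Proof.
have [k] := ubnP (count (fun x => x \notin D) T); elim: k s D => // k IH s D le_k sb DT [sR sC mA iso_s sz ag] next.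
have env := match_env tau sb DT; have nzs := match_nonzeros sb.
have TD_or : {subset T <= D} \/ exists2 v, v \in T & v \notin D.
  case E: (all (mem D) T).
    left; exact: (allP E).
  right; have /allPn[v vT vD] := negbT E.
  exists v; [exact: vT|exact: vD].
apply: Safe_step => [[]//||c st].
  case: TD_or => [TD|TD].
    by exists (Main_loop, s); apply: Step_leave => vt; apply: (none_erasable env nzs T_ok TD).
  have [t1 [t1_in t1_nz run_some]] := next_erasable env nzs T_ok TD.
  have [[p|] [vis run]] := erasable_total tau None t1_in (vis := [::]) isT; last by case: (run_some _ _ run).
  have [[A pA] _] := run_effect env nzs T_ok sz sR sC mA ag t1_in t1_nz run.
  by exists (Erasing, set_zero (set_mat s A) t1); apply: Step_erase run pA.
case: (step_erase_inv st) => [[t1 [p [vis [A [t1_in t1_nz run pA ->]]]]]|[none ->]].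
  have t1T := run_in_T env nzs T_ok t1_in t1_nz run.
  have [t1D st_t1] := stat_nonzero env t1_in t1_nz.
  have [_ /(_ A pA)[mA' isoA' agA' zA']] := run_effect env nzs T_ok sz sR sC mA ag t1_in t1_nz run.
  apply: (IH _ (t1 :: D)) => //.
  - by move: le_k; rewrite ltnS; apply: leq_trans; apply: count_notin_cons.
  - case: sb => h1 h2 h3 h4 h5; split=> //= v v_in; rewrite inE; case: eqP => //= _; exact: h5.
  - by move=> v; rewrite inE => /predU1P[->|/DT].
  - split=> //=.
    + exact: isomorphic_trans iso_s isoA'.
    + by move=> v v_in; case: eqP => // _; apply: sz.
    + by move=> v v_in; case: eqP => [->|/eqP ne]; [exact: zA'|exact: agA'].
apply: next => //.
have TD : {subset T <= D}.
  case: TD_or => // /(next_erasable env nzs T_ok)[t1 [t1_in t1_nz run_some]].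
  by have [vis /run_some] := none t1 t1_in t1_nz.
case: sb => h1 h2 h3 h4 h5; split=> // v v_in; rewrite h5 //.
by have -> : (v \in D) = (v \in T) by apply/idP/idP => [/DT|/TD].
Qed.

End Erase.

Section Split.
Variables (s : block_matrix K m R C) (v : position).
Variables (row_identity col_identity : nat -> seq nat) (hr hc : nat -> option nat).
Hypothesis mem_row_identity : forall i j,
  (j \in row_identity i) = in_range s (i, j) && is_identity (stat s (i, j)).
Hypothesis mem_col_identity : forall i j,
  (i \in col_identity j) = in_range s (i, j) && is_identity (stat s (i, j)).
Hypotheses (row_forest : forest row_identity v.1 hr hc) (col_forest : forest col_identity v.2 hc hr).

(** The closure under shared identity blocks is what breadth first search explores: neighbors of a
    line with a depth have a depth, and a line with a depth is reached through its parents. *)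
Lemma split_forest : (forall i, split_row s v i <-> hr i) /\ (forall j, split_col s v j <-> hc j).
Proof.
have to_forest : (forall i, split_row s v i -> hr i) /\ (forall j, split_col s v j -> hc j).
  apply: split_mut => [|i j u_in u_id _||i j u_in u_id _]; rewrite ?(forest_root row_forest) ?(forest_root col_forest) //.
    case hj: (hc j) => [d|//] _.
    by have [|->|[e _ ->]] := forest_next col_forest hj (j := i); rewrite ?mem_col_identity ?u_in.
  case hi: (hr i) => [d|//] _.
  by have [|->|[e _ ->]] := forest_next row_forest hi (j := j); rewrite ?mem_row_identity ?u_in.
have of_forest d : (forall i, hr i = Some d -> split_row s v i) /\ (forall j, hc j = Some d -> split_col s v j).
  elim: d => [|d [IHr IHc]]; split=> [i|j].
  - by move/(forest_root_eq row_forest) ->; apply: Split_row_pivot.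
  - by move/(forest_root_eq col_forest) ->; apply: Split_col_pivot.
  - move/(forest_parent row_forest) => [j]; rewrite mem_row_identity => /andP[u_in u_id] /IHc.
    exact: Split_row_identity.
  - move/(forest_parent col_forest) => [i]; rewrite mem_col_identity => /andP[u_in u_id] /IHr.
    exact: Split_col_identity.
have [r1 c1] := to_forest; split=> x; split; [exact: r1| |exact: c1|].
  by case hx: (hr x) => [d|//] _; have [h _] := of_forest d; apply: h.
by case hx: (hc x) => [d|//] _; have [_ h] := of_forest d; apply: h.
Qed.

End Split.

Lemma candidates_unprocessed b s u : matches [::] s b ->
  u \in pivot_candidates (transposed (size (board_cols b)) (board_stat b)) <-> unprocessed s u.
Proof.
move=> sb; rewrite (match_candidates sb); split=> [/andP[u_in]|[u_in st_u]].
  by case E: (board_status b u) => // _; split=> //; rewrite (match_stat sb).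
by move: st_u; rewrite u_in (match_stat sb) //= => ->.
Qed.

Lemma last_pivot s u us : (forall w, w \in u :: us <-> unprocessed s w) -> last_candidate (last u us) (u :: us) ->
  pivot s (last u us) /\ forall w, pivot s w -> w = last u us.
Proof.
move=> cand /allP max_v; have v_un : unprocessed s (last u us) by apply/cand/mem_last.
split=> [|w [/cand w_un w_max]]; first by split=> // w /cand; apply: max_v.
have := w_max _ v_un; have := max_v _ w_un; case: (w) (last u us) => w1 w2 [v1 v2] /= h1 h2.
by have -> : w1 = v1 by [lia]; have -> : w2 = v2 by lia.
Qed.

Lemma phase_safe b b' v s : phase tc b (transposed (size (board_cols b)) (board_stat b)) v = Some b' ->
  matches [::] s b -> state_ok s -> pivot s v -> (forall w, pivot s w -> w = v) ->
  (forall s', matches [::] s' b' -> state_ok s' -> safe tau solved (Main_loop, s')) ->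
  safe tau solved (Main_loop, s).
Proof.
rewrite /phase; set ct := transposed _ _; set ri := lines is_identity _; set ci := lines is_identity _.
set h := depths _ _ _ _; case: ifP => // /andP[ok_r ok_c].
set rmask := map _ _; set cmask := map _ _; set b1 := split_board _ _ _ _; set T := shrink _ _ _.
case E: erasure_ok => // -[<-] sb s_ok pivot_v pivot_eq next; have T_ok := E; clear E.
have [sR sC mA iso_s sz ag] := s_ok; have [[v_in v_st] _] := pivot_v.
have env := match_env tau sb (T := [::]) (fun _ => id).
have st_s u : in_range s u -> stat s u = board_status b u by move=> u_in; rewrite (match_stat sb).
have mem_ri i j : (j \in ri i) = in_range s (i, j) && is_identity (stat s (i, j)).
  by rewrite (env_row_identity env); case u_in: (in_range s (i, j)) => //=; rewrite st_s.
have mem_ci i j : (i \in ci j) = in_range s (i, j) && is_identity (stat s (i, j)).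
  by rewrite (env_col_identity env); case u_in: (in_range s (i, j)) => //=; rewrite st_s.
have Fr := depth_forest ok_r; have Fc := depth_forest ok_c.
pose H := (sumn [seq x.2 | x <- h.1] + sumn [seq x.2 | x <- h.2])%N.
have hr_le i d : look h.1 i = Some d -> (d <= H)%N by move/look_le => le_d; apply: leq_trans le_d (leq_addr _ _).
have hc_le j d : look h.2 j = Some d -> (d <= H)%N by move/look_le => le_d; apply: leq_trans le_d (leq_addl _ _).
apply: Safe_step => [[_ /(_ v)[]//]||c /step_main_inv[v' [P [Q [r [fr [fc [pivot_v' [inner_P inner_Q] ech [p_fr p_fc] ->]]]]]]]].
  have [P [Q [r [inner_P inner_Q ech]]]] := echelon_exists sR sC (mat s) v.
  by eexists; apply: Step_pivot pivot_v inner_P inner_Q ech (perm_refl _) (perm_refl _).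
have E := pivot_eq _ pivot_v'; subst v'; move: inner_P inner_Q ech p_fr p_fc => inner_P inner_Q ech p_fr p_fc.
have start := fix_start sR sC mem_ri mem_ci Fr Fc mA v_in v_st ag inner_P inner_Q ech p_fr p_fc.
rewrite -[_ ++ _]cats0 in start *.
apply: (fix_safe (k := H.+1) sR sC mem_ri mem_ci Fr Fc hr_le hc_le _ _ start) => [c' _|A A_ok].
  by rewrite addnS ltnS leq_addl.
apply: Safe_step => [[]//||c' /step_split_inv ->]; first by eexists; apply: Step_split.
have [mA' isoA' ech' zero ident _] := A_ok.
pose s1 := set_mat s A.
have ag1 u : in_range s1 u -> agrees s1 (mat s1) u (stat s1 u).
  move=> u_in; case st_u: (stat s1 u) => //=; last exact: zero.
  by case: (ident u u_in st_u) => [//|[]].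
have [sR' sC'] : total_size (rows s1) = R /\ total_size (cols s1) = C by [].
have v_in1 : in_range s1 v := v_in.
have rowE := split_row_line sR' ag1 ech'.
have colE := split_col_line sC' ag1 ech'.
have s2_ok : state_ok (split_at s1 v r).
  split.
  - exact: split_rows_total sR' ag1 ech'.
  - exact: split_cols_total sC' ag1 ech'.
  - by rewrite /masked rowE colE; exact: mA'.
  - have -> : block_arrow tau (split_at s1 v r) = block_arrow tau s1 by rewrite /block_arrow rowE colE.
    exact: isomorphic_trans iso_s isoA'.
  - move=> w w_in; rewrite split_strongly_zero // split_statE /=.
    case: ifP => _; first by case: ifP.
    have := split_old_in_range w_in; set u := (_, _) => u_in.
    by case: ifP => [_|_]; [case: ifP|exact: sz].
  - by move=> w; exact: split_agrees sR' sC' v_in1 ag1 ech' _.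
have [row_split col_split] := split_forest mem_ri mem_ci Fr Fc (s := s1).
have sb1 : matches [::] s1 b by case: sb.
have rmaskE : rmask = [seq `[< split_row s1 v i >] | i <- iota 0 (size (rows s1))].
  rewrite /rmask (match_rows sb) size_map; apply: eq_map => i.
  by apply/idP/asboolP => /row_split.
have cmaskE : cmask = [seq `[< split_col s1 v j >] | j <- iota 0 (size (cols s1))].
  rewrite /cmask (match_cols sb) size_map; apply: eq_map => j.
  by apply/idP/asboolP => /col_split.
have sb2 : matches [::] (split_at s1 v r) b1 by apply: split_matches.
apply: (erase_safe T_ok sb2 _ s2_ok) => // s3 s3_ok sb3; apply: next => //.
apply: erase_matches sb3 => w wT.
have := erased_in (match_nonzeros sb2) T_ok wT.
by case/andP.
Qed.

Lemma no_candidates_safe b s : pivot_candidates (transposed (size (board_cols b)) (board_stat b)) = [::] ->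
  matches [::] s b -> state_ok s -> safe tau solved (Main_loop, s).
Proof.
move=> E sb s_ok; have none w : ~ unprocessed s w by move/(candidates_unprocessed w sb); rewrite E.
apply: Safe_finished => [||c /step_main_inv[w [_ [_ [_ [_ [_ [[w_un _] _ _ _ _]]]]]]]].
- by split.
- exact: state_solved s_ok none.
by case: (none w).
Qed.

Lemma checkE n b : check tc n b =
  let ct := transposed (size (board_cols b)) (board_stat b) in
  if pivot_candidates ct is u :: us then
    if n is n'.+1 then
      if last_candidate (last u us) (u :: us) then
        if phase tc b ct (last u us) is Some b' then check tc n' b' else false
      else false
    else false
  else true.
Proof. by case: n. Qed.

Lemma check_safe n b s : check tc n b -> matches [::] s b -> state_ok s -> safe tau solved (Main_loop, s).
Proof.
elim: n b s => [|n IH] b s; rewrite checkE; cbv zeta; case E: pivot_candidates => [|u us] chk sb s_ok.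
- exact: no_candidates_safe E sb s_ok.
- by move: chk.
- exact: no_candidates_safe E sb s_ok.
move: chk; case max_v: last_candidate => //; case E': phase => [b'|] // chk.
have [|pivot_v pivot_eq] := last_pivot _ max_v (s := s).
  by move=> w; rewrite -E; apply: candidates_unprocessed.
apply: (phase_safe E' sb s_ok pivot_v pivot_eq) => s' s'b' s'_ok.
exact: IH chk s'b' s'_ok.
Qed.

End Simulation.

Local Close Scope ring_scope.

(** Eighty rounds suffice for all fifteen orientations; the cast leaves the computation to the
    kernel at [Qed]. *)
Lemma small_check tc : (size tc <= 3)%N -> check tc 80 (first_board tc).
Proof. by move/mem_small_orientations; move: tc; apply/allP; vm_cast_no_check (erefl true). Qed.

Lemma arrow_iso (D : precat) (X Y : arr D) (f : mor (arr_dom X) (arr_dom Y)) f'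
    (g : mor (arr_cod X) (arr_cod Y)) g' :
  inverse f f' -> inverse g g' -> arr_map Y = ccomp g (ccomp (arr_map X) f') -> isomorphic X Y.
Proof.
move=> [f'f ff'] [g'g gg'] E.
have F1 : (f, g) \in @arr_square D X Y.
  by rewrite unfold_in /arr_square /= E -ccompA -(ccompA _ f') f'f ccompm1.
have F2 : (f', g') \in @arr_square D Y X.
  by rewrite unfold_in /arr_square /= E ccompA g'g ccomp1m.
by exists (ArrHom F1), (ArrHom F2); split; apply: val_inj; congr pair.
Qed.

Theorem theorem1 (K : fieldType) (m : nat) (tau : 'I_m -> direction)
    (CL_finite : finite_type (repCL K tau)) (M : repCL K tau)
    (ell : ivl m -> int) (ell_grading : AR_grading K tau ell)
    (R C : nat) (s0 : block_matrix K m R C)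
    (s0_problem : block_matrix_problem ell M s0) :
  terminates tau (Main_loop, s0) /\
  forall c : config K m R C,
    reachable tau (Main_loop, s0) c -> finished c ->
    [/\ reduced tau c.2,
        isomorphic (block_arrow tau s0) (block_arrow tau c.2),
        exists (J : finType) (X : J -> arr (repA K tau)),
          indecomposable_decomposition X (block_arrow tau c.2)
      & forall (J : finType) (X : J -> arr (repA K tau)),
          indecomposable_decomposition X (block_arrow tau c.2) ->
          exists N : J -> repCL K tau,
            (forall j, ladder_arrow (N j) = X j) /\ indecomposable_decomposition N M].
Proof.
have m3 := finite_type_small CL_finite.
have sb := first_matches ell_grading m3 s0_problem.
have [_ [sR sC] [etaV [etaV' [etaW [etaW' [invV invW M_map]]]]] s0_mask s0_stat] := s0_problem.
have s0_ok : state_ok tau s0 s0.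
  split=> //; first exact: isomorphic_refl.
    by move=> v v_in; rewrite s0_stat //; case: ifP.
  by move=> v v_in; rewrite s0_stat //; case: ifP.
have tc3 : (size (tcode tau) <= 3)%N by rewrite size_tcode.
have [term fin] := safe_terminates (check_safe (small_check tc3) sb s0_ok).
split=> // c /fin {}fin /fin[red iso_c]; split=> //; first exact: arrow_decomposition_exists.
move=> J X [X_ind X_sum]; apply: ladder_decomposition; split=> //.
(* The block matrix problem arises from the arrow of [M] by changing bases in its two rows, which is
   an isomorphism of arrows. *)
have iso_M : isomorphic (ladder_arrow M) (block_arrow tau s0) :=
  arrow_iso (X := ladder_arrow M) (Y := block_arrow tau s0) invV invW M_map.
exact: direct_sum_iso (isomorphic_sym (isomorphic_trans iso_M iso_c)) X_sum.
Qed.
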